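(* Let $s\in(0,1)$ and let $(M,g)$ be a closed, connected, $C^4$-regular Riemannian manifold of dimension $n\ge 2$. Let $O\subset M$ be a non-empty open set and let $\bar L_{s,O}$ be the source-to-solution operator defined in the context. Then for each $\alpha\in\mathbb S^{n-1}$ and each $x_0\in O$ there exist a sequence $(N_{k,\alpha})_{k\in\mathbb N}\subset\mathbb R$ with $N_{k,\alpha}\to\infty$ as $k\to\infty$ and a sequence of smooth functions $(f_{N_{k,\alpha}})_{k\in\mathbb N}$ with $\int_M \frac{1}{\sqrt{\det(g)}}f_{N_{k,\alpha}}\,dV_g=0$ such that $$\lim_{k\to\infty}N_{k,\alpha}^{2s+\frac n2}\Big\langle f_{N_{k,\alpha}},\tfrac{1}{\sqrt{\det(g)}}\bar L_{s,O}(f_{N_{k,\alpha}})\Big\rangle_{H^{-s}(M,dV_g),H^s(M,dV_g)}=\tilde c\,\big(\tilde C_\alpha(g)(x_0)\big)^{-2s},$$ where $$\tilde C_\alpha(g)(x_0):=\sqrt{\sum_{j,\ell=1}^n\det(g(x_0))^{\frac1{2s}}\,g^{-1}_{j\ell}(x_0)\,\alpha_j\alpha_\ell}$$ and $\tilde c=|c_s|^{-1}\hat c_s^{-2}(c_1+c_2)$ with $c_1=\int_0^\infty tK_s^2(t)\,dt$, $c_2=\int_0^\infty tK_{1-s}^2(t)\,dt$, $c_s=-\frac{2^{2s-1}\Gamma(s)}{\Gamma(1-s)}$ and $\hat c_s=2^{-s}\Gamma(1-s)$. The functions $f_{N_{k,\alpha}}$ are independent of $g$ and are supported in $B_{1/N_{k,\alpha}}(x_0)\cap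 M$.
   Context: $\Gamma$ is the Gamma function and $K_\nu$ is the modified Bessel function of the second kind. $dV_g$ is the volume form of $(M,g)$, $-\Delta_g$ its Laplace--Beltrami operator with eigenvalues $0=\lambda_0<\lambda_1\le\lambda_2\le\dots$ and an $L^2(M,dV_g)$-orthonormal basis of eigenfunctions $(\phi_k)_{k\ge0}$; $(u,v)_{L^2(M,dV_g)}=\int_M u\bar v\,dV_g$. For $s\in(0,1)$, $(-\Delta_g)^su:=\sum_{k\ge1}\lambda_k^s(u,\phi_k)_{L^2(M,dV_g)}\phi_k$. Functions may be complex valued and operators are extended complex-linearly. Coordinate convention: $\det(g)$, the entries $g^{-1}_{j\ell}$ of the inverse metric matrix, the vector $\alpha$ and the (Euclidean) balls $B_r(x_0)$ are taken with respect to fixed local coordinates on $O$ near $x_0$, and the functions $f$ considered are supported in this coordinate patch. ''Independent of $g$'' means that, once the coordinates, $\alpha$ and $x_0$ are fixed, the functions can be chosen without reference to the metric. Source-to-solution operator: for $f\in C_c^\infty(O)$ with $\int_M\frac{1}{\sqrt{\det(g)}}f\,dV_g=0$ (in local coordinates: $\int f\,dx=0$), $\bar L_{s,O}(f):=u^f|_O$, where $u^f$ is the solution of $\sqrt{\det(g)}(-\Delta_g)^su^f=f$ in $M$ with $(u^f,1)_{L^2(M,dV_g)}=0$. The duality pairing is $\langle u,v\rangle_{H^{-s}(M,dV_g),H^s(M,dV_g)}=\sum_{k\ge0}(u,\phi_k)_{L^2(M,dV_g)}\overline{(v,\phi_k)_{L^2(M,dV_g)}}$ for smooth functions (extending the $L^2(M,dV_g)$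 product). Since $f$ is compactly supported in $O$, the pairing in the claim only involves $\bar L_{s,O}(f)$ on $O$ and equals $\int_O f\,\overline{\bar L_{s,O}(f)}\,\frac{1}{\sqrt{\det(g)}}\,dV_g$. *)

(* Defs.v *)
From HB Require Import structures.
From mathcomp Require Import all_boot all_order all_algebra.
From mathcomp Require Import all_classical all_reals all_analysis.
From mathcomp.real_closed Require Export complex.
Set Implicit Arguments.
Unset Strict Implicit.
Unset Printing Implicit Defensive.
Import Order.TTheory GRing.Theory Num.Theory.
Import numFieldNormedType.Exports.
Local Open Scope classical_set_scope.
Local Open Scope ring_scope.
Local Open Scope complex_scope.

(** Functions on 'rV[R]_n *)

Definition partial (R : realType) (n : nat) (i : 'I_n) (h : 'rV[R]_n -> R)
  : 'rV[R]_n -> R := fun x => 'D_(delta_mx 0 i) h x.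

(** Meant for an open set [U]: [{for x, continuous h}] and [derivable] are then
    local conditions, insensitive to the values of [h] outside [U]. *)
Fixpoint Ck (R : realType) (n : nat) (k : nat) (U : set 'rV[R]_n)
    (h : 'rV[R]_n -> R) : Prop :=
  (forall x, U x -> {for x, continuous h}) /\
  (if k is k'.+1 then
     forall i, (forall x, U x -> derivable h x (delta_mx 0 i)) /\
               Ck k' U (partial i h)
   else True).

Definition Cinfty (R : realType) (n : nat) (U : set 'rV[R]_n)
    (h : 'rV[R]_n -> R) : Prop := forall k, Ck k U h.

Definition euclidean_ball (R : realType) (n : nat) (x : 'rV[R]_n) (r : R) :
  set 'rV[R]_n := [set y | Num.sqrt (\sum_i (y 0 i - x 0 i) ^+ 2) < r].

(** The integral over R^n as an iterated one-dimensional Lebesgue integral; by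
    Tonelli it is the n-dimensional Lebesgue integral of a nonnegative Borel
    function. *)
Fixpoint integral_rV (R : realType) (n : nat) : ('rV[R]_n -> \bar R) -> \bar R :=
  match n return ('rV[R]_n -> \bar R) -> \bar R with
  | 0%N => fun h => h 0
  | m.+1 => fun h =>
      (\int[lebesgue_measure]_t
         integral_rV (fun x : 'rV[R]_m => h (row_mx (t%:M : 'rV[R]_1) x)))%E
  end.

(** Smooth manifolds of dimension n *)

(** [chart_inv] only matters on the image of [chart_dom], where it is the inverse
    of the homeomorphism [chart_map]. *)
Record chart (R : realType) (n : nat) (M : topologicalType) := Chart {
  chart_dom : set M;
  chart_map :> M -> 'rV[R]_n;
  chart_inv : 'rV[R]_n -> M;
  chart_dom_open : open chart_dom;
  chart_img_open : open (chart_map @` chart_dom);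
  chart_mapK : forall p, chart_dom p -> chart_inv (chart_map p) = p;
  chart_map_continuous :
    forall p, chart_dom p -> {for p, continuous chart_map};
  chart_inv_continuous :
    forall x, (chart_map @` chart_dom) x -> {for x, continuous chart_inv}
}.

Definition chart_img (R : realType) (n : nat) (M : topologicalType)
  (e : chart R n M) : set 'rV[R]_n := e @` chart_dom e.

Definition overlap (R : realType) (n : nat) (M : topologicalType)
  (e e' : chart R n M) : set 'rV[R]_n := e @` (chart_dom e `&` chart_dom e').

Definition transition (R : realType) (n : nat) (M : topologicalType)
  (e e' : chart R n M) : 'rV[R]_n -> 'rV[R]_n := fun x => e' (chart_inv e x).

(** [A] need not be maximal; it may be. *)
Record smooth_atlas (R : realType) (n : nat) (M : topologicalType)
    (A : set (chart R n M)) : Prop := SmoothAtlas {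
  atlas_cover : forall p : M, exists2 e, A e & chart_dom e p;
  atlas_compat : forall e e', A e -> A e' -> forall j,
    Cinfty (overlap e e') (fun x => transition e e' x 0 j)
}.

(** Without boundary because the charts are open in R^n; second countability
    follows from compactness. *)
Record closed_connected_manifold (R : realType) (n : nat) (M : topologicalType)
    (A : set (chart R n M)) : Prop := ClosedConnectedManifold {
  manifold_atlas : smooth_atlas A;
  manifold_hausdorff : hausdorff_space M;
  manifold_compact : compact [set: M];
  manifold_connected : connected [set: M]
}.

Definition Ck_manifold (R : realType) (n : nat) (M : topologicalType)
    (A : set (chart R n M)) (k : nat) (f : M -> R[i]) : Prop :=
  forall e, A e -> Ck k (chart_img e) (fun x => complex.Re (f (chart_inv e x))) /\
                   Ck k (chart_img e) (fun x => complex.Im (f (chart_inv e x))).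

Definition smooth_manifold_fun (R : realType) (n : nat) (M : topologicalType)
    (A : set (chart R n M)) (f : M -> R[i]) : Prop :=
  forall k, Ck_manifold A k f.

(** Riemannian metrics *)

(** The transpose of the usual Jacobian, as points are row vectors: entry (i, j)
    is the i-th partial derivative of the j-th component. *)
Definition transition_jacobian (R : realType) (n : nat) (M : topologicalType)
    (e e' : chart R n M) (x : 'rV[R]_n) : 'M[R]_n :=
  \matrix_(i, j) partial i (fun y => transition e e' y 0 j) x.

(** [g e x] is the matrix of the metric in the coordinates [e], at the point of
    coordinates [x]; its values off the image of [e] are irrelevant. *)
Record riemannian_metric (R : realType) (n : nat) (M : topologicalType)
    (A : set (chart R n M)) (k : nat)
    (g : chart R n M -> 'rV[R]_n -> 'M[R]_n) : Prop := RiemannianMetric {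
  metric_sym : forall e x, A e -> chart_img e x -> (g e x)^T = g e x;
  metric_pos : forall e x, A e -> chart_img e x ->
    forall v : 'rV[R]_n, v != 0 -> 0 < (v *m g e x *m v^T) 0 0;
  metric_Ck : forall e, A e -> forall i j,
    Ck k (chart_img e) (fun x => g e x i j);
  metric_compat : forall e e', A e -> A e' -> forall x, overlap e e' x ->
    g e x = transition_jacobian e e' x *m g e' (transition e e' x)
            *m (transition_jacobian e e' x)^T
}.

Notation borel M := (g_sigma_algebraType (@open M)).

Definition volume_measure (R : realType) (n : nat) (M : ptopologicalType)
    (A : set (chart R n M)) (g : chart R n M -> 'rV[R]_n -> 'M[R]_n)
    (mu : {measure set (borel M) -> \bar R}) : Prop :=
  forall e, A e -> forall B : set (borel M), measurable B -> B `<=` chart_dom e ->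
    mu B = integral_rV (fun x => (Num.sqrt (\det (g e x)) * \1_(e @` B) x)%:E).

(** In the coordinates [e], with G = g e, the operator is
    h |-> det(G)^(-1/2) sum_i d_i (sum_j det(G)^(1/2) (G^-1)_ij d_j h). *)
Definition laplace_beltrami (R : realType) (n : nat) (M : topologicalType)
    (g : chart R n M -> 'rV[R]_n -> 'M[R]_n) (e : chart R n M)
    (h : 'rV[R]_n -> R) : 'rV[R]_n -> R :=
  fun x => (Num.sqrt (\det (g e x)))^-1 *
    \sum_i partial i (fun y => \sum_j
      Num.sqrt (\det (g e y)) * invmx (g e y) i j * partial j h y) x.

(** Square integrable complex functions *)

Definition L2 (R : realType) (M : ptopologicalType)
    (mu : {measure set (borel M) -> \bar R}) (u : M -> R[i]) : Prop :=
  ((fun p => complex.Re (u p)) : borel M -> R) \in Lfun mu 2%:E /\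
  ((fun p => complex.Im (u p)) : borel M -> R) \in Lfun mu 2%:E.

Definition inner (R : realType) (M : ptopologicalType)
    (mu : {measure set (borel M) -> \bar R}) (D : set M) (u v : M -> R[i]) : R[i] :=
  (\int[mu]_(p in D) complex.Re (u p * (v p)^*)) +i*
  (\int[mu]_(p in D) complex.Im (u p * (v p)^*)).

Definition L2_cvg (R : realType) (M : ptopologicalType)
    (mu : {measure set (borel M) -> \bar R}) (S : nat -> M -> R[i])
    (w : M -> R[i]) : Prop :=
  (\int[mu]_p (complex.Re (S K p - w p) ^+ 2 +
               complex.Im (S K p - w p) ^+ 2)%:E)%E @[K --> \oo] --> 0%E.

Record eigenbasis (R : realType) (n : nat) (M : ptopologicalType)
    (A : set (chart R n M)) (g : chart R n M -> 'rV[R]_n -> 'M[R]_n)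
    (mu : {measure set (borel M) -> \bar R})
    (lambda : nat -> R) (phi : nat -> M -> R[i]) : Prop := Eigenbasis {
  eigenvalue0 : lambda 0%N = 0;
  eigenvalue1 : 0 < lambda 1%N;
  eigenvalue_ndecr : forall k, lambda k <= lambda k.+1;
  eigenfun_C2 : forall k, Ck_manifold A 2 (phi k);
  eigenfun_eq : forall k e x, A e -> chart_img e x ->
    - laplace_beltrami g e (fun y => complex.Re (phi k (chart_inv e y))) x =
      lambda k * complex.Re (phi k (chart_inv e x)) /\
    - laplace_beltrami g e (fun y => complex.Im (phi k (chart_inv e y))) x =
      lambda k * complex.Im (phi k (chart_inv e x));
  eigenfun_L2 : forall k, L2 mu (phi k);
  eigenfun_orthonormal : forall j k,
    inner mu setT (phi j) (phi k) = (j == k)%:R;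
  eigenfun_complete : forall u, L2 mu u ->
    L2_cvg mu (fun K p => \sum_(0 <= k < K) inner mu setT u (phi k) * phi k p) u
}.

(** [frac_laplacian mu lambda phi s u w] : (-Delta_g)^s u is the element [w] of
    L^2, the series sum_(k >= 1) lambda_k^s (u, phi_k) phi_k converging in L^2. *)
Definition frac_laplacian (R : realType) (M : ptopologicalType)
    (mu : {measure set (borel M) -> \bar R})
    (lambda : nat -> R) (phi : nat -> M -> R[i]) (s : R)
    (u w : M -> R[i]) : Prop :=
  [/\ L2 mu u, L2 mu w &
    L2_cvg mu (fun K p => \sum_(1 <= k < K)
      (lambda k `^ s)%:C * inner mu setT u (phi k) * phi k p) w].

(** sqrt(det g) in the coordinates [e], as a function on [chart_dom e]. Off the
    domain of [e] the value is arbitrary: there the function only multiplies or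
    divides functions that vanish. *)
Definition sqrt_det (R : realType) (n : nat) (M : topologicalType)
    (g : chart R n M -> 'rV[R]_n -> 'M[R]_n) (e : chart R n M) (p : M) : R[i] :=
  (Num.sqrt (\det (g e (e p))))%:C.

(** sqrt(det g) (-Delta_g)^s u = f with (u, 1) = 0, for [f] supported in the domain
    of [e]; elsewhere the equation is (-Delta_g)^s u = 0. *)
Definition solution (R : realType) (n : nat) (M : ptopologicalType)
    (g : chart R n M -> 'rV[R]_n -> 'M[R]_n)
    (mu : {measure set (borel M) -> \bar R})
    (lambda : nat -> R) (phi : nat -> M -> R[i]) (s : R) (e : chart R n M)
    (f : M -> R[i]) : set (M -> R[i]) :=
  [set u | frac_laplacian mu lambda phi s u (fun p => f p / sqrt_det g e p) /\
           inner mu setT u (cst 1) = 0].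

(** The restriction to [O] of the solution, extended by 0. Solutions are unique
    up to null sets, so the choice made by [xget] is immaterial. *)
Definition source_to_solution (R : realType) (n : nat) (M : ptopologicalType)
    (g : chart R n M -> 'rV[R]_n -> 'M[R]_n)
    (mu : {measure set (borel M) -> \bar R})
    (lambda : nat -> R) (phi : nat -> M -> R[i]) (s : R) (e : chart R n M)
    (O : set M) (f : M -> R[i]) : M -> R[i] :=
  patch (cst 0) O (xget (cst 0) (solution g mu lambda phi s e f)).

(** The H^{-s}, H^s duality extends the L^2 inner product. Restricting to [O] loses
    nothing for [f] supported there, and gives a meaning to a second argument
    only available on [O], such as the source-to-solution operator. *)
Definition duality_pairing (R : realType) (M : ptopologicalType)
    (mu : {measure set (borel M) -> \bar R}) (O : set M) (f v : M -> R[i]) : R[i] :=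
  inner mu O f v.

(** Constants *)

(** Euler's integral, for x > 0. *)
Definition Gamma (R : realType) (x : R) : R :=
  \int[lebesgue_measure]_(t in `]0, +oo[) (t `^ (x - 1) * expR (- t)).

(** For nu > -1, so that Gamma is only used at positive arguments, and x > 0. *)
Definition besselI (R : realType) (nu x : R) : R :=
  limn (series (fun m : nat =>
    (x / 2) `^ (m.*2%:R + nu) / (m`!%:R * Gamma (m%:R + nu + 1)))).

(** The modified Bessel function of the second kind, for 0 < |nu| < 1, x > 0. *)
Definition besselK (R : realType) (nu x : R) : R :=
  pi / 2 * ((besselI (- nu) x - besselI nu x) / sin (nu * pi)).

Definition c1 (R : realType) (s : R) : R :=
  \int[lebesgue_measure]_(t in `]0, +oo[) (t * besselK s t ^+ 2).

Definition c2 (R : realType) (s : R) : R :=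
  \int[lebesgue_measure]_(t in `]0, +oo[) (t * besselK (1 - s) t ^+ 2).

Definition cs (R : realType) (s : R) : R :=
  - (2 `^ (2 * s - 1) * Gamma s / Gamma (1 - s)).

Definition cs_hat (R : realType) (s : R) : R := 2 `^ (- s) * Gamma (1 - s).

Definition c_tilde (R : realType) (s : R) : R :=
  `|cs s|^-1 * cs_hat s ^- 2 * (c1 s + c2 s).

(** [G] is the matrix of the metric at the point considered. *)
Definition C_tilde (R : realType) (n : nat) (s : R) (alpha : 'rV[R]_n)
    (G : 'M[R]_n) : R :=
  Num.sqrt (\sum_j \sum_l
    \det G `^ (1 / (2 * s)) * invmx G j l * alpha 0 j * alpha 0 l).

(* Main.v *)
Require Import Defs.
From HB Require Import structures.
From mathcomp Require Import all_boot all_order all_algebra.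
From mathcomp Require Import all_classical all_reals all_analysis.
From mathcomp Require Import measurable_realfun ring lra.
Set Implicit Arguments.
Unset Strict Implicit.
Unset Printing Implicit Defensive.
Import Order.TTheory GRing.Theory Num.Theory.
Import numFieldNormedType.Exports.
Local Open Scope classical_set_scope.
Local Open Scope ring_scope.

(** Put h = f / sqrt(det g).  The pairing is (h, (-Delta)^(-s) h), that is, the sum
    over j >= 1 of lambda_j^(-s) |(h, phi_j)|^2.  A source that oscillates with
    frequency W in the direction alpha, on a small neighbourhood of x0, should live
    on the eigenvalues close to W^2 a, where a is the value at x0 of the symbol
    g^(-1)(alpha, alpha).  The pairing is then close to (W^2 a)^(-s) |h|^2, and |h|^2
    is close to det(g(x0))^(-1/2) times the Lebesgue norm of f, because h^2 dV_g is
    f^2 det(g)^(-1/2) dx.  As det(g)^(-1/2) a^(-s) is the power -2s of C_tilde, it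
    only remains to normalise the Lebesgue norm of f, which involves no metric.
    This is possible for any c_tilde >= 0 (c_tilde_ge0).

    The localisation in frequency is obtained without any microlocal analysis.
    Let v be h divided by the symbol, and let r = h + W^(-2) Delta v.  Integration by
    parts gives (h, phi_j) = (lambda_j / W^2) (v, phi_j) + (r, phi_j)
    (inner_remainder).  If r were zero and v equal to h / a, this would say that
    (h, phi_j) vanishes unless lambda_j = a W^2.  The elementary inequality
      |u^(-s) - 1| <= min (u^(-1), u^(-s)) |1 - u|
    (powR_inv_le), applied to u = lambda_j / (a W^2) and summed over j, turns the
    sizes of v - h / a and of r into an error for the pairing (spectral_estimate).
    The first size is small because the symbol is continuous and the supports
    shrink to x0.  For the second, the amplitude of v is chosen so that the term of
    order W^2 in Delta v cancels h; each derivative that falls on an amplitude costs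
    a factor c, the inverse of the radius of the support, so that r is O(c / W)
    (wave_remainder).  Low frequencies contribute W^s |r| to the error, which is why
    W is a high power of c: with W = c^(2 / (1 - s)), W^s c / W = 1 / c tends to 0.

    The source is the derivative along alpha of W^(-1) sin(W alpha.x + t) eta(x),
    with eta a bump of radius 1 / c, so its integral vanishes for every metric.  Its
    norm must not be small compared with that of eta; for t = 0 or t = - pi / 2 it
    is not (norm_source_quarter).

    That the solution exists and is orthogonal to the constants requires phi_0 to
    be a constant.  Indeed, 1 is orthogonal to the other eigenfunctions: with a
    partition of unity rho_i, the integral of rho_i Delta phi_j is minus that of the
    scalar product of the gradients of rho_i and phi_j, and these sum to zero
    (eigen_mean_zero).

    The rest is calculus: stability properties of C^k functions of several
    variables, the divergence theorem for compactly supported fields, the change of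
    variables between M and a chart, and the completeness of L^2. *)

(** * Functions of class C^k on R^n *)

Section Ck_calculus.
Context {R : realType} {n : nat}.
Implicit Types (U V : set 'rV[R]_n) (h u v : 'rV[R]_n -> R) (i j : 'I_n).

Lemma Ck_continuous k U h : Ck k U h -> forall x, U x -> {for x, continuous h}.
Proof. by case: k => [|k] []. Qed.

Lemma Ck_derivable k U h i x : Ck k.+1 U h -> U x -> derivable h x (delta_mx 0 i).
Proof. by move=> [_ /(_ i)[+ _]]; exact. Qed.

Lemma Ck_partial k U h i : Ck k.+1 U h -> Ck k U (partial i h).
Proof. by move=> [_ /(_ i)[]]. Qed.

Lemma Ck0I U h : (forall x, U x -> {for x, continuous h}) -> Ck 0 U h.
Proof. by []. Qed.

Lemma CkSI k U h : (forall x, U x -> {for x, continuous h}) ->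
  (forall i x, U x -> derivable h x (delta_mx 0 i)) ->
  (forall i, Ck k U (partial i h)) -> Ck k.+1 U h.
Proof. by move=> ch dh pih; split=> // i; split; [exact: dh|exact: pih]. Qed.

Lemma CkW k U h : Ck k.+1 U h -> Ck k U h.
Proof.
elim: k h => [|k ih] h [ch dh]; first by split.
split=> // i; have [d1 d2] := dh i; split=> //; exact: ih.
Qed.

Lemma Ck_le k m U h : (m <= k)%N -> Ck k U h -> Ck m U h.
Proof.
move=> /subnK <-; elim: (k - m)%N => [//|d ih]; rewrite addSn => /CkW; exact: ih.
Qed.

Lemma Ck_sub k U V h : V `<=` U -> Ck k U h -> Ck k V h.
Proof.
move=> VU; elim: k h => [|k ih] h [ch dh]; split=> //.
- by move=> x /VU; exact: ch.
- by move=> x /VU; exact: ch.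
- by move=> i; have [d1 d2] := dh i; split; [move=> x /VU; exact: d1|exact: ih].
Qed.

(** Being C^k is local, although partial derivatives are defined everywhere. *)
Lemma Ck_local k U h :
  (forall x, U x -> exists2 V, V x & Ck k V h) -> Ck k U h.
Proof.
elim: k h => [|k ih] h hU; split=> //.
- by move=> x /hU[V Vx [+ _]]; exact.
- by move=> x /hU[V Vx [+ _]]; exact.
- move=> i; split; first by move=> x /hU[V Vx [_ /(_ i)[+ _]]]; exact.
  by apply: ih => x /hU[V Vx [_ /(_ i)[_ ?]]]; exists V.
Qed.

Lemma open_near_eq U h h' x : open U -> U x -> {in U, h =1 h'} ->
  \near x, h x = h' x.
Proof.
move=> oU Ux hh; apply: filterS (open_nbhs_nbhs (conj oU Ux)) => y Uy.
by apply: hh; rewrite inE.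
Qed.

Lemma partial_eq U h h' i : open U -> {in U, h =1 h'} ->
  {in U, partial i h =1 partial i h'}.
Proof.
move=> oU hh x; rewrite inE => Ux; apply: near_eq_derive.
exact: (open_near_eq oU Ux hh).
Qed.

Lemma continuous_eq U h h' x : open U -> {in U, h =1 h'} -> U x ->
  {for x, continuous h} -> {for x, continuous h'}.
Proof.
move=> oU hh Ux; rewrite /prop_for/continuous_at -(hh x) ?inE// => ch.
by apply: cvg_trans ch; exact: (near_eq_cvg (open_near_eq oU Ux hh)).
Qed.

Lemma Ck_eq k U h h' : open U -> {in U, h =1 h'} -> Ck k U h -> Ck k U h'.
Proof.
move=> oU; elim: k h h' => [|k ih] h h' hh [ch dh]; split=> //.
- by move=> x Ux; apply: continuous_eq hh Ux (ch _ Ux).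
- by move=> x Ux; apply: continuous_eq hh Ux (ch _ Ux).
- move=> i; have [d1 d2] := dh i; split.
    move=> x Ux; apply: near_eq_derivable (d1 _ Ux); exact: (open_near_eq oU Ux hh).
  apply: ih d2; exact: partial_eq.
Qed.

Lemma partial_cst (a : R) i : partial i (cst a : 'rV[R]_n -> R) = cst 0.
Proof. by apply/funext => x; rewrite /partial derive_cst. Qed.

Lemma Ck_cst k U (a : R) : Ck k U (cst a).
Proof.
elim: k a => [|k ih] a; split => //.
- by move=> x _; exact: cst_continuous.
- by move=> x _; exact: cst_continuous.
- by move=> i; split=> [x _|]; [exact: derivable_cst|rewrite partial_cst].
Qed.

Lemma coord_is_derive j i (x : 'rV[R]_n) :
  is_derive x (delta_mx 0 i) (fun y : 'rV[R]_n => y 0 j) (j == i)%:R.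
Proof.
pose c := (fun y : 'rV[R]_n => y 0 j).
have lc : linear c by move=> ? ? ?; rewrite /c !mxE.
pose C : {linear 'rV[R]_n -> R} := HB.pack c (GRing.isLinear.Build _ _ _ _ c lc).
have cC : continuous C by exact: coord_continuous.
have d : differentiable C x by exact: linear_differentiable.
apply: (@DeriveDef _ _ _ x (delta_mx 0 i) C); first exact: diff_derivable.
by rewrite deriveE// diff_lin//= /c mxE eqxx.
Qed.

Lemma partial_coord j i :
  partial i (fun y : 'rV[R]_n => y 0 j) = cst (j == i)%:R.
Proof.
by apply/funext => x; have [_] := coord_is_derive j i x.
Qed.

Lemma Ck_coord k U j : Ck k U (fun y : 'rV[R]_n => y 0 j).
Proof.
case: k => [|k]; [apply: Ck0I|apply: CkSI].
- by move=> x _; exact: coord_continuous.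
- by move=> x _; exact: coord_continuous.
- by move=> i x _; have [] := coord_is_derive j i x.
- move=> i; rewrite partial_coord; exact: Ck_cst.
Qed.

Lemma partialD U u v i : Ck 1 U u -> Ck 1 U v ->
  {in U, partial i (u \+ v) =1 partial i u \+ partial i v}.
Proof.
move=> cu cv x; rewrite inE => Ux; rewrite /partial/=.
by rewrite [LHS]deriveD//; [exact: Ck_derivable cu Ux|exact: Ck_derivable cv Ux].
Qed.

Lemma partialM U u v i : Ck 1 U u -> Ck 1 U v ->
  {in U, partial i (u \* v) =1 (partial i u \* v) \+ (u \* partial i v)}.
Proof.
move=> cu cv x; rewrite inE => Ux; rewrite /partial/=.
rewrite [LHS]deriveM; [|exact: Ck_derivable cu Ux|exact: Ck_derivable cv Ux].
by rewrite addrC /= /GRing.scale/= mulrC.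
Qed.

Lemma CkD k U u v : open U -> Ck k U u -> Ck k U v -> Ck k U (u \+ v).
Proof.
move=> oU; elim: k u v => [|k ih] u v cu cv; [apply: Ck0I|apply: CkSI].
- by move=> x Ux; apply: continuousD; [exact: Ck_continuous cu _ _|exact: Ck_continuous cv _ _].
- by move=> x Ux; apply: continuousD; [exact: Ck_continuous cu _ _|exact: Ck_continuous cv _ _].
- by move=> i x Ux; apply: derivableD;
    [exact: Ck_derivable cu Ux|exact: Ck_derivable cv Ux].
- move=> i; apply: (@Ck_eq _ _ (partial i u \+ partial i v)) => //.
    move=> x Ux; rewrite (partialD i (Ck_le _ cu) (Ck_le _ cv) Ux)//.
  by apply: ih; exact: Ck_partial.
Qed.

Lemma CkM k U u v : open U -> Ck k U u -> Ck k U v -> Ck k U (u \* v).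
Proof.
move=> oU; elim: k u v => [|k ih] u v cu cv; [apply: Ck0I|apply: CkSI].
- by move=> x Ux; apply: continuousM; [exact: Ck_continuous cu _ _|exact: Ck_continuous cv _ _].
- by move=> x Ux; apply: continuousM; [exact: Ck_continuous cu _ _|exact: Ck_continuous cv _ _].
- by move=> i x Ux; apply: derivableM;
    [exact: Ck_derivable cu Ux|exact: Ck_derivable cv Ux].
- move=> i; apply: (@Ck_eq _ _ ((partial i u \* v) \+ (u \* partial i v))) => //.
    move=> x Ux; rewrite (partialM i (Ck_le _ cu) (Ck_le _ cv) Ux)//.
  by apply: CkD => //; apply: ih; solve [exact: Ck_partial|exact: CkW].
Qed.

Lemma CkZ k U (a : R) u : open U -> Ck k U u -> Ck k U (fun x => a * u x).
Proof. by move=> oU cu; apply: (@CkM _ _ (cst a)) => //; exact: Ck_cst. Qed.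

Lemma partialZ U (a : R) u i : Ck 1 U u ->
  {in U, partial i (fun x => a * u x) =1 fun x => a * partial i u x}.
Proof.
move=> cu x xU; rewrite (partialM i (Ck_cst 1 U a) cu xU)/=.
by rewrite partial_cst/= mul0r add0r.
Qed.

Lemma CkN k U u : open U -> Ck k U u -> Ck k U (fun x => - u x).
Proof.
move=> oU cu; apply: (@Ck_eq _ _ (fun x => -1 * u x)) => //.
  by move=> x _; rewrite mulN1r.
exact: CkZ.
Qed.

Lemma CkB k U u v : open U -> Ck k U u -> Ck k U v -> Ck k U (fun x => u x - v x).
Proof. by move=> oU cu cv; apply: (@CkD _ _ u (fun x => - v x)) => //; exact: CkN. Qed.

Lemma Ck_sum k U (I : Type) (r : seq I) (P : pred I) (F : I -> 'rV[R]_n -> R) : open U ->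
  (forall a, P a -> Ck k U (F a)) -> Ck k U (fun x => \sum_(a <- r | P a) F a x).
Proof.
move=> oU cF; elim: r => [|a r ih].
  apply: (@Ck_eq _ _ (cst 0)) => //; last exact: Ck_cst.
  by move=> x _; rewrite big_nil.
case: (boolP (P a)) => Pa.
  apply: (@Ck_eq _ _ (F a \+ (fun x => \sum_(a <- r | P a) F a x))) => //.
    by move=> x _ /=; rewrite big_cons Pa.
  by apply: CkD => //; exact: cF.
apply: Ck_eq ih => // x _; by rewrite big_cons (negbTE Pa).
Qed.

Lemma Ck_prod k U (I : Type) (r : seq I) (P : pred I) (F : I -> 'rV[R]_n -> R) : open U ->
  (forall a, P a -> Ck k U (F a)) -> Ck k U (fun x => \prod_(a <- r | P a) F a x).
Proof.
move=> oU cF; elim: r => [|a r ih].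
  apply: (@Ck_eq _ _ (cst 1)) => //; last exact: Ck_cst.
  by move=> x _; rewrite big_nil.
case: (boolP (P a)) => Pa.
  apply: (@Ck_eq _ _ (F a \* (fun x => \prod_(a <- r | P a) F a x))) => //.
    by move=> x _ /=; rewrite big_cons Pa.
  by apply: CkM => //; exact: cF.
apply: Ck_eq ih => // x _; by rewrite big_cons (negbTE Pa).
Qed.

Lemma partial_sum U (I : Type) (r : seq I) (F : I -> 'rV[R]_n -> R) i : open U ->
  (forall a, Ck 1 U (F a)) ->
  {in U, partial i (fun x => \sum_(a <- r) F a x) =1
         fun x => \sum_(a <- r) partial i (F a) x}.
Proof.
move=> oU cF; elim: r => [|a r ih] x xU.
  rewrite big_nil (_ : (fun _ => _) = cst 0) ?partial_cst//.
  by apply/funext => y; rewrite big_nil.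
rewrite big_cons -ih// (_ : (fun x => _) = F a \+ (fun x => \sum_(a <- r) F a x)).
  by rewrite (partialD i (cF a) (Ck_sum _ oU _) xU).
by apply/funext => y; rewrite big_cons.
Qed.

Lemma derive_line (h : 'rV[R]_n -> R) x w :
  'D_w h x = 'D_1 (fun t : R => h (t *: w + x)) 0.
Proof.
have E : (fun t : R => t^-1 *: ((h \o shift x) (t *: w) - h x)) =
    (fun t : R => t^-1 *: (((fun t : R => h (t *: w + x)) \o shift 0) (t *: (1 : R)) -
      h (0 *: w + x))).
  apply/funext => t /=.
  by rewrite scale0r add0r addr0 [t *: 1]mulr1.
by rewrite /derive E.
Qed.

(** The derivative in the direction w is a derivative at 0 along a line, where the
    chain rule in one variable applies. *)
Lemma is_derive_comp1 (F : R -> R) (dF dh : R) h x (w : 'rV[R]_n) :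
  is_derive (h x) 1 F dF -> is_derive x w h dh -> is_derive x w (F \o h) (dF * dh).
Proof.
move=> [F1 F2] [h1 h2].
have e0 : h (0 *: w + x) = h x by rewrite scale0r add0r.
have [/derivable1_diffP d2 e2] :
    is_derive (0 : R) 1 (fun t : R => h (t *: w + x)) dh.
  apply: DeriveDef; first exact: (derivable1P h x w).1 h1.
  by rewrite -derive_line.
have d1 : differentiable F ((fun t : R => h (t *: w + x)) 0).
  by rewrite e0; exact: (derivable1_diffP _ _).1 F1.
have dc := differentiable_comp d2 d1.
have dw : derivable (F \o h) x w.
  by apply: (derivable1P (F \o h) x w).2; apply/derivable1_diffP.
apply: DeriveDef => //.
rewrite derive_line.
have /= := @derive1_comp R _ F 0 ((derivable1_diffP _ _).2 d2) ((derivable1_diffP _ _).2 d1).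
by rewrite !derive1E e2 e0 F2.
Qed.

(** One step of an induction on k: the partial derivatives of F o h are those of h
    times F' o h. *)
Lemma Ck_comp1 k U h (F F' : R -> R) : open U ->
  (forall x, U x -> is_derive (h x) 1 F (F' (h x))) ->
  Ck k.+1 U h -> Ck k U (F' \o h) -> Ck k.+1 U (F \o h).
Proof.
move=> oU dF ch cF; have dh i x : U x -> is_derive x (delta_mx 0 i) h (partial i h x).
  by move=> Ux; apply: DeriveDef => //; exact: Ck_derivable ch Ux.
split=> [x Ux|i].
  apply: continuous_comp; first exact: Ck_continuous ch _ Ux.
  apply/differentiable_continuous/derivable1_diffP.
  by have [] := dF _ Ux.
split=> [x Ux|]; first by have [] := is_derive_comp1 (dF _ Ux) (dh i _ Ux).
apply: (@Ck_eq _ _ ((F' \o h) \* partial i h)) => //.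
  move=> x; rewrite inE => Ux.
  by have [_] := is_derive_comp1 (dF _ Ux) (dh i _ Ux).
by apply: CkM => //; exact: Ck_partial.
Qed.

Lemma partial_comp1 U h (F F' : R -> R) i :
  (forall x, U x -> is_derive (h x) 1 F (F' (h x))) -> Ck 1 U h ->
  {in U, partial i (F \o h) =1 (F' \o h) \* partial i h}.
Proof.
move=> dF ch x; rewrite inE => Ux.
have dh : is_derive x (delta_mx 0 i) h (partial i h x).
  by apply: DeriveDef => //; exact: Ck_derivable ch Ux.
by have [_] := is_derive_comp1 (dF _ Ux) dh.
Qed.

Lemma Ck0_comp (F : R -> R) U h : (forall x, U x -> {for (h x), continuous F}) ->
  Ck 0 U h -> Ck 0 U (F \o h).
Proof.
move=> cF ch; split=> // x Ux; apply: continuous_comp; last exact: cF.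
exact: Ck_continuous ch _ Ux.
Qed.

Lemma CkV k U h : open U -> (forall x, U x -> h x != 0) -> Ck k U h ->
  Ck k U (fun x => (h x)^-1).
Proof.
move=> oU h0; elim: k => [|k ih] ch.
  by apply: (@Ck0_comp GRing.inv) => // x Ux; exact/inv_continuous/h0.
apply: (@Ck_comp1 _ _ _ GRing.inv (fun y => - (y^-1 * y^-1))) => //.
  move=> x Ux; have := @is_deriveV R id (h x) 1 1 (h0 _ Ux) _.
  move=> /(_ (is_derive_id _ _)); rewrite /GRing.scale/= mulr1 -expr2 exprVn.
  exact.
apply: CkN => //; apply: (@CkM _ _ (fun x => (h x)^-1) (fun x => (h x)^-1)) => //;
  by apply: ih; exact: CkW.
Qed.

Lemma Ck_sqrt k U h : open U -> (forall x, U x -> 0 < h x) -> Ck k U h ->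
  Ck k U (fun x => Num.sqrt (h x)).
Proof.
move=> oU h0; elim: k => [|k ih] ch.
  by apply: (@Ck0_comp Num.sqrt) => // x Ux; exact: sqrt_continuous.
apply: (@Ck_comp1 _ _ _ Num.sqrt (fun y => (2 * Num.sqrt y)^-1)) => //.
  by move=> x Ux; apply: is_derive1_sqrt; exact: h0.
apply: (@CkV _ _ (fun x => 2 * Num.sqrt (h x))) => //.
  by move=> x /h0 hx; rewrite mulf_neq0// ?gt_eqF// ?sqrtr_gt0.
by apply: CkZ => //; apply: ih; exact: CkW.
Qed.

End Ck_calculus.

Section Ck_chain.
Context {R : realType} {n : nat}.
Implicit Types (U V : set 'rV[R]_n) (h u v f : 'rV[R]_n -> R) (i j : 'I_n).

Lemma line_is_derive h (x w : 'rV[R]_n) (t dh : R) : is_derive (t *: w + x) w h dh ->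
  is_derive t 1 (fun s : R => h (s *: w + x)) dh.
Proof.
have E : (fun r : R => r^-1 *: ((h \o shift (t *: w + x)) (r *: w) - h (t *: w + x))) =
    (fun r : R => r^-1 *: (((fun s : R => h (s *: w + x)) \o shift t) (r *: (1 : R)) -
      h (t *: w + x))).
  by apply/funext => r /=; rewrite [r *: 1]mulr1 scalerDl addrA.
by move=> [d1 d2]; split; [rewrite /derivable -E|rewrite -d2 /derive -E].
Qed.

Lemma mean_value_partial U f j (c : 'rV[R]_n) (d : R) : (forall t : R, `|t| <= `|d| -> U (t *: delta_mx 0 j + c)) ->
  Ck 1 U f -> exists2 t : R, `|t| <= `|d| &
  f (d *: delta_mx 0 j + c) - f c = partial j f (t *: delta_mx 0 j + c) * d.
Proof.
move=> sU cf; pose F (t : R) := f (t *: delta_mx 0 j + c).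
pose dF (t : R) := partial j f (t *: delta_mx 0 j + c).
have dd (t : R) : `|t| <= `|d| -> is_derive t 1 F (dF t).
  move=> td; apply: line_is_derive; apply: DeriveDef => //.
  by apply: Ck_derivable cf _; exact: sU.
have cont (a b : R) : (forall t : R, t \in `[a, b] -> `|t| <= `|d|) -> {within `[a, b], continuous F}.
  move=> ab; apply: derivable_within_continuous => t /ab/dd[]//.
have F0 : F 0 = f c by rewrite /F scale0r add0r.
have [d0|d0] := leP 0 d.
  have dab (t : R) : t \in `[0, d] -> `|t| <= `|d|.
    by rewrite in_itv/= => /andP[t0 td]; rewrite !ger0_norm.
  have dab' t : t \in `]0, d[%R -> is_derive t 1 F (dF t).
    by move=> t0d; apply/dd/dab; apply: subset_itv_oo_cc t0d.
  have [t tab e] := MVT_segment d0 dab' (cont _ _ dab).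
  by exists t; [exact: dab|rewrite -F0 -/(F d) e subr0].
have dab (t : R) : t \in `[d, 0] -> `|t| <= `|d|.
  rewrite in_itv/= => /andP[dt t0]; rewrite !ler0_norm//; last exact: ltW.
  by rewrite lerN2.
have dab' t : t \in `]d, 0[%R -> is_derive t 1 F (dF t).
  by move=> t0d; apply/dd/dab; apply: subset_itv_oo_cc t0d.
have [t tab e] := MVT_segment (ltW d0) dab' (cont _ _ dab).
by exists t; [exact: dab|rewrite -F0 -/(F d) -opprB e sub0r mulrN opprK].
Qed.

(** Obtained by moving from a to b one coordinate at a time; only partial
    derivatives are known to exist at this point. *)
Lemma mean_value U f (a b : 'rV[R]_n) :
  (forall y : 'rV[R]_n, (forall i, `|y 0 i - a 0 i| <= `|b 0 i - a 0 i|) -> U y) -> Ck 1 U f ->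
  exists2 xi : 'I_n -> 'rV[R]_n,
    forall j i, `|xi j 0 i - a 0 i| <= `|b 0 i - a 0 i| &
    f b - f a = \sum_j partial j f (xi j) * (b 0 j - a 0 j).
Proof.
move=> sU cf.
(* the first m coordinates are those of b *)
pose hyb m : 'rV[R]_n := \row_i (if (i < m)%N then b 0 i else a 0 i).
have hyb0 : hyb 0 = a by apply/rowP => i; rewrite mxE ltn0.
have hybn : hyb n = b by apply/rowP => i; rewrite mxE ltn_ord.
have hybS (j : 'I_n) : hyb j.+1 = (b 0 j - a 0 j) *: delta_mx 0 j + hyb j.
  apply/rowP => i; rewrite !mxE eqxx/= ltnS leq_eqVlt.
  have [->|ij] := eqVneq i j; first by rewrite eqxx ltnn mulr1 subrK.
  by rewrite (inj_eq val_inj) (negbTE ij)/= mulr0 add0r.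
have step (t : R) (j i : 'I_n) : `|t| <= `|b 0 j - a 0 j| ->
    `|(t *: delta_mx 0 j + hyb j) 0 i - a 0 i| <= `|b 0 i - a 0 i|.
  move=> tj; rewrite !mxE eqxx/=; have [->|ij] := eqVneq i j.
    by rewrite ltnn mulr1 addrK.
  by rewrite mulr0 add0r; case: ifP => // _; rewrite subrr normr0.
have /choice[t tP] : forall j : 'I_n, exists t : R, `|t| <= `|b 0 j - a 0 j| /\
    f (hyb j.+1) - f (hyb j) = partial j f (t *: delta_mx 0 j + hyb j) * (b 0 j - a 0 j).
  move=> j; have [|t t1 t2] := @mean_value_partial U f j (hyb j) (b 0 j - a 0 j) _ cf.
    by move=> t tj; apply: sU => i; exact: step.
  by exists t; rewrite hybS.
exists (fun j => t j *: delta_mx 0 j + hyb j); first by move=> j i; apply: step; case: (tP j).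
rewrite -{1}hybn -hyb0 -(telescope_sumr (fun m => f (hyb m)))// big_mkord.
by rewrite hyb0; apply: eq_bigr => j _; case: (tP j).
Qed.

Definition gradient_form (c : 'I_n -> R) (v : 'rV[R]_n) : R := \sum_j v 0 j * c j.

Lemma gradient_form_linear c : linear (gradient_form c).
Proof.
move=> k u v; rewrite /gradient_form scaler_sumr -big_split/=; apply: eq_bigr => j _.
by rewrite !mxE mulrDl -mulrA.
Qed.
HB.instance Definition _ c := GRing.isLinear.Build R 'rV[R]_n R _ (gradient_form c)
  (gradient_form_linear c).

Lemma coord_le_norm (v : 'rV[R]_n) i : `|v 0 i| <= `|v|.
Proof.
rewrite [leRHS]/Num.norm/= mx_normrE; apply: (le_bigmax _ (fun ij => `|v ij.1 ij.2|) (0, i)).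
Qed.

Lemma gradient_form_continuous c : continuous (gradient_form c).
Proof.
move=> x; apply: (@Ck_continuous _ _ 0 setT) => //.
apply: Ck_sum => [|j _]; first exact: openT.
apply: (CkM (v := cst (c j)) openT); [exact: Ck_coord|exact: Ck_cst].
Qed.

(** Continuity of the partial derivatives makes the mean value formula first order
    accurate, which is Frechet differentiability. *)
Lemma Ck1_diff U f x : open U -> U x -> Ck 1 U f ->
  differentiable f x /\ 'd f x = gradient_form (fun j => partial j f x) :> (_ -> _).
Proof.
move=> oU Ux cf; set c := fun j => _.
suff E : (f : 'rV[R]_n -> R^o) \o shift x =
    cst (f x) + (gradient_form c : 'rV[R]_n -> R^o) +o_ (0 : 'rV[R]_n) id.
  have E2 := @diff_unique R 'rV[R]_n R^o f (gradient_form c) x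
    (@gradient_form_continuous c) E; split=> //.
  by apply/diff_locallyP; rewrite E2; split=> //; exact: gradient_form_continuous.
apply/eqaddoP => eps eps0.
pose e := eps / n.+1%:R; have e0 : 0 < e by rewrite divr_gt0.
have : \forall y \near x, U y /\ forall j, `|partial j f y - c j| <= e.
  near=> y; split; first by near: y; exact: open_nbhs_nbhs.
  near: y; apply: filter_forall => j.
  have /cvgrPdist_le/(_ _ e0) := Ck_continuous (Ck_partial j cf) Ux.
  by apply: filterS => y; rewrite distrC.
move=> /nbhs_ballP[r r0 rU].
have : \forall h \near (0 : 'rV[R]_n), `|h| < r.
  exact: pseudometric_normed_Zmodule.nbhs0_lt.
apply: filterS => h hr.
have in_ball (y : 'rV[R]_n) : (forall i, `|y 0 i - x 0 i| <= `|(h + x) 0 i - x 0 i|) -> ball x r y.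
  move=> yh; rewrite -ball_normE/= distrC; apply: le_lt_trans hr.
  rewrite [leLHS]/Num.norm/= mx_normrE; apply/bigmax_leP; split=> // -[i0 i] _ /=.
  rewrite ord1 !mxE; apply: (le_trans (yh i)); rewrite !mxE addrK; exact: coord_le_norm.
have [|xi xiP] := @mean_value U f x (h + x) _ cf.
  by move=> y /in_ball/rU[].
rewrite /= => fE; rewrite [X in `|X|](_ : _ = \sum_j h 0 j * (partial j f (xi j) - c j)).
  apply: (le_trans (ler_norm_sum _ _ _)).
  apply: (@le_trans _ _ (\sum_(j < n) `|h| * e)).
    apply: ler_sum => j _; rewrite normrM ler_pM//; first exact: coord_le_norm.
    by have /rU[_] := in_ball _ (xiP j); exact.
  rewrite sumr_const card_ord -mulr_natr -mulrA [leLHS]mulrC ler_wpM2r//.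
  by rewrite /e mulrAC ler_pdivrMr// ler_wpM2l ?ler_nat// ltW.
rewrite !fctE opprD addrA fE /gradient_form -sumrB; apply: eq_bigr => j _.
by rewrite mxE addrK mulrBr mulrC.
Unshelve. all: by end_near. Qed.

Lemma is_derive_comp (T : 'rV[R]_n -> 'rV[R]_n) V f x w (dT : 'I_n -> R) :
  open V -> V (T x) -> Ck 1 V f ->
  (forall j, is_derive x w (fun y => T y 0 j) (dT j)) ->
  is_derive x w (f \o T) (\sum_j dT j * partial j f (T x)).
Proof.
move=> oV VT cf dTj.
pose g (t : R) := T (t *: w + x).
have dg j : is_derive (0 : R) 1 (fun t => g t 0 j) (dT j).
  by apply: line_is_derive (fun y => T y 0 j) _ _ _ _ _; rewrite scale0r add0r.
have g1 : derivable g 0 1.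
  apply/derivable_mxP => i j; rewrite ord1; by case: (dg j).
have g0 : g 0 = T x by rewrite /g scale0r add0r.
have [d1 d2] : differentiable f (g 0) /\
    'd f (g 0) = gradient_form (fun j => partial j f (T x)) :> (_ -> _).
  by rewrite g0; exact: Ck1_diff cf.
have d3 : differentiable g 0 by exact/derivable1_diffP.
have e2 : 'D_1 (f \o g) 0 = \sum_j dT j * partial j f (T x).
  rewrite (deriveE _ (differentiable_comp d3 d1)) (diff_comp d3 d1).
  rewrite [LHS](_ : _ = gradient_form (fun j => partial j f (T x)) ('d g 0 1)); last by rewrite -d2.
  rewrite -(deriveE _ d3) /gradient_form; apply: eq_bigr => j _; congr (_ * _).
  by rewrite derive_mx// mxE; case: (dg j).
apply: DeriveDef.
  by apply: (derivable1P (f \o T) x w).2; exact: (derivable1_diffP _ _).2 (differentiable_comp d3 d1).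
by rewrite derive_line -e2.
Qed.

Lemma row_continuous (X : topologicalType) (T : X -> 'rV[R]_n) (x : X) :
  (forall j, {for x, continuous (fun y => T y 0 j)}) -> {for x, continuous T}.
Proof.
move=> cT; apply/cvg_ballP => e e0.
have : \forall y \near x, forall j, ball (T x 0 j) e (T y 0 j).
  by apply: filter_forall => j; have /cvg_ballP/(_ _ e0) := cT j.
by apply: filterS => y Ty; split=> // i j; rewrite ord1.
Qed.

Lemma Ck_comp k U V f (T : 'rV[R]_n -> 'rV[R]_n) : open U -> open V ->
  (forall x, U x -> V (T x)) -> (forall j, Ck k U (fun y => T y 0 j)) ->
  Ck k V f -> Ck k U (f \o T).
Proof.
move=> oU oV UV; elim: k f => [|k ih] f cT cf.
  apply: Ck0I => x Ux; apply: continuous_comp; last exact: (Ck_continuous cf (UV _ Ux)).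
  by apply: row_continuous => j; exact: Ck_continuous (cT j) _ Ux.
have dT j i x : U x -> is_derive x (delta_mx 0 i) (fun y => T y 0 j)
    (partial i (fun y => T y 0 j) x).
  by move=> Ux; apply: DeriveDef => //; exact: Ck_derivable (cT j) Ux.
have dfT i x : U x -> is_derive x (delta_mx 0 i) (f \o T)
    (\sum_j partial i (fun y => T y 0 j) x * partial j f (T x)).
  by move=> Ux; apply: is_derive_comp (UV _ Ux) (Ck_le _ cf) (fun j => dT j i x Ux).
apply: CkSI.
- move=> x Ux; apply: continuous_comp; last exact: (Ck_continuous cf (UV _ Ux)).
  by apply: row_continuous => j; exact: Ck_continuous (cT j) _ Ux.
- by move=> i x Ux; case: (dfT i x Ux).
- move=> i; apply: (@Ck_eq _ _ _ _ (fun x => \sum_j partial i (fun y => T y 0 j) x *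
      (partial j f \o T) x)) => //.
    by move=> x; rewrite inE => Ux; case: (dfT i x Ux).
  apply: Ck_sum => // j _; apply: CkM => //; first exact: Ck_partial.
  by apply: ih; [move=> l; exact: CkW|exact: Ck_partial].
Qed.

End Ck_chain.

(** * Smooth bump functions *)

(** For j = 0 this is the classical flat function exp(-1/t); the powers of 1/t are
    carried along because they span a space stable under differentiation. *)
Definition flat (R : realType) (j : nat) (t : R) : R :=
  if 0 < t then t^-1 ^+ j * expR (- t^-1) else 0.

Section flat_theory.
Context {R : realType}.

Lemma flat_ge0 j (t : R) : 0 <= flat j t.
Proof.
by rewrite /flat; case: ifP => // /ltW t0; rewrite mulr_ge0 ?expR_ge0// exprn_ge0// invr_ge0.
Qed.

(** A bound of order t^2 is what gives derivative 0 at t = 0. *)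
Lemma flat_le j (t : R) : flat j t <= j.+2%:R ^+ j.+2 * t ^+ 2.
Proof.
rewrite /flat; case: ifPn => t0; last first.
  by rewrite mulr_ge0 ?sqr_ge0// exprn_ge0.
set m := j.+2; have m0 : 0 < m%:R :> R by [].
have : (t^-1 / m%:R) ^+ m <= expR t^-1.
  have -> : expR t^-1 = expR (t^-1 / m%:R) ^+ m.
    by rewrite -expRM_natl mulrC divfK// gt_eqF.
  rewrite lerXn2r// ?nnegrE ?expR_ge0//.
    by rewrite divr_ge0// invr_ge0 ltW.
  by rewrite (le_trans _ (expR_ge1Dx _))// lerDr.
move=> H; rewrite expRN ler_pdivrMr ?expR_gt0//.
have -> : t^-1 ^+ j = m%:R ^+ m * t ^+ 2 * (t^-1 / m%:R) ^+ m.
  have e1 : t^-1 ^+ 2 * t ^+ 2 = 1 by rewrite -exprMn mulVf ?gt_eqF// expr1n.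
  have e2 : m%:R^-1 ^+ m * m%:R ^+ m = 1 :> R.
    by rewrite -exprMn mulVf ?gt_eqF// expr1n.
  transitivity (t^-1 ^+ j * (t^-1 ^+ 2 * t ^+ 2) * (m%:R^-1 ^+ m * m%:R ^+ m)).
    by rewrite e1 e2 !mulr1.
  rewrite exprMn (_ : t^-1 ^+ m = t^-1 ^+ j * t^-1 ^+ 2); last by rewrite -exprD addn2.
  by move: (m%:R^-1 ^+ m) (m%:R ^+ m) (t^-1 ^+ j) (t^-1 ^+ 2) => a b c d; ring.
by rewrite ler_wpM2l// mulr_ge0 ?sqr_ge0// exprn_ge0.
Qed.

Lemma flat_is_derive j (t : R) :
  is_derive t 1 (flat j) (flat j.+2 t - j%:R * flat j.+1 t).
Proof.
have [t0|t0|->] := ltgtP t 0.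
- have -> : flat j.+2 t - j%:R * flat j.+1 t = 0.
    by rewrite /flat lt_gtF// mulr0 subr0.
  apply: (@near_eq_is_derive R R^o R^o (cst 0)).
  near=> u; rewrite /flat lt_gtF//.
  near: u; exact: lt_nbhsl.
- apply: (@near_eq_is_derive R R^o R^o (fun u : R => u^-1 ^+ j * expR (- u^-1))).
    near=> u; rewrite /flat ifT//.
    near: u; exact: lt_nbhsr.
  have tn0 : t != 0 by rewrite gt_eqF.
  have dV : is_derive t 1 (fun u : R => u^-1) (- t^-2).
    have := @is_deriveV R id t 1 1 tn0 (is_derive_id _ _).
    by rewrite /GRing.scale/= mulr1.
  have dX := is_deriveX j dV.
  have dE : is_derive t 1 (fun u : R => expR (- u^-1)) (t^-2 * expR (- t^-1)).
    have := @is_derive1_comp R expR (fun u => - u^-1) t _ _ (is_derive_expR _) (is_deriveN dV).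
    by rewrite opprK mulrC.
  have := is_deriveM dX dE.
  rewrite (_ : (_ * _ : R -> R) = fun u : R => u^-1 ^+ j * expR (- u^-1)); last first.
    by apply/funext => u; rewrite fctE exprfctE.
  move=> H; apply: is_derive_eq H _.
  rewrite exprfctE /flat t0 /GRing.scale/= -!exprVn; move: (t^-1) (expR _) => y E.
  by case: j {dX} => [|j]; rewrite ?expr0 ?exprS/=; ring.
- rewrite (_ : flat j.+2 0 - _ = 0); last by rewrite /flat ltxx mulr0 subr0.
  have L : h^-1 *: ((flat j \o shift 0) (h *: (1 : R)) - flat j 0) @[h --> (0:R)^'] --> (0:R).
    pose C : R := j.+2%:R ^+ j.+2.
    have C0 : 0 < C by rewrite exprn_gt0.
    apply/cvgr0Pnorm_le => e e0; near=> h.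
    have h0 : h != 0 by near: h; exact: nbhs_dnbhs_neq.
    have he : `|h| <= e / C.
      by near: h; apply: dnbhs0_le; rewrite divr_gt0.
    rewrite /= addr0 [h *: _]mulr1 /flat ltxx subr0 -/(flat j h) normrZ normfV.
    rewrite ler_pdivrMl ?normr_gt0// ger0_norm ?flat_ge0//.
    apply: (le_trans (flat_le j h)); rewrite -/C -normr_id -real_normK ?num_real//.
    by rewrite expr2 normr_id mulrCA ler_wpM2l// mulrC -ler_pdivlMr.
  apply: DeriveDef; first by apply/cvg_ex; exists 0; exact: L.
  exact: cvg_lim L.
Unshelve. all: by end_near. Qed.

Lemma Ck_flat n k (U : set 'rV[R]_n) h j : open U -> Ck k U h -> Ck k U (flat j \o h).
Proof.
move=> oU; elim: k j => [|k ih] j ch.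
  apply: Ck0_comp => // x _; apply/differentiable_continuous/derivable1_diffP.
  by case: (flat_is_derive j (h x)).
apply: (@Ck_comp1 _ _ _ _ _ _ (fun t => flat j.+2 t - j%:R * flat j.+1 t)) => //.
  by move=> x _; exact: flat_is_derive.
have := CkW ch.
move=> ch'; apply: (@CkB _ _ _ _ (flat j.+2 \o h) (fun x => j%:R * (flat j.+1 \o h) x)) => //.
  exact: ih.
by apply: CkZ => //; exact: ih.
Qed.

Lemma Ck_trig n k (U : set 'rV[R]_n) h : open U -> Ck k U h ->
  Ck k U (cos \o h) /\ Ck k U (sin \o h).
Proof.
move=> oU; elim: k => [|k ih] ch.
  by split; apply: Ck0_comp => // x _; [exact: continuous_cos|exact: continuous_sin].
have [c1 c2] := ih (CkW ch); split.
  apply: (@Ck_comp1 _ _ _ _ _ _ (fun t => - sin t)) => //; last exact: CkN.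
by apply: (@Ck_comp1 _ _ _ _ _ _ cos).
Qed.

End flat_theory.

(** * Lebesgue measure on R^n *)

Lemma open_borel (M : ptopologicalType) (U : set M) : open U -> measurable (U : set (borel M)).
Proof. by move=> oU; apply: sub_sigma_algebra. Qed.

Lemma closed_borel (M : ptopologicalType) (U : set M) :
  closed U -> measurable (U : set (borel M)).
Proof.
by move=> cU; rewrite -[U]setCK; apply: measurableC; apply: open_borel; exact: closed_openC.
Qed.

(** Continuity at the points of an open set is enough, whatever the values
    elsewhere; charts and their inverses are only continuous in this sense. *)
Lemma open_continuous_preimage (M N : topologicalType) (D : set M) (f : M -> N) (V : set N) :
  open D -> (forall x, D x -> {for x, continuous f}) -> open V -> open (D `&` f @^-1` V).
Proof.
move=> oD cf oV; rewrite openE => x [Dx fVx].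
apply: filterI; first exact: open_nbhs_nbhs.
by apply: (cf x Dx); exact: open_nbhs_nbhs.
Qed.

Lemma continuous_borel (M N : ptopologicalType) (D : set M) (f : M -> N) :
  open D -> (forall x, D x -> {for x, continuous f}) ->
  measurable_fun (D : set (borel M)) (f : borel M -> borel N).
Proof.
have E : @measurable _ (borel N) = <<s @open N >> by [].
move=> oD cf; refine (@measurability _ _ _ _ _ _ _ E _).
by move=> _ [V oV <-]; apply: open_borel; exact: open_continuous_preimage.
Qed.

Lemma continuous_borel_real (R : realType) (M : ptopologicalType) (D : set M) (f : M -> R) :
  open D -> (forall x, D x -> {for x, continuous f}) ->
  measurable_fun (D : set (borel M)) (f : borel M -> R).
Proof.
move=> oD cf; refine (@measurability _ _ _ _ _ _ _ (measurable_realfun.RGenOInfty.measurableE R) _).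
move=> _ [V [a ->] <-]; apply: open_borel; apply: open_continuous_preimage => //.
Qed.

Section row_measurability.
Context {R : realType} {n : nat}.

Let rat_box (q : 'rV[rat]_n * nat) : set 'rV[R]_n :=
  [set x | forall i, ball (ratr (q.1 0 i) : R) (q.2.+1%:R^-1 : R) (x 0 i)].

Let open_rat_box (U : set 'rV[R]_n) : open U ->
  U = \bigcup_(q in [set q | rat_box q `<=` U]) rat_box q.
Proof.
move=> oU; rewrite eqEsubset; split; last first.
  by move=> x [q qU]; exact: qU.
move=> x Ux; have /nbhs_ballP[r r0 rU] := open_nbhs_nbhs (conj oU Ux).
have [k kr] : exists k : nat, 2 * k.+1%:R^-1 < r.
  have r2 : 0 < r / 2 by rewrite divr_gt0.
  have [k _ kr] := near_infty_natSinv_lt (PosNum r2).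
  by exists k; rewrite -ltr_pdivlMl// mulrC; exact: (kr k (leqnn k)).
have /choice[q qP] : forall i : 'I_n, exists q : rat, ball (x 0 i) (k.+1%:R^-1 : R) (ratr q).
  move=> i; have [|q] := @rat_in_itvoo R (x 0 i) (x 0 i + k.+1%:R^-1).
    by rewrite ltrDl.
  rewrite in_itv/= => /andP[q1 q2]; exists q; rewrite /ball/= ltr0_norm ?subr_lt0//.
  by rewrite opprB ltrBlDl.
exists (\row_i q i, k) => /=; last first.
  by move=> i /=; rewrite mxE; apply: ball_sym.
move=> y yq; apply: rU; split=> // i j; rewrite ord1.
apply: (le_ball (ltW kr)); rewrite mulr2n mulrDl mul1r.
apply: ball_triangle (qP j) _; have := yq j.
by rewrite /= mxE.
Qed.

Lemma coord_measurable i :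
  measurable_fun setT ((fun x : 'rV[R]_n => x 0 i) : borel 'rV[R]_n -> R).
Proof.
apply: continuous_borel_real; first exact: openT.
by move=> x _; exact: coord_continuous.
Qed.

(** Open sets are countable unions of rational boxes, and the preimage of a box is
    a finite intersection of conditions on coordinates. *)
Lemma row_measurable d (T : measurableType d) (F : T -> 'rV[R]_n) :
  (forall i, measurable_fun setT (fun t => F t 0 i)) ->
  measurable_fun setT (F : T -> borel 'rV[R]_n).
Proof.
have E : @measurable _ (borel 'rV[R]_n) = <<s @open 'rV[R]_n >> by [].
move=> mF; refine (@measurability _ _ _ _ _ _ _ E _).
move=> _ [U oU <-]; rewrite setTI (open_rat_box oU) preimage_bigcup.
rewrite [X in measurable X](_ : _ = \bigcup_q
    (if `[< rat_box q `<=` U >] then F @^-1` rat_box q else set0)); last first.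
  rewrite eqEsubset; split=> t [q qU Fq].
    by exists q => //; case: asboolP.
  by move: Fq; case: asboolP => // qU' Fq; exists q.
apply: countable_bigcupT_measurable; first exact: countableP.
move=> q; case: ifP => // _.
rewrite (_ : F @^-1` _ = \bigcap_(i in [set: 'I_n])
    ((fun t => F t 0 i) @^-1` ball (ratr (q.1 0 i) : R) (q.2.+1%:R^-1 : R))).
  apply: fin_bigcap_measurable => // i _.
  rewrite -[X in measurable X]setTI; apply: mF => //.
  apply: open_measurable; exact: ball_open.
rewrite eqEsubset; split=> t Ft i; first by move=> _; exact: Ft.
exact: Ft.
Qed.

End row_measurability.

Section lebesgue_measure_rV.
Context {R : realType}.

Definition row_cons n (tx : measurableTypeR R * borel 'rV[R]_n) : borel 'rV[R]_n.+1 :=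
  row_mx ((tx.1 : R)%:M : 'rV_1) (tx.2 : 'rV[R]_n).

Definition row_uncons n (x : borel 'rV[R]_n.+1) : measurableTypeR R * borel 'rV[R]_n :=
  ((x : 'rV[R]_n.+1) 0 ord0, (\row_i (x : 'rV[R]_n.+1) 0 (lift ord0 i))).

Lemma row_cons0 n t (x : 'rV[R]_n) : (row_cons (t, x) : 'rV_n.+1) 0 ord0 = t.
Proof.
by rewrite /row_cons mxE; case: splitP => // j _; rewrite ord1 mxE mulr1n.
Qed.

Lemma row_consS n t (x : 'rV[R]_n) i : (row_cons (t, x) : 'rV_n.+1) 0 (lift ord0 i) = x 0 i.
Proof.
rewrite /row_cons mxE; case: splitP => j.
  by rewrite ord1.
by rewrite /= /bump/= => -[] /val_inj ->.
Qed.

Lemma row_consK n : cancel (@row_cons n) (@row_uncons n).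
Proof.
move=> [t x]; rewrite /row_uncons row_cons0; congr pair.
by apply/rowP => i; rewrite mxE row_consS.
Qed.

Lemma row_cons_measurable n : measurable_fun setT (@row_cons n).
Proof.
apply: row_measurable => i; case: (unliftP ord0 i) => [j ->|->].
  rewrite (_ : (fun _ => _) = (fun x : borel 'rV[R]_n => (x : 'rV[R]_n) 0 j) \o snd).
    by apply: measurableT_comp; [exact: coord_measurable|exact: measurable_snd].
  by apply/funext => -[t x]; rewrite row_consS.
rewrite (_ : (fun _ => _) = fst); first exact: measurable_fst.
by apply/funext => -[t x]; rewrite row_cons0.
Qed.

Lemma row_uncons_measurable n : measurable_fun setT (@row_uncons n).
Proof.
apply/measurable_fun_pairP; split; first exact: coord_measurable.
apply: row_measurable => i; rewrite (_ : (fun _ => _) =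
  (fun x : borel 'rV[R]_n.+1 => (x : 'rV[R]_n.+1) 0 (lift ord0 i))).
  exact: coord_measurable.
by apply/funext => x; rewrite /= mxE.
Qed.

Definition leb_cons n (lam : {sigma_finite_measure set (measurableTypeR R) -> \bar R})
    (mu : {sigma_finite_measure set (borel 'rV[R]_n) -> \bar R}) :
    set (borel 'rV[R]_n.+1) -> \bar R :=
  pushforward (lam \x mu)%E (@row_cons n).

Section leb_cons.
Variables (n : nat) (lam : {sigma_finite_measure set (measurableTypeR R) -> \bar R})
  (mu : {sigma_finite_measure set (borel 'rV[R]_n) -> \bar R}).

Let leb_cons0 : leb_cons lam mu set0 = 0%E.
Proof. by rewrite /leb_cons /pushforward preimage_set0 measure0. Qed.

Let leb_cons_ge0 A : (0 <= leb_cons lam mu A)%E.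
Proof. by rewrite /leb_cons /pushforward; exact: measure_ge0. Qed.

Let leb_cons_sigma_additive : semi_sigma_additive (leb_cons lam mu).
Proof.
move=> F mF tF mUF; rewrite /leb_cons /pushforward preimage_bigcup.
apply: measure_semi_sigma_additive.
- by move=> k; rewrite -[X in measurable X]setTI; exact: row_cons_measurable.
- apply/trivIsetP => /= i j _ _ ij; rewrite -preimage_setI.
  by move/trivIsetP : tF => /(_ _ _ _ _ ij) ->//; rewrite preimage_set0.
- by rewrite -preimage_bigcup -[X in measurable X]setTI; exact: row_cons_measurable.
Qed.

HB.instance Definition _ := isMeasure.Build _ _ _ (leb_cons lam mu)
  leb_cons0 leb_cons_ge0 leb_cons_sigma_additive.

Let leb_cons_sigma_finite : sigma_finite setT (leb_cons lam mu).
Proof.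
have /sigma_finiteP[F [TF ndF Foo]] := sigma_finiteT lam.
have /sigma_finiteP[G [TG ndG Goo]] := sigma_finiteT mu.
exists (fun k => @row_uncons n @^-1` (F k `*` G k)).
  rewrite -preimage_bigcup (_ : \bigcup_k (F k `*` G k) = setT) ?preimage_setT//.
  rewrite -subTset => -[t x] _.
  have [i _ Fi] : (\bigcup_i F i) t by rewrite -TF.
  have [j _ Gj] : (\bigcup_j G j) x by rewrite -TG.
  exists (maxn i j) => //; split.
  - by move: t Fi; exact/subsetPset/ndF/leq_maxl.
  - by move: x Gj; exact/subsetPset/ndG/leq_maxr.
move=> k; have [mF Fk] := Foo k; have [mG Gk] := Goo k; split.
  by rewrite -[X in measurable X]setTI; apply: row_uncons_measurable => //; exact: measurableX.
rewrite /leb_cons /pushforward -comp_preimage (_ : _ \o _ = id); last first.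
  by apply/funext => tx /=; rewrite row_consK.
by rewrite preimage_id product_measure1E// lte_mul_pinfty// ge0_fin_numE.
Qed.

HB.instance Definition _ := Measure_isSigmaFinite.Build _ _ _ (leb_cons lam mu)
  leb_cons_sigma_finite.
End leb_cons.

(** The recursion is that of integral_rV, but it produces a measure, so that the
    convergence theorems and Fubini apply. Borel sets are needed because
    volume measures live on the Borel sets of M. *)
Fixpoint leb n : {sigma_finite_measure set (borel 'rV[R]_n) -> \bar R} :=
  match n with
  | 0%N => \d_ (0 : borel 'rV[R]_0)
  | m.+1 => leb_cons lebesgue_measure (leb m)
  end.

End lebesgue_measure_rV.

Section leb_theory.
Context {R : realType}.
Local Notation leb := (@leb R).
Local Notation mu1 := (@lebesgue_measure R : {sigma_finite_measure set (measurableTypeR R) -> \bar R}).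

Lemma row_cons_slice n (t : R) :
  measurable_fun setT (fun x : borel 'rV[R]_n => row_cons (t, x)).
Proof.
apply: (measurableT_comp (@row_cons_measurable R n)).
exact: pair1_measurable.
Qed.

Lemma ge0_integral_lebS n (h : borel 'rV[R]_n.+1 -> \bar R) :
  measurable_fun setT h -> (forall x, 0 <= h x)%E ->
  (\int[leb n.+1]_x h x = \int[mu1]_t \int[leb n]_x h (row_cons (t, x)))%E.
Proof.
move=> mh h0.
rewrite [LHS](ge0_integral_pushforward (@row_cons_measurable R n))//.
rewrite preimage_setT; apply: fubini_tonelli1 => [|x]; last exact: h0.
by apply: measurableT_comp => //; exact: row_cons_measurable.
Qed.

(** Tonelli, one coordinate at a time. *)
Lemma integral_rVE n (h : 'rV[R]_n -> \bar R) :
  measurable_fun setT (h : borel 'rV[R]_n -> \bar R) -> (forall x, 0 <= h x)%E ->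
  (integral_rV h = \int[leb n]_x h x)%E.
Proof.
elim: n h => [|n ih] h mh h0.
  by rewrite [RHS]integral_dirac// diracT mul1e.
rewrite ge0_integral_lebS//=; apply: eq_integral => t _; apply: ih => //.
apply: (measurableT_comp mh).
exact: row_cons_slice.
Qed.

Definition box n (c : 'rV[R]_n) (r : R) : set 'rV[R]_n :=
  [set x | forall i, `|x 0 i - c 0 i| <= r].

Lemma closed_box n (c : 'rV[R]_n) r : closed (box c r).
Proof.
rewrite (_ : box c r = \bigcap_(i in [set: 'I_n]) [set x | `|x 0 i - c 0 i| <= r]).
  apply: closed_bigI => i _.
  apply: (@closed_comp _ _ (fun x : 'rV[R]_n => `|x 0 i - c 0 i|) [set y | y <= r]).
    move=> x _.
    apply: (@continuous_comp _ _ _ (fun x : 'rV[R]_n => x 0 i - c 0 i) Num.norm).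
      by apply: continuousB; [exact: coord_continuous|exact: cst_continuous].
    exact: norm_continuous.
  exact: closed_le.
rewrite eqEsubset; split=> x xb i; first by move=> _; exact: xb.
exact: xb.
Qed.

Lemma measurable_box n (c : 'rV[R]_n) r : measurable (box c r : set (borel 'rV[R]_n)).
Proof. by apply: closed_borel; exact: closed_box. Qed.

Lemma compact_box n (c : 'rV[R]_n) r : compact (box c r).
Proof.
apply: bounded_closed_compact; last exact: closed_box.
exists (`|r| + `|c|); split; first exact: num_real.
move=> M rM x xb; apply: le_trans (ltW rM).
rewrite -[x](subrK c); apply: (le_trans (ler_normD _ _)); rewrite lerD2r.
rewrite [leLHS]/Num.norm/= mx_normrE; apply/bigmax_leP; split=> // -[i0 i] _ /=.
by rewrite ord1 !mxE (le_trans (xb i))// ler_norm.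
Qed.

Lemma leb_box n (c : 'rV[R]_n) r : 0 <= r -> leb n (box c r) = ((2 * r) ^+ n)%:E.
Proof.
move=> r0; elim: n c => [|n ih] c.
  by rewrite /= diracE mem_set// => -[].
pose c' : 'rV[R]_n := \row_i c 0 (lift ord0 i).
have -> : leb n.+1 (box c r) = (mu1 \x leb n)%E (`[c 0 ord0 - r, c 0 ord0 + r] `*` box c' r).
  congr product_measure1.
  rewrite eqEsubset; split=> -[t x] /=.
    move=> xb; split.
      by have := xb ord0; rewrite row_cons0 in_itv/= ler_distlC; lra.
    by move=> i /=; have := xb (lift ord0 i); rewrite row_consS mxE.
  move=> [tb xb] i; case: (unliftP ord0 i) => [j ->|->].
    by rewrite row_consS; have := xb j; rewrite mxE.
  by rewrite row_cons0 ler_distl.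
rewrite product_measure1E//; last exact: measurable_box.
rewrite exprS EFinM; congr (_ * _)%E; last exact: ih.
rewrite [LHS]lebesgue_measure_itv/= lte_fin; case: ltP => cr.
  by rewrite -EFinB; congr EFin; ring.
by congr EFin; lra.
Qed.

(** Both orders of integration are recorded, since the coordinate in which a
    function is differentiated must be integrated first. *)
Lemma integral_lebS n (h : borel 'rV[R]_n.+1 -> \bar R) : (leb n.+1).-integrable setT h ->
  (\int[leb n.+1]_x h x = \int[mu1]_t \int[leb n]_x h (row_cons (t, x)))%E /\
  (\int[leb n.+1]_x h x = \int[leb n]_x \int[mu1]_t h (row_cons (t, x)))%E.
Proof.
move=> ih; have mh := measurable_int _ ih.
have mh' : measurable_fun setT (h \o @row_cons R n).
  by apply: measurableT_comp => //; exact: row_cons_measurable.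
have ih' : (mu1 \x leb n)%E.-integrable setT (h \o @row_cons R n).
  apply/integrableP; split=> //.
  move/integrableP : ih => [_]; apply: le_lt_trans.
  rewrite [leRHS](ge0_integral_pushforward (@row_cons_measurable R n))//.
  by apply: measurableT_comp.
have E : (\int[leb n.+1]_x h x = \int[mu1 \x leb n]_x (h \o @row_cons R n) x)%E.
  by rewrite [LHS](integral_pushforward (@row_cons_measurable R n)).
by split; rewrite E; [rewrite -integral12_prod_meas1|rewrite -integral21_prod_meas1].
Qed.

Lemma integrable_bounded_box n (h : 'rV[R]_n -> R) (c : 'rV[R]_n) (r C : R) :
  measurable_fun setT (h : borel 'rV[R]_n -> R) ->
  0 <= r -> (forall x, ~ box c r x -> h x = 0) -> (forall x, `|h x| <= C) ->
  (leb n).-integrable setT (EFin \o (h : borel 'rV[R]_n -> R)).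
Proof.
move=> mh r0 h0 hC.
have H : (leb n).-integrable (box c r) (EFin \o (h : borel 'rV[R]_n -> R)).
  apply: measurable_bounded_integrable.
  - exact: measurable_box.
  - by rewrite [ltLHS](leb_box c r0) ltry.
  - exact: measurable_funTS.
  - exists C; split; first exact: num_real.
    by move=> M CM x _; apply: le_trans (ltW CM).
move/integrable_mkcond : H => /(_ (@measurable_box n c r)).
apply: eq_integrable => // x _; rewrite patchE; case: ifPn => // /negP; rewrite inE => nx.
by rewrite /= h0.
Qed.

Lemma integral_derive_R (X Y : R -> R) (r : R) :
  (forall t : R, is_derive t 1 X (Y t)) -> continuous Y ->
  (forall t : R, r < `|t| -> X t = 0) ->
  (\int[mu1]_t (Y t)%:E = 0)%E.
Proof.
move=> dX cY X0.
pose r' : R := `|r| + 1.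
have rr' : r < r' by rewrite /r' ltr_pwDr// ler_norm.
have r'0 : 0 < r' by rewrite ltr_wpDl.
have Y0 (t : R) : r < `|t| -> Y t = 0.
  move=> rt; have [_ <-] := dX t.
  transitivity ('D_1 (cst 0 : R -> R) t); last by rewrite derive_cst.
  apply: near_eq_derive; near=> u; apply: X0; near: u.
  have := @norm_continuous R R^o t; rewrite /continuous_at => /cvgr_gt; exact.
rewrite (_ : (\int[mu1]_t (Y t)%:E)%E = \int[mu1]_(t in `[(- r')%R, r'%R]) (Y t)%:E)%E; last first.
  rewrite [RHS]integral_mkcond; apply: eq_integral => t _; rewrite patchE.
  case: ifPn => // /negP tr; rewrite Y0//.
  rewrite ltNge; apply/negP => /le_trans tr'; apply: tr; rewrite inE/= in_itv/= -ler_norml.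
  by apply: tr'; exact: ltW.
rewrite (@continuous_FTC2 _ Y X).
- by rewrite !X0 ?subee// ?normrN (ger0_norm (ltW r'0)).
- lra.
- exact: continuous_subspaceT.
- have cX : continuous X.
    move=> t; apply/differentiable_continuous/derivable1_diffP.
    by case: (dX t).
  split.
  + by move=> t _; case: (dX t).
  + exact/cvg_at_right_filter/cX.
  + exact/cvg_at_left_filter/cX.
- by move=> t _; rewrite derive1E; case: (dX t).
Unshelve. all: by end_near. Qed.

Lemma derive_zero_outside n (X : 'rV[R]_n -> R) (c : 'rV[R]_n) r v x :
  (forall x, ~ box c r x -> X x = 0) -> ~ box c r x -> 'D_v X x = 0.
Proof.
move=> X0 nx; rewrite (@near_eq_derive R _ _ X (cst 0)) ?derive_cst//.
have oB : open (~` box c r) by apply: closed_openC; exact: closed_box.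
by apply: filterS (open_nbhs_nbhs (conj oB nx)) => y /X0.
Qed.

Lemma continuous_box_bounded n (Y : 'rV[R]_n -> R) c r : continuous Y ->
  (forall x, ~ box c r x -> Y x = 0) -> exists C : R, forall x, `|Y x| <= C.
Proof.
move=> cY Y0.
have [|M [_ HM]] := @compact_bounded _ R^o (Y @` box c r).
  apply: continuous_compact; last exact: compact_box.
  exact: continuous_subspaceT.
exists (`|M| + 1) => x; have [xb|nx] := pselect (box c r x); last first.
  by rewrite Y0// normr0 addr_ge0.
apply: HM; last by exists x.
by rewrite (le_lt_trans (ler_norm _))// ltrDl.
Qed.

Lemma row_cons_line n (t u : R) (x : 'rV[R]_n) :
  (row_cons (u + t, x) : 'rV_n.+1) = u *: delta_mx 0 ord0 + row_cons (t, x).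
Proof.
apply/rowP => i; rewrite !mxE/=; case: splitP => j ij.
  have -> : i = ord0 by apply: val_inj; rewrite /= ij (ord1 j).
  by rewrite !mxE eqxx (ord1 j) !mulr1n mulr1.
rewrite (_ : (i == ord0) = false) ?andbF ?mulr0 ?add0r//.
by apply/eqP => i0; move: ij; rewrite i0.
Qed.

Lemma row_cons_lineS n (t u : R) (x : 'rV[R]_n) j :
  (row_cons (t, u *: delta_mx 0 j + x) : 'rV_n.+1) =
  u *: delta_mx 0 (lift ord0 j) + row_cons (t, x).
Proof.
apply/rowP => i; case: (unliftP ord0 i) => [k ->|->].
  by rewrite row_consS [in RHS]mxE row_consS !mxE (inj_eq lift_inj).
by rewrite row_cons0 [in RHS]mxE row_cons0 !mxE (negbTE (neq_lift _ _)) andbF mulr0 add0r.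
Qed.

(** Integrating first in the direction of the derivative leaves the integral over R
    of the derivative of a compactly supported function. *)
Lemma integral_partial n (X Y : 'rV[R]_n -> R) i c r :
  0 <= r -> (forall x, ~ box c r x -> X x = 0) ->
  (forall x : 'rV[R]_n, is_derive x (delta_mx 0 i) X (Y x)) -> continuous Y ->
  (\int[leb n]_x (Y x)%:E = 0)%E.
Proof.
move=> r0; elim: n X Y i c => [|n ih] X Y i c X0 dX cY; first by case: i {dX}.
have Y0 x : ~ box c r x -> Y x = 0.
  by move=> nx; have [_ <-] := dX x; exact: derive_zero_outside nx.
have [C YC] := continuous_box_bounded cY Y0.
have mY : measurable_fun setT (Y : borel 'rV[R]_n.+1 -> R).
  by apply: continuous_borel_real; [exact: openT|move=> x _; exact: cY].
have iY := integrable_bounded_box mY r0 Y0 YC.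
have [E1 E2] := integral_lebS iY.
pose c' : 'rV[R]_n := \row_i c 0 (lift ord0 i).
have nbox t x : ~ box c r (row_cons (t, x)) \/
    `|t - c 0 ord0| <= r /\ box c' r x.
  have [b|] := pselect (box c r (row_cons (t, x))); last by left.
  right; split; first by have := b ord0; rewrite row_cons0.
  by move=> j; have := b (lift ord0 j); rewrite row_consS mxE.
have [j ij|i0] := unliftP ord0 i.
  rewrite [LHS]E1; apply: integral0_eq => t _.
  apply: (ih (fun x => X (row_cons (t, x))) (fun x => Y (row_cons (t, x))) j c').
  - by move=> x nx; apply: X0; case: (nbox t x) => // -[].
  - move=> x; have [d1 d2] := dX (row_cons (t, x)).
    have E : (fun u : R => u^-1 *: ((X \o shift (row_cons (t, x) : 'rV_n.+1)) (u *: delta_mx 0 i)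
          - X (row_cons (t, x)))) =
        (fun u : R => u^-1 *: (((fun x => X (row_cons (t, x))) \o shift x) (u *: delta_mx 0 j)
          - X (row_cons (t, x)))).
      by apply/funext => u; rewrite /= ij -row_cons_lineS.
    by split; [rewrite /derivable -E|rewrite -d2 /derive -E].
  - move=> x; apply: (@continuous_comp _ _ _ (fun x => row_cons (t, x) : 'rV_n.+1) Y).
      apply: row_continuous => k; case: (unliftP ord0 k) => [l ->|->].
        rewrite (_ : (fun y => _) = (fun y : 'rV[R]_n => y 0 l)).
          exact: coord_continuous.
        by apply/funext => y; rewrite row_consS.
      rewrite (_ : (fun y => _) = cst t); first exact: cst_continuous.
      by apply/funext => y; rewrite row_cons0.
    exact: cY.
rewrite [LHS]E2; apply: integral0_eq => x _.
apply: (@integral_derive_R (fun t => X (row_cons (t, x)))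
  (fun t => Y (row_cons (t, x))) (`|c 0 ord0| + r)).
- move=> t; have [d1 d2] := dX (row_cons (t, x)).
  have E : (fun u : R => u^-1 *: ((X \o shift (row_cons (t, x) : 'rV_n.+1)) (u *: delta_mx 0 i)
        - X (row_cons (t, x)))) =
      (fun u : R => u^-1 *: (((fun t => X (row_cons (t, x))) \o shift t) (u *: (1 : R))
        - X (row_cons (t, x)))).
    by apply/funext => u; rewrite /= i0 -row_cons_line [u *: 1]mulr1.
  by split; [rewrite /derivable -E|rewrite -d2 /derive -E].
- move=> t; apply: (@continuous_comp _ _ _ (fun t => row_cons (t, x) : 'rV_n.+1) Y).
    apply: row_continuous => k; case: (unliftP ord0 k) => [l ->|->].
      rewrite (_ : (fun y => _) = cst (x 0 l)); first exact: cst_continuous.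
      by apply/funext => y; rewrite row_consS.
    rewrite (_ : (fun y => _) = id); first exact: cvg_id.
    by apply/funext => y; rewrite row_cons0.
  exact: cY.
- move=> t tr; apply: X0; case: (nbox t x) => // -[tc _].
  move: tr; rewrite ltNge -[X in `|X|](subrK (c 0 ord0)) => /negP[].
  by rewrite (le_trans (ler_normD _ _))// [leRHS]addrC lerD2r.
Qed.

End leb_theory.

(** * Integration in a chart *)

Section integral_density.
Context d d' (T : measurableType d) (T' : measurableType d') (R : realType).
Variables (mu : {measure set T -> \bar R}) (nu : {measure set T' -> \bar R}).
Variables (D : set T) (I : set T') (phi : T' -> T) (w : T' -> R).
Hypotheses (mD : measurable D) (mI : measurable I).
Hypotheses (mphi : measurable_fun I phi) (mw : measurable_fun I w).
Hypotheses (w0 : forall x, I x -> 0 <= w x) (ID : forall x, I x -> D (phi x)).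
Hypothesis density : forall B, measurable B -> B `<=` D ->
  (mu B = \int[nu]_(x in I) (w x * \1_B (phi x))%:E)%E.

Import HBNNSimple.

(** The hypothesis is the case of indicators; simple functions and monotone
    convergence do the rest. *)
Lemma ge0_integral_density (F : T -> \bar R) : measurable_fun D F ->
  (forall x, D x -> 0 <= F x)%E ->
  (\int[mu]_(x in D) F x = \int[nu]_(x in I) ((w x)%:E * F (phi x)))%E.
Proof.
move=> mF F0; pose f_ := nnsfun_approx mD mF.
have mfphi n : measurable_fun I (fun x => f_ n (phi x)).
  by apply: (measurable_comp measurableT) => //; exact: measurable_funP.
transitivity (limn (fun n => \int[mu]_(x in D) (f_ n x)%:E)%E).
  rewrite -monotone_convergence//.
  - apply: eq_integral => y /[!inE] yD; apply/esym/cvg_lim => //.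
    exact: cvg_nnsfun_approx.
  - by move=> n; exact/measurable_EFinP/measurable_funTS/measurable_funP.
  - by move=> n y _; rewrite lee_fin.
  - by move=> y _ m n mn; rewrite lee_fin; exact/lefP/nd_nnsfun_approx.
transitivity (limn (fun n => \int[nu]_(x in I) (w x * f_ n (phi x))%:E)%E); last first.
  rewrite -monotone_convergence//.
  - apply: eq_integral => x /[!inE] Ix; apply/cvg_lim => //.
    rewrite (_ : (fun n => _) = (fun n => (w x)%:E * (f_ n (phi x))%:E)%E)//.
    apply: cvgeZl => //; apply: cvg_nnsfun_approx => //; exact: ID.
  - by move=> n; apply/measurable_EFinP; apply: measurable_funM.
  - by move=> n y Iy; rewrite lee_fin mulr_ge0// w0.
  - move=> y Iy m n mn; rewrite lee_fin ler_wpM2l ?w0//.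
    by have /lefP := nd_nnsfun_approx mD mF mn; exact.
congr (limn _); apply/funext => n.
have mfk r : measurable (f_ n @^-1` [set r]) by [].
transitivity (\sum_(k \in range (f_ n))
    \int[mu]_(x in D) (k * \1_(f_ n @^-1` [set k]) x)%:E)%E.
  under eq_integral do rewrite fimfunE -fsumEFin//.
  rewrite ge0_integral_fsum//.
  - by move=> y; apply/measurable_EFinP; exact/measurable_funTS/measurable_funM.
  - by move=> y x _; rewrite nnfun_muleindic_ge0.
transitivity (\sum_(k \in range (f_ n))
    \int[nu]_(x in I) (w x * (k * \1_(f_ n @^-1` [set k]) (phi x)))%:E)%E; last first.
  rewrite -ge0_integral_fsum//.
  - apply: eq_integral => x _; rewrite fsumEFin// fimfunE; congr EFin.
    by rewrite !fsbig_finite//= big_distrr.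
  - move=> y; apply/measurable_EFinP; apply: measurable_funM => //.
    apply: measurable_funM => //.
    by apply: (measurable_comp measurableT).
  - move=> y x Ix; rewrite lee_fin mulr_ge0 ?w0//.
    by have := @nnfun_muleindic_ge0 _ _ _ (f_ n) y (phi x); rewrite lee_fin.
apply: eq_fsbigr => r /[!inE] -[t _ rt].
have r0 : 0 <= r by rewrite -rt.
pose B := D `&` f_ n @^-1` [set r].
have mB : measurable B by exact: measurableI.
transitivity (r%:E * mu B)%E.
  rewrite integralZl_indic_nnsfun// integral_indic//.
  by rewrite setIC.
rewrite (density mB (@subIsetl _ _ _)).
transitivity (\int[nu]_(x in I) (r%:E * (w x * \1_B (phi x))%:E))%E.
  rewrite ge0_integralZl_EFin//.
  - by move=> x Ix; rewrite lee_fin mulr_ge0// w0.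
  - apply/measurable_EFinP; apply: measurable_funM => //.
    by apply: (measurable_comp measurableT).
apply: eq_integral => x /[!inE] Ix; rewrite -EFinM; congr EFin.
rewrite mulrCA; congr (_ * (_ * _)).
rewrite !indicE (_ : (phi x \in B) = (phi x \in f_ n @^-1` [set r]))//.
apply/idP/idP; rewrite !inE /B; first by move=> [].
by move=> H; split => //; exact: ID.
Qed.

Lemma integral_density (F : T -> R) : measurable_fun D F ->
  (\int[mu]_(x in D) (F x)%:E = \int[nu]_(x in I) (w x * F (phi x))%:E)%E.
Proof.
move=> mF; rewrite [LHS]integralE [RHS]integralE.
have wmax x y : I x -> (w x * Num.max y 0 = Num.max (w x * y) 0).
  by move=> Ix; rewrite maxr_pMr ?w0// mulr0.
congr (_ - _)%E.
  rewrite ge0_integral_density//; last exact/measurable_funepos/measurable_EFinP.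
  apply: eq_integral => x /[!inE] Ix; rewrite !funeposE.
  by rewrite -!EFin_max -EFinM wmax.
rewrite ge0_integral_density//; last exact/measurable_funeneg/measurable_EFinP.
apply: eq_integral => x /[!inE] Ix; rewrite !funenegE.
by rewrite -!EFinN -!EFin_max -EFinM wmax// mulrN.
Qed.

End integral_density.

(** * The metric in a chart *)

Section positive_definite.
Context {R : realType} {n : nat}.

Definition posdef (G : 'M[R]_n) := forall v : 'rV[R]_n, v != 0 -> 0 < (v *m G *m v^T) 0 0.

Lemma posdef_unit G : posdef G -> G \in unitmx.
Proof.
move=> pG; rewrite -row_free_unit -kermx_eq0.
apply/eqP/row_matrixP => i; rewrite row0; apply/eqP/negPn/negP => r0.
have := pG _ r0; rewrite -row_mul mulmx_ker row0 mul0mx mxE ltxx.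
by [].
Qed.

Lemma rv_norm2_gt0 (v : 'rV[R]_n) : v != 0 -> 0 < (v *m v^T) 0 0.
Proof.
move=> v0; have [i vi] : exists i, v 0 i != 0.
  apply/existsP; apply: contraNT v0 => /existsPn H; apply/eqP/rowP => i.
  by rewrite mxE; apply/eqP; have := H i; rewrite negbK.
rewrite mxE (bigD1 i)//= mxE ltr_pwDl// ?sumr_ge0// -?expr2 ?exprn_even_gt0//.
by move=> j _; rewrite mxE -expr2 sqr_ge0.
Qed.

(** No matrix on the segment from the identity to G is singular, so that the
    determinant keeps its sign there. *)
Lemma posdef_det_gt0 G : posdef G -> 0 < \det G.
Proof.
move=> pG.
(* the determinant along the segment is a polynomial, so that the intermediate
   value theorem applies to it *)
pose P : 'M[{poly R}]_n := (1 - 'X)%:M + 'X *: map_mx polyC G.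
have PE t : (\det P).[t] = \det ((1 - t)%:M + t *: G).
  rewrite -[LHS]/(horner_eval t (\det P)) -det_map_mx; congr (\det _).
  apply/matrixP => i j; rewrite !mxE /= /horner_eval hornerD hornerM hornerX hornerC.
  by case: eqP => _; rewrite ?mulr1n ?mulr0n ?hornerD ?hornerN ?hornerC ?hornerX.
have Pn0 t : 0 <= t <= 1 -> (\det P).[t] != 0.
  move=> /andP[t0 t1]; rewrite PE -unitfE -unitmxE; apply: posdef_unit => v v0.
  rewrite mulmxDr mulmxDl mxE mul_mx_scalar -scalemxAl -scalemxAr -scalemxAl !mxE.
  have := rv_norm2_gt0 v0; have := pG _ v0; rewrite !mxE => a b.
  have [t2|t2] := ltP t (1/2).
    by rewrite ltr_pwDl// ?mulr_gt0 ?mulr_ge0 ?(ltW a)//; lra.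
  by rewrite ltr_wpDl// ?mulr_gt0 ?mulr_ge0 ?(ltW b)//; lra.
rewrite ltNge; apply/negP => detG.
have E1 : (\det P).[1] <= 0 by rewrite PE subrr scale1r raddf0 add0r.
have E0 : 0 <= (\det P).[0] by rewrite PE subr0 scale0r addr0 det1.
have [|t t01 /rootP] := @poly_ivt R (- \det P) 0 1 ler01.
  by rewrite !hornerN oppr_le0 oppr_ge0 E0 E1.
rewrite hornerN => /eqP; rewrite oppr_eq0; apply/negP; exact: Pn0.
Qed.

End positive_definite.

Section metric.
Context {R : realType} {n : nat} {M : ptopologicalType}.
Variables (A : set (chart R n M)) (g : chart R n M -> 'rV[R]_n -> 'M[R]_n).
Hypothesis gM : riemannian_metric A 4 g.
Variable (e : chart R n M).
Hypothesis eA : A e.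
Local Notation I := (chart_img e).

Lemma Ck_det k m (F : 'rV[R]_n -> 'M[R]_m) (U : set 'rV[R]_n) : open U ->
  (forall i j, Ck k U (fun x => F x i j)) -> Ck k U (fun x => \det (F x)).
Proof.
move=> oU cF; rewrite /determinant; apply: Ck_sum => // s _.
by apply: CkZ => //; apply: Ck_prod.
Qed.

Lemma open_img : open I. Proof. exact: chart_img_open. Qed.

Lemma metric_posdef x : I x -> posdef (g e x).
Proof. by move=> Ix v; exact: (metric_pos gM). Qed.

Lemma metric_det_gt0 x : I x -> 0 < \det (g e x).
Proof. by move=> Ix; apply: posdef_det_gt0; exact: metric_posdef. Qed.

Definition vol x := Num.sqrt (\det (g e x)).

Lemma vol_gt0 x : I x -> 0 < vol x.
Proof. by move=> Ix; rewrite sqrtr_gt0 metric_det_gt0. Qed.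

Lemma Ck_vol : Ck 4 I vol.
Proof.
apply: Ck_sqrt; [exact: open_img|exact: metric_det_gt0|].
by apply: (Ck_det open_img) => i j; exact: (metric_Ck gM).
Qed.

Lemma Ck_invmx i j : Ck 4 I (fun x => invmx (g e x) i j).
Proof.
have oI := open_img.
apply: (@Ck_eq _ _ _ _ (fun x => (\det (g e x))^-1 * cofactor (g e x) j i)) => //.
  move=> x; rewrite inE => Ix; rewrite /invmx posdef_unit; last exact: metric_posdef.
  by rewrite !mxE.
apply: (@CkM _ _ _ _ (fun x => (\det (g e x))^-1)) => //.
  apply: CkV => //; first by move=> x Ix; rewrite gt_eqF// metric_det_gt0.
  by apply: (Ck_det oI) => a b; exact: (metric_Ck gM).
rewrite /cofactor; apply: CkZ => //; apply: (Ck_det oI) => a b.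
by under eq_fun do rewrite !mxE; exact: (metric_Ck gM).
Qed.

(** The coefficients of the divergence form of the Laplace-Beltrami operator. *)
Definition flux i j x := vol x * invmx (g e x) i j.

Lemma Ck_flux i j : Ck 4 I (flux i j).
Proof. by apply: CkM; [exact: open_img|exact: Ck_vol|exact: Ck_invmx]. Qed.

Lemma flux_sym i j x : I x -> flux i j x = flux j i x.
Proof.
move=> Ix; rewrite /flux; congr (_ * _).
have E : (invmx (g e x))^T = invmx (g e x) by rewrite trmx_inv (Defs.metric_sym gM eA Ix).
by rewrite -{1}E mxE.
Qed.

End metric.

Section chart_facts.
Context {R : realType} {n : nat} {M : topologicalType}.
Variable e : chart R n M.

Lemma chart_img_in p : chart_dom e p -> chart_img e (e p).
Proof. by move=> Dp; exists p. Qed.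

Lemma chart_inv_dom x : chart_img e x -> chart_dom e (chart_inv e x).
Proof. by move=> [p Dp <-]; rewrite chart_mapK. Qed.

Lemma chart_invK x : chart_img e x -> e (chart_inv e x) = x.
Proof. by move=> [p Dp <-]; rewrite chart_mapK. Qed.

End chart_facts.

Section chart_integral.
Context {R : realType} {n : nat} {M : ptopologicalType}.
Variables (A : set (chart R n M)) (g : chart R n M -> 'rV[R]_n -> 'M[R]_n).
Variable mu : {measure set (borel M) -> \bar R}.
Hypotheses (gM : riemannian_metric A 4 g) (muM : volume_measure A g mu).
Variable (e : chart R n M).
Hypothesis eA : A e.
Local Notation I := (chart_img e).
Local Notation D := (chart_dom e).
Local Notation leb := (@leb R n).

Lemma measurable_img : measurable (I : set (borel 'rV[R]_n)).
Proof. by apply: open_borel; exact: open_img. Qed.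

Lemma measurable_dom : measurable (D : set (borel M)).
Proof. by apply: open_borel; exact: chart_dom_open. Qed.

Lemma measurable_chart_inv :
  measurable_fun (I : set (borel 'rV[R]_n)) (chart_inv e : borel 'rV[R]_n -> borel M).
Proof. by apply: continuous_borel; [exact: open_img|exact: chart_inv_continuous]. Qed.

Lemma Ck_measurable k U (h : 'rV[R]_n -> R) : open U -> Ck k U h ->
  measurable_fun (U : set (borel 'rV[R]_n)) (h : borel 'rV[R]_n -> R).
Proof. by move=> oU ch; apply: continuous_borel_real => //; exact: Ck_continuous ch. Qed.

Lemma measurable_vol : measurable_fun (I : set (borel 'rV[R]_n)) (vol g e : borel 'rV[R]_n -> R).
Proof. by apply: Ck_measurable; [exact: open_img|exact: Ck_vol gM _ eA]. Qed.

(** The iterated integral of the definition becomes an integral for a measure. *)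
Lemma chart_density B : measurable (B : set (borel M)) -> B `<=` D ->
  (mu B = \int[leb]_(x in I) (vol g e x * \1_B (chart_inv e x))%:E)%E.
Proof.
move=> mB BD; rewrite (muM eA mB BD).
have eBE x : I x -> (x \in e @` B) = (chart_inv e x \in B).
  move=> Ix; apply/idP/idP; rewrite !inE.
    by move=> [p Bp <-]; rewrite chart_mapK//; exact: BD.
  by move=> Bx; exists (chart_inv e x) => //; rewrite chart_invK.
have eBI x : (e @` B) x -> I x by move=> [p Bp <-]; apply: chart_img_in; exact: BD.
have E : (fun x => (Num.sqrt (\det (g e x)) * \1_(e @` B) x)%:E) =
    ((fun x => (vol g e x * \1_B (chart_inv e x))%:E) \_ I).
  apply/funext => x; rewrite patchE; case: ifPn => [/[!inE] Ix|/negP/[!inE] nI].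
    by rewrite /vol !indicE eBE.
  rewrite indicE (_ : (x \in e @` B) = false) ?mulr0//.
  by apply/negbTE/negP; rewrite inE => /eBI.
have mI := measurable_img.
rewrite integral_rVE ?E -?integral_mkcond//.
  apply/(measurable_restrictT _ mI)/measurable_EFinP; apply: measurable_funM => //.
    exact: measurable_vol.
  refine (measurable_comp measurableT (@subsetT _ _) (measurable_indic mB)
    measurable_chart_inv).
Qed.

Lemma chart_integral (F : M -> R) :
  measurable_fun (D : set (borel M)) (F : borel M -> R) -> (forall p, ~ D p -> F p = 0) ->
  (\int[mu]_p (F p)%:E = \int[leb]_(x in I) (vol g e x * F (chart_inv e x))%:E)%E.
Proof.
move=> mF F0; rewrite -(integral_density measurable_dom measurable_img
    measurable_chart_inv measurable_vol _ _ chart_density mF).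
- rewrite [RHS]integral_mkcond; apply: eq_integral => p _; rewrite patchE.
  by case: ifPn => // /negP/[!inE] nD; rewrite F0.
- by move=> x Ix; rewrite sqrtr_ge0.
- exact: chart_inv_dom.
Qed.

End chart_integral.

Section divergence.
Context {R : realType} {n : nat}.

Lemma compact_sub_box (K : set 'rV[R]_n) : compact K -> exists2 r, 0 <= r & K `<=` box 0 r.
Proof.
move=> /compact_bounded[r [_ Kr]]; exists (`|r| + 1); first by rewrite addr_ge0.
move=> x Kx i; rewrite mxE subr0; apply: le_trans (coord_le_norm _ _) _.
by apply: Kr => //; rewrite (le_lt_trans (ler_norm _))// ltrDl.
Qed.

(** The two open sets U and the complement of K cover the space. *)
Lemma Ck_extend0 k (U K : set 'rV[R]_n) h : open U -> closed K -> Ck k U h ->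
  K `<=` U -> (forall x, U x -> ~ K x -> h x = 0) -> Ck k setT (h \_ U).
Proof.
move=> oU cK ch KU h0; apply: Ck_local => x _.
have [Kx|nKx] := pselect (U x).
  exists U => //; apply: Ck_eq ch => // y yU; by rewrite patchE yU.
exists (~` K); first by move=> /KU.
apply: (@Ck_eq _ _ _ _ (cst 0)); [exact: closed_openC| |exact: Ck_cst].
move=> y; rewrite inE => nKy; rewrite patchE; case: ifPn => // /[!inE] Uy.
by rewrite h0.
Qed.

(** Extended by 0 the field is C^1 on the whole space, where the integral of each
    partial derivative vanishes. *)
Lemma integral_divergence (U K : set 'rV[R]_n) (X : 'I_n -> 'rV[R]_n -> R) :
  open U -> compact K -> K `<=` U -> (forall i, Ck 1 U (X i)) ->
  (forall i x, U x -> ~ K x -> X i x = 0) ->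
  (\int[@leb R n]_(x in U) (\sum_i partial i (X i) x)%:E = 0)%E.
Proof.
move=> oU cK KU cX X0; have [r r0 Kr] := compact_sub_box cK.
have clK : closed K by apply: compact_closed => //; exact: norm_hausdorff.
have cX' i : Ck 1 setT (X i \_ U) by apply: Ck_extend0 clK _ KU _ => // x; exact: X0.
have X'0 i x : ~ box 0 r x -> (X i \_ U) x = 0.
  move=> nx; rewrite patchE; case: ifPn => // /[!inE] Ux; rewrite X0//.
  by move=> /Kr.
have cY i : continuous (partial i (X i \_ U)).
  by move=> x; have := Ck_continuous (Ck_partial i (cX' i)); exact.
have Y0 i x : ~ box 0 r x -> partial i (X i \_ U) x = 0.
  by move=> nx; apply: derive_zero_outside nx => y; exact: X'0.
have dX i x : is_derive x (delta_mx 0 i) (X i \_ U) (partial i (X i \_ U) x).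
  by apply: DeriveDef => //; apply: Ck_derivable (cX' i) _.
have iY i : (@leb R n).-integrable setT (fun x => (partial i (X i \_ U) x)%:E).
  have [C YC] := continuous_box_bounded (cY i) (Y0 i).
  apply: (integrable_bounded_box _ r0 (Y0 i) YC).
  by apply: continuous_borel_real; [exact: openT|move=> x _; exact: cY].
transitivity (\int[@leb R n]_x (\sum_i (partial i (X i \_ U) x)%:E))%E.
  rewrite integral_mkcond; apply: eq_integral => x _; rewrite patchE sumEFin.
  have [/[!inE] Ux|/negP/[!inE] nU] := boolP (x \in U).
    congr EFin; apply: eq_bigr => i _; apply: (@partial_eq _ _ U) => //; last by rewrite inE.
    by move=> y yU; rewrite patchE yU.
  rewrite big1// => i _; rewrite /partial (@near_eq_derive R _ _ _ (cst 0)) ?derive_cst//.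
  have nK : (~` K) x by move=> /KU.
  apply: filterS (open_nbhs_nbhs (conj (closed_openC clK) nK)) => y nKy.
  by rewrite patchE; case: ifPn => // /[!inE] Uy; rewrite X0.
rewrite integral_sum//; apply: big1 => i _.
exact: (integral_partial r0 (X'0 i) (dX i) (cY i)).
Qed.

End divergence.

(** * Square integrable functions *)

Section real_L2.
Context d (T : measurableType d) (R : realType) (mu : {measure set T -> \bar R}).
Implicit Types f h : T -> R.
Local Notation sqint f := (f \in Lfun mu 2%:E).

Lemma sqint_measurable f : sqint f -> measurable_fun setT f.
Proof. by rewrite inE => /andP[/[!inE]]. Qed.

Lemma sqintI f : measurable_fun setT f -> (\int[mu]_x (f x ^+ 2)%:E < +oo)%E -> sqint f.
Proof.
move=> mf fi; rewrite inE; apply/andP; split; rewrite inE//= /finite_norm.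
rewrite unlock poweR_lty//; apply: le_lt_trans fi.
rewrite le_eqVlt; apply/orP; left; apply/eqP; apply: eq_integral => x _ /=.
by rewrite powR_mulrn// real_normK// num_real.
Qed.

Lemma sqint_mul f h : sqint f -> sqint h -> mu.-integrable setT (fun x => (f x * h x)%:E).
Proof. by move=> lf lh; have /Lfun1_integrable := Lfun2_mul_Lfun1 lf lh. Qed.

Lemma sqint_add f h : sqint f -> sqint h -> sqint (fun x => f x + h x).
Proof. by have [_] := Lfun_addr_closed mu (lee1n 2); exact. Qed.

Lemma sqint_scale a f : sqint f -> sqint (fun x => a * f x).
Proof.
move=> lf; rewrite (_ : (fun x => _) = a \o* f); last first.
  by apply/funext => x; rewrite /= mulrC.
by apply: Lfun_scale => //; rewrite ler1n.
Qed.

Lemma sqint_sub f h : sqint f -> sqint h -> sqint (fun x => f x - h x).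
Proof.
move=> lf lh; rewrite (_ : (fun x => _) = (fun x => f x + (-1) * h x)); last first.
  by apply/funext => x; rewrite mulN1r.
by apply: sqint_add => //; exact: sqint_scale.
Qed.

(** Riesz-Fischer: a subsequence with summable increments converges almost
    everywhere, and Fatou's lemma identifies the limit. *)
Lemma sqint_complete (f : nat -> T -> R) : (forall n, sqint (f n)) ->
  (forall eps : R, 0 < eps -> exists N, forall m n, (N <= m)%N -> (N <= n)%N ->
    (\int[mu]_x ((f m x - f n x) ^+ 2)%:E <= eps%:E)%E) ->
  exists2 w, sqint w &
    forall eps : R, 0 < eps -> exists N, forall n, (N <= n)%N ->
    (\int[mu]_x ((f n x - w x) ^+ 2)%:E <= eps%:E)%E.
Proof.
move=> lf cf.
have mf n := sqint_measurable (lf n).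
have /choice[N NP] : forall i : nat, exists N, forall m n, (N <= m)%N -> (N <= n)%N ->
    (\int[mu]_x ((f m x - f n x) ^+ 2)%:E <= ((4^-1) ^+ i)%:E)%E.
  by move=> i; apply: cf; rewrite exprn_gt0.
(* a subsequence along which the increments decrease like 2 ^- i *)
pose k i := (i + \sum_(j < i.+1) N j)%N.
have kN i : (N i <= k i)%N.
  by rewrite /k big_ord_recr/= addnA leq_addl.
have kS i : (k i <= k i.+1)%N.
  by rewrite /k [in leqRHS]big_ord_recr/= leq_add// leq_addr.
have ki i : (i <= k i)%N by rewrite /k leq_addr.
pose D i x := f (k i.+1) x - f (k i) x.
have mD i : measurable_fun setT (D i) by exact: measurable_funB.
have DP i : (\int[mu]_x (D i x ^+ 2)%:E <= ((4^-1) ^+ i)%:E)%E.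
  by apply: NP; [exact: leq_trans (kN i) (kS i)|exact: kN].
(* the weight 2 ^+ i still gives a summable series, and it makes the increments
   themselves summable wherever this series converges *)
pose h i x : \bar R := (2 ^+ i * D i x ^+ 2)%:E.
have h0 i x : (0 <= h i x)%E by rewrite lee_fin mulr_ge0 ?sqr_ge0// exprn_ge0.
have mh i : measurable_fun setT (h i).
  by apply/measurable_EFinP; apply: measurable_funM => //; exact: measurable_funX.
pose H x := (\sum_(i <oo) h i x)%E.
have mH : measurable_fun setT H by apply: ge0_emeasurable_sum => // i x _ _; exact: h0.
have H0 x : (0 <= H x)%E by apply: nneseries_ge0 => i _ _; exact: h0.
have iH : (\int[mu]_x H x <= 2%:E)%E.
  rewrite integral_nneseries//.
  apply: lime_le; first by apply: is_cvg_nneseries => i _ _; exact: integral_ge0.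
  apply: nearW => m; apply: (@le_trans _ _ (\sum_(0 <= i < m) ((2^-1) ^+ i)%:E)%E).
    apply: lee_sum => i _; rewrite /h.
    under eq_integral do rewrite EFinM.
    rewrite ge0_integralZl_EFin ?exprn_ge0//; last 2 first.
    - by move=> x _; rewrite lee_fin sqr_ge0.
    - by apply/measurable_EFinP; exact: measurable_funX.
    apply: (@le_trans _ _ ((2 ^+ i)%:E * ((4^-1) ^+ i)%:E)%E).
      by rewrite lee_wpmul2l// lee_fin exprn_ge0.
    rewrite -EFinM lee_fin -exprMn (_ : 2 * 4^-1 = 2^-1 :> R)//; lra.
  rewrite sumEFin lee_fin.
  suff -> : \sum_(0 <= i < m) (2^-1 : R) ^+ i = 2 - 2 * 2^-1 ^+ m.
    by rewrite gerBl mulr_ge0// exprn_ge0.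
  elim: m => [|m ih]; first by rewrite big_nil expr0; ring.
  by rewrite big_nat_recr//= ih exprS; field.
pose E := [set x | H x < +oo]%E.
have mE : measurable E.
  by rewrite -[E]setTI; apply: emeasurable_fun_infty_o.
have nE : mu (~` E) = 0%E.
  have iH' : mu.-integrable setT H.
    apply/integrableP; split=> //; under eq_integral do rewrite gee0_abs//.
    by apply: le_lt_trans iH _; rewrite ltry.
  have [B [mB B0 EB]] := integrable_ae measurableT iH'.
  apply: subset_measure0 B0 => //; first exact: measurableC.
  by move=> x /= nEx; apply: EB => /= /(_ I) Hx; apply: nEx; rewrite /E/= ltey_eq Hx.
have Hfin x : E x -> cvgn (fun i => f (k i) x).
  move=> Ex; have Hf : H x \is a fin_num by rewrite ge0_fin_numE.
  have -> : (fun i => f (k i) x) = (fun i => f (k 0%N) x + series (D^~ x) i).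
    apply/funext => i; rewrite /series/= /D telescope_sumr//.
    by rewrite addrC subrK.
  apply: is_cvgD; first exact: is_cvg_cst.
  apply: normed_cvg; apply: nondecreasing_is_cvgn.
    by apply: nondecreasing_series => i _ _; exact: normr_ge0.
  exists (2 + fine (H x)) => _ [m _ <-]; rewrite /series/=.
  apply: (@le_trans _ _ (\sum_(0 <= i < m) (2^-1 ^+ i + 2 ^+ i * D i x ^+ 2))).
    apply: ler_sum => i _.
    have p0 : 0 < (2 : R) ^+ i by rewrite exprn_gt0.
    rewrite exprVn; move: (2 ^+ i) p0 => p p0.
    rewrite -(ler_pM2l p0) mulrDr mulfV ?gt_eqF//.
    rewrite -(real_normK (num_real (D i x))).
    move: `|_| => t; nra.
  rewrite big_split/= lerD//.
    suff -> : \sum_(0 <= i < m) (2^-1 : R) ^+ i = 2 - 2 * 2^-1 ^+ m.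
      by rewrite gerBl mulr_ge0// exprn_ge0.
    elim: m => [|m ih]; first by rewrite big_nil expr0; ring.
    by rewrite big_nat_recr//= ih exprS; field.
  rewrite -lee_fin -sumEFin fineK//.
  by apply: nneseries_lim_ge => i _ _; exact: h0.
pose w x := if x \in E then limn (fun i => f (k i) x) else 0.
have wE x : E x -> f (k i) x @[i --> \oo] --> w x.
  by move=> Ex; rewrite /w mem_set//; exact: Hfin.
have mw : measurable_fun setT w.
  rewrite (_ : w = (fun x => limn (fun i => f (k i) x)) \_ E); last first.
    by apply/funext => x; rewrite patchE.
  apply/(measurable_restrictT _ mE).
  apply: (@measurable_fun_cvg _ _ _ _ (fun i => f (k i))).
    by move=> i; exact: measurable_funTS.
  by move=> x Ex; exact: Hfin.
have main eps : 0 < eps -> exists N, forall n, (N <= n)%N ->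
    (\int[mu]_x ((f n x - w x) ^+ 2)%:E <= eps%:E)%E.
  move=> e0; have [m mP] := cf _ e0; exists m => n mn.
  have mfw : measurable_fun setT (fun x => ((f n x - w x) ^+ 2)%:E).
    by apply/measurable_EFinP; apply: measurable_funX; exact: measurable_funB.
  rewrite (ge0_negligible_integral (measurableC mE))//; last first.
    by move=> x _; rewrite lee_fin sqr_ge0.
  pose u i x : \bar R := ((f n x - f (k (i + m)) x) ^+ 2)%:E.
  have mu_ i : measurable_fun E (u i).
    apply: measurable_funTS; apply/measurable_EFinP; apply: measurable_funX.
    exact: measurable_funB.
  have u0 i x : E x -> (0 <= u i x)%E by move=> _; rewrite lee_fin sqr_ge0.
  have uw x : E x -> limn_einf (u^~ x) = ((f n x - w x) ^+ 2)%:E.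
    move=> Ex.
    have c : u^~ x @ \oo --> ((f n x - w x) ^+ 2)%:E.
      apply: cvg_EFin; first exact: nearW.
      have c' : f n x - f (k (i + m)%N) x @[i --> \oo] --> f n x - w x.
        apply: cvgB; first exact: cvg_cst.
        by rewrite (cvg_shiftn m (fun i => f (k i) x)); exact: wE.
      by rewrite expr2; apply: cvg_trans (cvgM c' c').
    by rewrite is_cvg_limn_einfE ?(cvg_lim _ c)//; apply/cvg_ex; exists ((f n x - w x) ^+ 2)%:E.
  have E' : (\int[mu]_(x in E) ((f n x - w x) ^+ 2)%:E =
      \int[mu]_(x in E) limn_einf (u^~ x))%E.
    by apply: eq_integral => x; rewrite inE => Ex; rewrite uw.
  apply: (@le_trans _ _ (\int[mu]_(x in E) limn_einf (u^~ x))%E).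
    by rewrite -E' setTD setCK.
  apply: le_trans (fatou mu mE mu_ u0) _.
  rewrite limn_einf_lim; apply: lime_le; first exact: is_cvg_einfs.
  apply: nearW => i; apply: (@le_trans _ _ (\int[mu]_(x in E) u i x)%E).
    by apply: ereal_inf_lbound; exists i => /=.
  apply: (@le_trans _ _ (\int[mu]_x u i x)%E).
    apply: ge0_subset_integral => //.
      apply/measurable_EFinP; apply: measurable_funX; exact: measurable_funB.
    by move=> x _; rewrite lee_fin sqr_ge0.
  apply: mP => //; apply: leq_trans (ki _); exact: leq_addl.
exists w => //.
have [n nP] := main 1 ltr01.
rewrite (_ : w = (fun x => f n x - (f n x - w x))); last first.
  by apply/funext => x; rewrite opprB addrC subrK.
apply: sqint_sub => //; apply: sqintI; first exact: measurable_funB.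
by apply: le_lt_trans (nP n (leqnn n)) _; rewrite ltry.
Qed.

End real_L2.

Local Open Scope complex_scope.

Section ip.
Context d (T : measurableType d) (R : realType) (mu : {measure set T -> \bar R}).
Implicit Types f h : T -> R.
Local Notation sqint f := (f \in Lfun mu 2%:E).

Definition ip f h : R := \int[mu]_x (f x * h x).

Lemma ipC f h : ip f h = ip h f.
Proof. by rewrite /ip; congr (Rintegral _ _ _); apply/funext => x; rewrite mulrC. Qed.

Lemma ipDl f f' h : sqint f -> sqint f' -> sqint h ->
  ip (fun x => f x + f' x) h = ip f h + ip f' h.
Proof.
move=> lf lf' lh; rewrite /ip -RintegralD//; try exact: sqint_mul.
by congr (Rintegral _ _ _); apply/funext => x; rewrite mulrDl.
Qed.

Lemma ipZl a f h : sqint f -> sqint h -> ip (fun x => a * f x) h = a * ip f h.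
Proof.
move=> lf lh; rewrite /ip -RintegralZl//; last exact: sqint_mul.
by congr (Rintegral _ _ _); apply/funext => x; rewrite mulrA.
Qed.

Lemma ip_ge0 f : 0 <= ip f f.
Proof. by apply: Rintegral_ge0 => x _; rewrite -expr2 sqr_ge0. Qed.

Lemma ipE f h : sqint f -> sqint h -> (\int[mu]_x (f x * h x)%:E)%E = (ip f h)%:E.
Proof.
by move=> lf lh; rewrite fineK//; apply: integrable_fin_num => //; exact: sqint_mul.
Qed.

End ip.

Lemma mulcE (R : realType) (a b c d : R) :
  (a +i* b) * (c +i* d) = (a * c - b * d) +i* (a * d + b * c).
Proof. by []. Qed.

Lemma addcE (R : realType) (a b c d : R) : (a +i* b) + (c +i* d) = (a + c) +i* (b + d).
Proof. by []. Qed.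

Lemma sqr_lt_norm (R : realType) (x e : R) : 0 < e -> x ^+ 2 < e ^+ 2 -> `|x| < e.
Proof.
move=> e0; rewrite -(real_normK (num_real x)) => H; rewrite ltNge; apply/negP => ex.
by move: H; rewrite ltNge lerXn2r// nnegrE ltW.
Qed.

Section complex_L2.
Context {R : realType} {M : ptopologicalType}.
Variable mu : {measure set (borel M) -> \bar R}.
Implicit Types u v w : M -> R[i].
Local Notation L2 := (L2 mu).
Local Notation inner := (inner mu setT).
Local Notation ip := (ip mu).

Definition re u : borel M -> R := fun p => complex.Re (u p).
Definition im u : borel M -> R := fun p => complex.Im (u p).

Lemma L2P u : L2 u <-> re u \in Lfun mu 2%:E /\ im u \in Lfun mu 2%:E.
Proof. by []. Qed.

Lemma innerE u v : L2 u -> L2 v ->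
  inner u v = (ip (re u) (re v) + ip (im u) (im v)) +i*
              (ip (im u) (re v) - ip (re u) (im v)).
Proof.
move=> [ur ui] [vr vi]; rewrite /Defs.inner /ip; congr (_ +i* _).
  rewrite -RintegralD//; try exact: sqint_mul.
  congr (Rintegral _ _ _); apply/funext => x; rewrite /re /im.
  by case: (u x) => a b; case: (v x) => a' b' /=; rewrite mulrN opprK.
rewrite -RintegralB//; try exact: sqint_mul.
congr (Rintegral _ _ _); apply/funext => x; rewrite /re /im.
by case: (u x) => a b; case: (v x) => a' b' /=; rewrite mulrN addrC.
Qed.

Lemma L2D u v : L2 u -> L2 v -> L2 (fun p => u p + v p).
Proof.
move=> [ur ui] [vr vi]; split.
  rewrite (_ : (fun p => _) = (fun p => re u p + re v p)); first exact: sqint_add.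
  by apply/funext => p; rewrite /re; case: (u p) => a b; case: (v p).
rewrite (_ : (fun p => _) = (fun p => im u p + im v p)); first exact: sqint_add.
by apply/funext => p; rewrite /im; case: (u p) => a b; case: (v p).
Qed.

Lemma L2Z (c : R[i]) u : L2 u -> L2 (fun p => c * u p).
Proof.
case: c => a b [ur ui]; split.
  rewrite (_ : (fun p => _) = (fun p => a * re u p - b * im u p)).
    by apply: sqint_sub; exact: sqint_scale.
  by apply/funext => p; rewrite /re /im; case: (u p).
rewrite (_ : (fun p => _) = (fun p => a * im u p + b * re u p)).
  by apply: sqint_add; exact: sqint_scale.
by apply/funext => p; rewrite /re /im; case: (u p).
Qed.

Lemma L20 : L2 (fun=> 0).
Proof.
have z : (fun _ : borel M => 0 : R) \in Lfun mu 2%:E.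
  apply: sqintI; first exact: measurable_cst.
  by under eq_integral do rewrite expr0n/=; rewrite integral0 ltry.
by split.
Qed.

Lemma L2B u v : L2 u -> L2 v -> L2 (fun p => u p - v p).
Proof.
move=> lu lv; rewrite (_ : (fun p => _) = (fun p => u p + (-1) * v p)); last first.
  by apply/funext => p; rewrite mulN1r.
by apply: L2D => //; exact: L2Z.
Qed.

Lemma L2_sum (c : nat -> R[i]) (phi : nat -> M -> R[i]) m k : (forall j, L2 (phi j)) ->
  L2 (fun p => \sum_(m <= j < k) c j * phi j p).
Proof.
move=> lphi; rewrite /index_iota; elim: (iota _ _) => [|j s ih].
  by rewrite (_ : (fun p => _) = (fun=> 0)); [exact: L20|apply/funext => p; rewrite big_nil].
rewrite (_ : (fun p => _) = (fun p => c j * phi j p + \sum_(j <- s) c j * phi j p)).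
  by apply: L2D => //; exact: L2Z.
by apply/funext => p; rewrite big_cons.
Qed.

Lemma innerC u v : L2 u -> L2 v -> inner v u = (inner u v)^*.
Proof.
move=> lu lv; rewrite !innerE//= (ipC _ (re v) (re u)) (ipC _ (im v) (im u)).
by rewrite (ipC _ (im v) (re u)) (ipC _ (re v) (im u)) /= opprB.
Qed.

Lemma innerDl u u' v : L2 u -> L2 u' -> L2 v ->
  inner (fun p => u p + u' p) v = inner u v + inner u' v.
Proof.
move=> lu lu' lv; rewrite !innerE//; last exact: L2D.
case: lu lu' lv => ur ui [ur' ui'] [vr vi].
have -> : re (fun p => u p + u' p) = (fun p => re u p + re u' p).
  by apply/funext => p; rewrite /re; case: (u p) => a b; case: (u' p).
have -> : im (fun p => u p + u' p) = (fun p => im u p + im u' p).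
  by apply/funext => p; rewrite /im; case: (u p) => a b; case: (u' p).
by rewrite !ipDl//; congr (_ +i* _); ring.
Qed.

Lemma innerZl c u v : L2 u -> L2 v -> inner (fun p => c * u p) v = c * inner u v.
Proof.
move=> lu lv; rewrite !innerE//; last exact: L2Z.
case: lu lv => ur ui [vr vi]; case: c => a b.
have -> : re (fun p => (a +i* b) * u p) = (fun p => a * re u p + (- b) * im u p).
  by apply/funext => p; rewrite /re /im mulNr; case: (u p).
have -> : im (fun p => (a +i* b) * u p) = (fun p => a * im u p + b * re u p).
  by apply/funext => p; rewrite /re /im; case: (u p).
rewrite !ipDl ?ipZl//; try exact: sqint_scale.
by rewrite mulcE; congr (_ +i* _); ring.
Qed.

Definition nrm2 u : R := ip (re u) (re u) + ip (im u) (im u).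
Definition csq (z : R[i]) : R := complex.Re z ^+ 2 + complex.Im z ^+ 2.

Lemma csq_ge0 z : 0 <= csq z.
Proof. by rewrite addr_ge0 ?sqr_ge0. Qed.

Lemma csqM z z' : csq (z * z') = csq z * csq z'.
Proof. by case: z => a b; case: z' => c d; rewrite /csq/=; ring. Qed.

Lemma nrm2_ge0 u : 0 <= nrm2 u.
Proof. by rewrite addr_ge0 ?ip_ge0. Qed.

Lemma inner_self u : L2 u -> inner u u = (nrm2 u)%:C.
Proof. by move=> lu; rewrite innerE// ipC subrr. Qed.

Lemma nrm2E u : L2 u ->
  (\int[mu]_p (complex.Re (u p) ^+ 2 + complex.Im (u p) ^+ 2)%:E = (nrm2 u)%:E)%E.
Proof.
move=> [ur ui]; rewrite EFinD -!ipE// -integralD//; try exact: sqint_mul.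
Qed.

(** That this polynomial in t is nonnegative is the Cauchy-Schwarz inequality. *)
Lemma nrm2_comb (t : R) z u v : L2 u -> L2 v ->
  nrm2 (fun p => t%:C * u p + z * v p) =
  t ^+ 2 * nrm2 u + 2 * t * complex.Re (z^* * inner u v) + csq z * nrm2 v.
Proof.
move=> lu lv.
have lc : L2 (fun p => t%:C * u p + z * v p) by apply: L2D; exact: L2Z.
suff : inner (fun p => t%:C * u p + z * v p) (fun p => t%:C * u p + z * v p) =
    (t ^+ 2 * nrm2 u + 2 * t * complex.Re (z^* * inner u v) + csq z * nrm2 v)%:C.
  by rewrite inner_self// => -[].
rewrite innerDl//; try exact: L2Z.
rewrite !innerZl// ![inner _ (fun p => _ + _)]innerC// !innerDl//; try exact: L2Z.
rewrite !innerZl// !inner_self// (innerC lu lv).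
case: (inner u v) => a b; case: z {lc} => c e.
by rewrite /csq /real_complex_def /= !(mulcE, addcE)/=; congr (_ +i* _); ring.
Qed.

Lemma cauchy_schwarz u v : L2 u -> L2 v -> csq (inner u v) <= nrm2 u * nrm2 v.
Proof.
move=> lu lv; set c := inner u v.
have H t : 0 <= t ^+ 2 * nrm2 u - 2 * t * csq c + csq c * nrm2 v.
  have := nrm2_ge0 (fun p => t%:C * u p + (- c) * v p).
  rewrite nrm2_comb// -/c; congr (0 <= _ + _ + _).
    by rewrite -mulrN; congr (_ * _); case: c => a b; rewrite /csq/=; ring.
  by congr (_ * _); case: c => a b; rewrite /csq/=; ring.
have := csq_ge0 c; have := nrm2_ge0 u; have := nrm2_ge0 v.
move: (csq c) (nrm2 u) (nrm2 v) H => d a N H N0 a0 d0.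
have [a1|a1] := eqVneq a 0.
  have := H (N + 1); rewrite a1; nra.
have {a1}a0 : 0 < a by rewrite lt_neqAle eq_sym a1.
have := H (d / a); rewrite exprMn expr2 (_ : d * d * a^-1 ^+ 2 * a = d * d / a); last first.
  by field; rewrite gt_eqF.
rewrite (_ : _ - _ = - (d * d / a)); last by field; rewrite gt_eqF.
have -> : - (d * d / a) + d * N = d * (a * N - d) / a by field; rewrite gt_eqF.
rewrite pmulr_lge0 ?invr_gt0//.
have [d1|d1] := eqVneq d 0; first by move=> _; rewrite d1 mulr_ge0// ltW.
by rewrite pmulr_rge0 ?subr_ge0// lt_neqAle eq_sym d1.
Qed.

Lemma nrm2Bsym u v : nrm2 (fun p => u p - v p) = nrm2 (fun p => v p - u p).
Proof.
rewrite /nrm2 /ip; congr (_ + _); congr (Rintegral _ _ _); apply/funext => p;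
  by rewrite /re /im; case: (u p) => a b; case: (v p) => c e /=; ring.
Qed.

Lemma L2_cvgP (S : nat -> M -> R[i]) w : (forall K, L2 (S K)) -> L2 w ->
  L2_cvg mu S w <-> nrm2 (fun p => S K p - w p) @[K --> \oo] --> (0 : R).
Proof.
move=> lS lw; have E : (fun K => \int[mu]_p (complex.Re (S K p - w p) ^+ 2 +
    complex.Im (S K p - w p) ^+ 2)%:E)%E = EFin \o (fun K => nrm2 (fun p => S K p - w p)).
  by apply/funext => K; rewrite nrm2E//; exact: L2B.
by rewrite /L2_cvg E; split => [/fine_cvgP[]//|H]; exact: cvg_EFin (nearW _ _) H.
Qed.

Lemma innerBl u u' v : L2 u -> L2 u' -> L2 v ->
  inner (fun p => u p - u' p) v = inner u v - inner u' v.
Proof.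
move=> lu lu' lv; rewrite (_ : (fun p => _) = (fun p => u p + (-1) * u' p)); last first.
  by apply/funext => p; rewrite mulN1r.
by rewrite innerDl ?innerZl ?mulN1r//; exact: L2Z.
Qed.

Lemma inner_suml (c : nat -> R[i]) (phi : nat -> M -> R[i]) m k v :
  (forall j, L2 (phi j)) -> L2 v ->
  inner (fun p => \sum_(m <= j < k) c j * phi j p) v =
  \sum_(m <= j < k) c j * inner (phi j) v.
Proof.
move=> lphi lv.
have [km|/ltnW mk] := leqP k m.
  rewrite [RHS]big_geq// (_ : (fun p => _) = (fun p => 0 * v p)) ?innerZl ?mul0r//.
  by apply/funext => p; rewrite big_geq// mul0r.
rewrite -(subnKC mk); elim: (k - m)%N => [|l ih].
  rewrite addn0 [RHS]big_geq// (_ : (fun p => _) = (fun p => 0 * v p)) ?innerZl ?mul0r//.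
  by apply/funext => p; rewrite big_geq// mul0r.
rewrite addnS big_nat_recr ?leq_addr//= -ih -innerZl// -innerDl//; last 2 first.
- exact: L2_sum.
- exact: L2Z.
by congr (Defs.inner _ _ _ _); apply/funext => p; rewrite big_nat_recr ?leq_addr.
Qed.

Lemma cvg_inner (S : nat -> M -> R[i]) w v : (forall K, L2 (S K)) -> L2 w -> L2 v ->
  L2_cvg mu S w -> csq (inner (S K) v - inner w v) @[K --> \oo] --> (0 : R).
Proof.
move=> lS lw lv /(L2_cvgP lS lw) Sw.
apply: (@squeeze_cvgr _ _ _ _ (cst 0) (fun K => nrm2 (fun p => S K p - w p) * nrm2 v)).
- apply: nearW => K; rewrite csq_ge0/= -innerBl// cauchy_schwarz//; exact: L2B.
- exact: cvg_cst.
- by rewrite -[X in _ --> X](mul0r (nrm2 v)); apply: cvgM => //; exact: cvg_cst.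
Qed.

Lemma csq_cvg (z : nat -> R[i]) l : csq (z K - l) @[K --> \oo] --> (0 : R) ->
  complex.Re (z K) @[K --> \oo] --> complex.Re l /\
  complex.Im (z K) @[K --> \oo] --> complex.Im l.
Proof.
move=> /cvgr0Pnorm_lt H; split; apply/cvgrPdist_lt => e e0.
  have := H _ (exprn_gt0 2 e0); apply: filterS => K; rewrite ger0_norm ?csq_ge0// => HK.
  apply: (sqr_lt_norm e0); apply: le_lt_trans HK.
  by case: (z K) => a b; case: l {H} => c f; rewrite /csq/=; have := sqr_ge0 (b - f); nra.
have := H _ (exprn_gt0 2 e0); apply: filterS => K; rewrite ger0_norm ?csq_ge0// => HK.
apply: (sqr_lt_norm e0); apply: le_lt_trans HK.
by case: (z K) => a b; case: l {H} => c f; rewrite /csq/=; have := sqr_ge0 (a - c); nra.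
Qed.

Section orthonormal.
Variable phi : nat -> M -> R[i].
Hypotheses (lphi : forall k, L2 (phi k))
  (ophi : forall j k, inner (phi j) (phi k) = (j == k)%:R).
Local Notation S c m K := (fun p => \sum_(m <= j < K) c j * phi j p).

Lemma inner_sum_phi (c : nat -> R[i]) m K i :
  inner (S c m K) (phi i) = if (m <= i < K)%N then c i else 0.
Proof.
rewrite inner_suml//; under eq_bigr do rewrite ophi.
rewrite (eq_bigr (fun j => if j == i then c j else 0)); last first.
  by move=> j _; case: eqP => _; rewrite ?mulr1 ?mulr0.
by rewrite -big_mkcond/= big_nat1_eq.
Qed.

Lemma inner_sum_self (c : nat -> R[i]) m K :
  nrm2 (S c m K) = \sum_(m <= j < K) csq (c j).
Proof.
have lS := L2_sum c m K lphi.
suff : inner (S c m K) (S c m K) = (\sum_(m <= j < K) csq (c j))%:C.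
  by rewrite inner_self// => -[].
rewrite inner_suml// rmorph_sum/= [LHS]big_nat [RHS]big_nat; apply: eq_bigr => j jK.
rewrite innerC// inner_sum_phi jK; case: (c j) => a b.
by rewrite mulcE /csq/real_complex_def/=; congr (_ +i* _); ring.
Qed.

Lemma bessel u K : L2 u -> \sum_(0 <= j < K) csq (inner u (phi j)) <= nrm2 u.
Proof.
move=> lu; pose c j := inner u (phi j).
have lS := L2_sum c 0 K lphi.
set B := \sum_(_ <= _ < _) _.
have B0 : 0 <= B by apply: sumr_ge0 => j _; exact: csq_ge0.
have E : inner (S c 0 K) u = B%:C.
  rewrite inner_suml// rmorph_sum/=; apply: eq_bigr => j _.
  rewrite innerC// -/(c j); case: (c j) => a b.
  by rewrite mulcE /csq/real_complex_def/=; congr (_ +i* _); ring.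
have := cauchy_schwarz lS lu; rewrite E inner_sum_self -/B /csq/= expr0n/= addr0.
have [->|B1] := eqVneq B 0; first by rewrite nrm2_ge0.
by rewrite expr2 ler_pM2l// lt_neqAle eq_sym B1.
Qed.

(** Continuity of the inner product identifies the coefficients of a limit. *)
Lemma coef_limit (c : nat -> R[i]) m w i : L2 w -> L2_cvg mu (fun K => S c m K) w ->
  inner w (phi i) = if (m <= i)%N then c i else 0.
Proof.
move=> lw Sw.
have /csq_cvg[c1 c2] := cvg_inner (fun K => L2_sum c m K lphi) lw (lphi i) Sw.
have E : \forall K \near \oo, inner (S c m K) (phi i) = if (m <= i)%N then c i else 0.
  near=> K; rewrite inner_sum_phi (_ : (i < K)%N) ?andbT//.
  by near: K; exact: nbhs_infty_gt.
apply/eqP; rewrite eq_complex; apply/andP; split; apply/eqP.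
  apply: (cvg_unique _ c1); first exact: norm_hausdorff.
  apply: cvg_near_cst; by apply: filterS E => K ->.
apply: (cvg_unique _ c2); first exact: norm_hausdorff.
by apply: cvg_near_cst; apply: filterS E => K ->.
Unshelve. all: by end_near. Qed.

(** The partial sums form a Cauchy sequence because the terms are orthogonal. *)
Lemma riesz_fischer (c : nat -> R[i]) (B : R) :
  (forall K, \sum_(0 <= j < K) csq (c j) <= B) ->
  exists2 w, L2 w & L2_cvg mu (fun K => S c 0 K) w.
Proof.
move=> cB.
have lS K := L2_sum c 0 K lphi.
have cauchy eps : 0 < eps -> exists N, forall m n, (N <= m)%N -> (N <= n)%N ->
    nrm2 (fun p => S c 0 m p - S c 0 n p) <= eps.
  move=> e0.
  have : cvgn (series (fun j => csq (c j))).
    apply: nondecreasing_is_cvgn; first by apply: nondecreasing_series => j _ _; exact: csq_ge0.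
    by exists B => _ [K _ <-]; exact: cB.
  move=> /cvg_ex[/= l /cvgrPdist_lt/(_ _ (divr_gt0 e0 (ltr0n R 2)))[N _ NP]].
  suff W m n : (N <= n)%N -> (n <= m)%N -> nrm2 (fun p => S c 0 m p - S c 0 n p) <= eps.
    exists N => m n Nm Nn; have [nm|/ltnW mn] := leqP n m; first exact: W.
    by rewrite nrm2Bsym W.
  move=> Nn nm.
  have -> : (fun p => S c 0 m p - S c 0 n p) = S c n m.
    by apply/funext => p; rewrite (big_cat_nat (leq0n n) nm)/= addrAC subrr add0r.
  rewrite inner_sum_self.
  have := NP n Nn; have := NP m (leq_trans Nn nm).
  rewrite /series/= (big_cat_nat (leq0n n) nm)/= !ltr_norml => /andP[a1 a2] /andP[b1 b2].
  by lra.
have part (q : (M -> R[i]) -> borel M -> R) :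
    (forall u, L2 u -> q u \in Lfun mu 2%:E) ->
    (forall u v p, q (fun p => u p - v p) p = q u p - q v p) ->
    (forall u, L2 u -> ip (q u) (q u) <= nrm2 u) ->
    exists2 w, w \in Lfun mu 2%:E & forall eps : R, 0 < eps -> exists N, forall K, (N <= K)%N ->
      (\int[mu]_x ((q (S c 0 K) x - w x) ^+ 2)%:E <= eps%:E)%E.
  move=> q1 q2 q3; apply: sqint_complete; first by move=> K; exact: q1.
  move=> eps /cauchy[N NP]; exists N => m K Nm NK.
  have lB : L2 (fun p => S c 0 m p - S c 0 K p) by exact: L2B.
  under eq_integral do rewrite expr2 -q2.
  by rewrite ipE ?q1// lee_fin (le_trans (q3 _ lB))// NP.
have [a la aP] : exists2 w, w \in Lfun mu 2%:E & forall eps : R, 0 < eps ->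
    exists N, forall K, (N <= K)%N ->
      (\int[mu]_x ((re (S c 0 K) x - w x) ^+ 2)%:E <= eps%:E)%E.
  apply: part; first by move=> u [].
    by move=> u v p; rewrite /re; case: (u p) => x y; case: (v p).
  by move=> u _; rewrite lerDl ip_ge0.
have [b lb bP] : exists2 w, w \in Lfun mu 2%:E & forall eps : R, 0 < eps ->
    exists N, forall K, (N <= K)%N ->
      (\int[mu]_x ((im (S c 0 K) x - w x) ^+ 2)%:E <= eps%:E)%E.
  apply: part; first by move=> u [].
    by move=> u v p; rewrite /im; case: (u p) => x y; case: (v p).
  by move=> u _; rewrite lerDr ip_ge0.
have lw : L2 (fun p => a p +i* b p) by [].
exists (fun p => a p +i* b p) => //; apply/L2_cvgP => //.
apply/cvgr0Pnorm_le => eps e0.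
have e2 : 0 < eps / 2 by rewrite divr_gt0.
have [N1 P1] := aP _ e2; have [N2 P2] := bP _ e2.
near=> K.
have N1K : (N1 <= K)%N by near: K; exact: nbhs_infty_ge.
have N2K : (N2 <= K)%N by near: K; exact: nbhs_infty_ge.
rewrite ger0_norm ?nrm2_ge0// (splitr eps) lerD//.
  have := P1 _ N1K; rewrite -lee_fin.
  under eq_integral do rewrite expr2.
  rewrite ipE//; try (by apply: sqint_sub => //; case: (lS K)).
  congr (_ <= _)%E; congr (ip _ _)%:E; apply/funext => p; rewrite /re;
    by case: (\sum_(_ <= _ < _) _).
have := P2 _ N2K; rewrite -lee_fin.
under eq_integral do rewrite expr2.
rewrite ipE//; try (by apply: sqint_sub => //; case: (lS K)).
congr (_ <= _)%E; congr (ip _ _)%:E; apply/funext => p; rewrite /im;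
  by case: (\sum_(_ <= _ < _) _).
Unshelve. all: by end_near. Qed.

Hypothesis cphi : forall u, L2 u ->
  L2_cvg mu (fun K p => \sum_(0 <= k < K) inner u (phi k) * phi k p) u.

Lemma parseval u v : L2 u -> L2 v ->
  csq (\sum_(0 <= j < K) inner u (phi j) * (inner v (phi j))^* - inner u v)
    @[K --> \oo] --> (0 : R).
Proof.
move=> lu lv; pose c j := inner u (phi j).
rewrite (_ : (fun K => _) = (fun K => csq (inner (S c 0 K) v - inner u v))).
  exact: (cvg_inner (fun K => L2_sum c 0 K lphi) lu lv (cphi lu)).
apply/funext => K; rewrite inner_suml//; congr (csq (_ - _)).
by apply: eq_bigr => j _; rewrite (innerC lv).
Qed.

End orthonormal.

End complex_L2.

(** * The spectral estimate *)

Section powers.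
Context {R : realType}.

(** Both bounds amount to comparing the powers of u with exponents -1, -s, 0 and
    1 - s, on either side of u = 1. *)
Lemma powR_inv_le (s u : R) : 0 < s -> s < 1 -> 0 < u ->
  `|u `^ (- s) - 1| <= u^-1 * `|1 - u| /\ `|u `^ (- s) - 1| <= u `^ (- s) * `|1 - u|.
Proof.
move=> s0 s1 u0.
have E1 : u `^ (- s) * u = u `^ (1 - s).
  by rewrite -{2}[u]powRr1 ?ltW// -powRD ?(gt_eqF u0) ?implybT// addrC.
have E2 : u^-1 = u `^ (-1) by rewrite powR_inv1// ltW.
have [u1|u1] := leP u 1.
  have A : 1 <= u `^ (- s).
    by rewrite -[leLHS](powRr0 u) ger_powR ?u0//; lra.
  have B : u `^ (- s) <= u^-1 by rewrite E2 ger_powR ?u0//; lra.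
  have C : u `^ (1 - s) <= 1 by rewrite -[leRHS](powRr0 u) ger_powR ?u0//; lra.
  rewrite !ger0_norm ?subr_ge0//; split.
    by rewrite mulrBr mulr1 mulVf ?gt_eqF//; lra.
  by rewrite mulrBr mulr1 E1; lra.
have u1' := ltW u1.
have A : u `^ (- s) <= 1 by rewrite -[leRHS](powRr0 u) ler_powR//; lra.
have B : u^-1 <= u `^ (- s) by rewrite E2 ler_powR//; lra.
have C : 1 <= u `^ (1 - s) by rewrite -[leLHS](powRr0 u) ler_powR//; lra.
rewrite ler0_norm ?subr_le0// ler0_norm ?subr_le0//; split.
  by rewrite !opprB mulrBr mulr1 mulVf ?gt_eqF//; lra.
by rewrite !opprB mulrBr mulr1 E1; lra.
Qed.

Definition cn (z : R[i]) : R := Num.sqrt (csq z).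

Lemma cn_ge0 z : 0 <= cn z. Proof. exact: sqrtr_ge0. Qed.

Lemma cn2 z : cn z ^+ 2 = csq z. Proof. by rewrite sqr_sqrtr// csq_ge0. Qed.

Lemma normC_cn z : `|z| = (cn z)%:C. Proof. exact: normc_def. Qed.

Lemma cnD z z' : cn (z + z') <= cn z + cn z'.
Proof. by rewrite -lecR rmorphD/= -!normC_cn ler_normD. Qed.

Lemma cnM z z' : cn (z * z') = cn z * cn z'.
Proof. by rewrite /cn csqM sqrtrM// csq_ge0. Qed.

Lemma cn_real (t : R) : cn t%:C = `|t|.
Proof. by rewrite /cn /csq/= expr0n/= addr0 sqrtr_sqr. Qed.

(** Here x, y, z, r are the components of h, v, v - h / a and the remainder at
    the frequency t. Both bounds of powR_inv_le are used: the first where x is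
    controlled by z or y, the second, milder at low frequency, for r alone. *)
Lemma freq_bound (a t s : R) (x y z r : R[i]) : 0 < a -> 0 < t -> 0 < s -> s < 1 ->
  x = t%:C * y + r -> y = z + a^-1%:C * x ->
  `|(t / a) `^ (- s) - 1| * csq x <=
    a * (cn z * cn x) + a * (cn r * cn y) + (a / t) `^ s * csq r.
Proof.
move=> a0 t0 s0 s1 xE yE.
have u0 : 0 < t / a by rewrite divr_gt0.
have [P1 P2] := powR_inv_le s0 s1 u0.
have E3 : (a / t) `^ s = (t / a) `^ (- s).
  by rewrite -[a / t]invf_div -[(t / a)^-1]powR_inv1 ?ltW// -powRrM mulN1r.
have E4 : (t / a)^-1 * t = a by field; rewrite !gt_eqF.
have X1 : `|1 - t / a| * cn x <= t * cn z + cn r.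
  rewrite -cn_real -cnM.
  have -> : (1 - t / a)%:C * x = t%:C * z + r.
    rewrite rmorphB/= mulrBl mul1r {1}xE yE rmorphM/=; ring.
  apply: le_trans (cnD _ _) _.
  by rewrite cnM cn_real gtr0_norm.
have X2 : cn x <= t * cn y + cn r.
  rewrite {1}xE; apply: le_trans (cnD _ _) _.
  by rewrite cnM cn_real gtr0_norm.
rewrite E3.
have := cn_ge0 x; have := cn_ge0 y; have := cn_ge0 z; have := cn_ge0 r.
rewrite -!cn2.
move: P1 P2 X1 X2 E4 (normr_ge0 (1 - t / a)) (normr_ge0 ((t / a) `^ (- s) - 1)).
have ui0 : 0 < (t / a)^-1 by rewrite invr_gt0.
have us0 : 0 < (t / a) `^ (- s) by rewrite powR_gt0.
move: `|_ - 1| `|1 - _| (cn x) (cn y) (cn z) (cn r) ui0 us0.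
move: ((t / a)^-1) ((t / a) `^ (- s)).
move=> ui us p q X Y Z P ui0 us0 P1 P2 X1 X2 E4 q0 p0 P0 Z0 Y0 X0.
pose m := Num.min ui us.
have pm : p <= m * q by rewrite /m; case: (leP ui us).
have m0 : 0 <= m by rewrite /m; case: (leP ui us) => _; exact: ltW.
have mui : m <= ui by rewrite /m ge_min lexx.
have mus : m <= us by rewrite /m ge_min lexx orbT.
apply: (@le_trans _ _ (m * q * X * X)).
  by rewrite expr2 mulrA ler_wpM2r// ler_wpM2r.
apply: (@le_trans _ _ (m * (t * Z + P) * X)).
  by rewrite ler_wpM2r// -mulrA ler_wpM2l.
have A1 : m * (t * Z) * X <= a * (Z * X).
  by rewrite -E4 -!mulrA ler_wpM2r// !mulr_ge0// ltW.
have A2 : m * P * X <= m * P * (t * Y + P).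
  by rewrite ler_wpM2l// mulr_ge0.
have A3 : m * P * (t * Y) <= a * (P * Y).
  rewrite -E4 (_ : m * P * (t * Y) = m * (t * (P * Y))); last by ring.
  by rewrite -!mulrA ler_wpM2r// !mulr_ge0// ltW.
have A4 : m * P * P <= us * P ^+ 2.
  by rewrite -mulrA -expr2 ler_wpM2r// sqr_ge0.
have -> : m * (t * Z + P) * X = m * (t * Z) * X + m * P * X by ring.
have E5 : m * P * (t * Y + P) = m * P * (t * Y) + m * P * P by ring.
by rewrite E5 in A2; lra.
Qed.

End powers.

Section spectral.
Context {R : realType} {M : ptopologicalType}.
Variable mu : {measure set (borel M) -> \bar R}.
Local Notation L2 := (L2 mu).
Local Notation inner := (inner mu setT).
Variables (lam : nat -> R) (phi : nat -> M -> R[i]).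
Hypotheses (lam1 : 0 < lam 1%N) (lam_ndecr : forall k, lam k <= lam k.+1).
Hypotheses (lphi : forall k, L2 (phi k))
  (ophi : forall j k, inner (phi j) (phi k) = (j == k)%:R)
  (cphi : forall u, L2 u ->
    L2_cvg mu (fun K p => \sum_(0 <= k < K) inner u (phi k) * phi k p) u).

Lemma lam_ge1 j : (1 <= j)%N -> lam 1%N <= lam j.
Proof.
elim: j => // -[_ _|j ih _]; first exact: lexx.
exact: le_trans (ih isT) (lam_ndecr _).
Qed.

Lemma lam_gt0 j : (1 <= j)%N -> 0 < lam j.
Proof. by move=> /lam_ge1; exact: lt_le_trans. Qed.

(** Bessel's inequality after 2 A B <= e B^2 + A^2 / e, term by term; e will be
    the ratio of the norms. *)
Lemma sum_cn (u v : M -> R[i]) (e : R) m K : L2 u -> L2 v -> 0 < e ->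
  \sum_(m <= j < K) cn (inner u (phi j)) * cn (inner v (phi j)) <=
  (e * nrm2 mu v + e^-1 * nrm2 mu u) / 2.
Proof.
move=> lu lv e0.
apply: (@le_trans _ _ (\sum_(m <= j < K)
    (e * csq (inner v (phi j)) + e^-1 * csq (inner u (phi j))) / 2)).
  apply: ler_sum => j _; rewrite -!cn2; move: (cn _) (cn _) => B A.
  rewrite ler_pdivlMr// -(ler_pM2l e0).
  have -> : e * (e * B ^+ 2 + e^-1 * A ^+ 2) = (e * B) ^+ 2 + A ^+ 2.
    by field; rewrite gt_eqF.
  have := sqr_ge0 (e * B - A); rewrite sqrrB; lra.
rewrite -mulr_suml ler_pM2r ?invr_gt0// big_split/= -!mulr_sumr.
have B w : L2 w -> \sum_(m <= j < K) csq (inner w (phi j)) <= nrm2 mu w.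
  move=> lw; apply: le_trans (bessel lphi ophi K lw).
  have [Km|/ltnW mK] := leqP K m.
    by rewrite big_geq//; apply: sumr_ge0 => j _; exact: csq_ge0.
  by rewrite (big_cat_nat (leq0n m) mK)/= lerDr sumr_ge0// => j _; exact: csq_ge0.
by rewrite lerD// ler_wpM2l// ?B// ?invr_ge0 ltW.
Qed.

Variables (s a W : R) (h v r u : M -> R[i]).
Hypotheses (s0 : 0 < s) (s1 : s < 1) (a0 : 0 < a) (W0 : 0 < W).
Hypotheses (lh : L2 h) (lv : L2 v) (lr : L2 r) (lu : L2 u).
Hypothesis hvr : forall j,
  inner h (phi j) = (lam j / W ^+ 2)%:C * inner v (phi j) + inner r (phi j).
Hypothesis h_phi0 : inner h (phi 0) = 0.
Hypothesis hu : forall j, (1 <= j)%N -> inner h (phi j) = (lam j `^ s)%:C * inner u (phi j).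

(** The function u is (-Delta)^(-s) h, so that by Parseval's identity both terms of
    the difference are series in |(h, phi_j)|^2, to which freq_bound applies.
    Below the frequency of h the remainder is amplified, at most by the factor
    with lam 1. *)
Lemma spectral_estimate (eps del C : R) : 0 < eps -> 0 < del -> 0 < C ->
  nrm2 mu (fun p => v p - a^-1%:C * h p) <= del ^+ 2 * nrm2 mu h ->
  nrm2 mu r <= eps ^+ 2 * nrm2 mu h -> nrm2 mu v <= C ^+ 2 * nrm2 mu h ->
  complex.Im (inner h u) = 0 /\
  `|W `^ (2 * s) * complex.Re (inner h u) - a `^ (- s) * nrm2 mu h| <=
  a `^ (- s) * (a * del + a * (eps * C) + (a * W ^+ 2 / lam 1%N) `^ s * eps ^+ 2) * nrm2 mu h.
Proof.
move=> e0 d0 C0 zb rb vb.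
pose x j := inner h (phi j).
pose t j := lam j / W ^+ 2.
have t0 j : (1 <= j)%N -> 0 < t j by move=> j1; rewrite divr_gt0 ?exprn_gt0// lam_gt0.
have uE j : (1 <= j)%N -> inner u (phi j) = (lam j `^ (- s))%:C * x j.
  move=> j1; rewrite /x hu// mulrA -rmorphM/= -powRD; last by rewrite (gt_eqF (lam_gt0 j1)) implybT.
  by rewrite addNr powRr0 mul1r.
pose Q K := \sum_(1 <= j < K) lam j `^ (- s) * csq (x j).
pose P K := \sum_(1 <= j < K) csq (x j).
have S0 K : \sum_(0 <= j < K.+1) inner h (phi j) * (inner u (phi j))^* = (Q K.+1)%:C.
  rewrite big_ltn// h_phi0 mul0r add0r /Q rmorph_sum/= big_nat [RHS]big_nat.
  apply: eq_bigr => j /andP[j1 _]; rewrite uE// -/(x j); case: (x j) => c d.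
  by rewrite /csq/real_complex_def/= !mulcE/=; congr (_ +i* _); ring.
have S1 K : \sum_(0 <= j < K.+1) inner h (phi j) * (inner h (phi j))^* = (P K.+1)%:C.
  rewrite big_ltn// h_phi0 mul0r add0r /P rmorph_sum/=.
  apply: eq_bigr => j _; rewrite -/(x j); case: (x j) => c d.
  by rewrite /csq/real_complex_def/= !mulcE/=; congr (_ +i* _); ring.
have /csq_cvg[cQ1 cQ2] := parseval lphi cphi lh lu.
have /csq_cvg[cP1 _] := parseval lphi cphi lh lh.
have cQ : Q K.+1 @[K --> \oo] --> complex.Re (inner h u).
  move: cQ1; rewrite -(cvg_shiftS (fun K => complex.Re _)).
  by under eq_fun do rewrite S0.
have cP : P K.+1 @[K --> \oo] --> nrm2 mu h.
  move: cP1; rewrite -(cvg_shiftS (fun K => complex.Re _)) inner_self//=.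
  by under eq_fun do rewrite S1.
split.
  move: cQ2; rewrite -(cvg_shiftS (fun K => complex.Im _)).
  under eq_fun do rewrite S0; move=> /= c.
  by apply/esym; apply: (cvg_unique _ _ c); [exact: norm_hausdorff|exact: cvg_cst].
have cD : `|W `^ (2 * s) * Q K.+1 - a `^ (- s) * P K.+1| @[K --> \oo] -->
    `|W `^ (2 * s) * complex.Re (inner h u) - a `^ (- s) * nrm2 mu h|.
  by apply: cvg_norm; apply: cvgB; apply: cvgM => //; exact: cvg_cst.
rewrite -(cvg_lim _ cD)//; apply: limr_le; first by apply/cvg_ex; eexists; exact: cD.
apply: nearW => K.
have WE j : (1 <= j)%N -> W `^ (2 * s) * lam j `^ (- s) = a `^ (- s) * (t j / a) `^ (- s).
  move=> j1; have tp := t0 j j1; have lp := lam_gt0 j1.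
  rewrite -[in RHS]powRM ?(ltW a0) ?(ltW (divr_gt0 tp a0))//.
  have -> : a * (t j / a) = t j by rewrite mulrC divfK// gt_eqF.
  rewrite /t [in RHS]powRM ?(ltW lp) ?invr_ge0 ?sqr_ge0// [RHS]mulrC; congr (_ * _).
  rewrite -powR_mulrn ?(ltW W0)// -powRN -powRrM; congr (_ `^ _); ring.
have -> : W `^ (2 * s) * Q K.+1 - a `^ (- s) * P K.+1 =
    a `^ (- s) * \sum_(1 <= j < K.+1) ((t j / a) `^ (- s) - 1) * csq (x j).
  rewrite /Q /P !mulr_sumr -sumrB big_nat [RHS]big_nat; apply: eq_bigr => j /andP[j1 _].
  by rewrite mulrA WE//; ring.
rewrite normrM ger0_norm ?powR_ge0// -mulrA ler_wpM2l ?powR_ge0//.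
apply: le_trans (ler_norm_sum _ _ _) _.
pose z p := v p - a^-1%:C * h p.
have lz : L2 z by apply: L2B => //; exact: L2Z.
apply: (@le_trans _ _ (\sum_(1 <= j < K.+1)
   (a * (cn (inner z (phi j)) * cn (x j)) + a * (cn (inner r (phi j)) * cn (inner v (phi j)))
    + (a * W ^+ 2 / lam 1%N) `^ s * csq (inner r (phi j))))).
  rewrite big_nat [leRHS]big_nat; apply: ler_sum => j /andP[j1 _].
  rewrite normrM (ger0_norm (csq_ge0 _)).
  have vz : inner v (phi j) = inner z (phi j) + a^-1%:C * inner h (phi j).
    by rewrite /z innerBl ?innerZl// ?subrK//; exact: L2Z.
  apply: le_trans (freq_bound a0 (t0 j j1) s0 s1 (hvr j) vz) _.
  rewrite lerD2l ler_wpM2r ?csq_ge0//; apply: ge0_ler_powR; first exact: ltW.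
  - by rewrite nnegrE divr_ge0 ?(ltW a0)// ltW// t0.
  - by rewrite nnegrE divr_ge0 ?(ltW lam1)// mulr_ge0 ?sqr_ge0// ltW.
  - rewrite /t invf_div mulrA ler_wpM2l ?mulr_ge0 ?sqr_ge0 ?(ltW a0) ?(ltW W0)//.
    by rewrite lef_pV2 ?posrE ?lam_ge1// lam_gt0.
rewrite !big_split/= -!mulr_sumr.
have B1 : \sum_(1 <= j < K.+1) cn (inner z (phi j)) * cn (x j) <= del * nrm2 mu h.
  apply: le_trans (sum_cn 1 K.+1 lz lh d0) _.
  have : del^-1 * nrm2 mu z <= del * nrm2 mu h.
    by rewrite ler_pdivrMl// mulrA -expr2.
  lra.
have B2 : \sum_(1 <= j < K.+1) cn (inner r (phi j)) * cn (inner v (phi j)) <=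
    eps * C * nrm2 mu h.
  apply: le_trans (sum_cn 1 K.+1 lr lv (divr_gt0 e0 C0)) _.
  have : (eps / C)^-1 * nrm2 mu r <= eps * C * nrm2 mu h.
    rewrite ler_pdivrMl ?divr_gt0//; apply: (le_trans rb); rewrite mulrA le_eqVlt.
    by apply/orP; left; apply/eqP; congr (_ * _); field; rewrite gt_eqF.
  have : eps / C * nrm2 mu v <= eps * C * nrm2 mu h.
    apply: (@le_trans _ _ (eps / C * (C ^+ 2 * nrm2 mu h))).
      by rewrite ler_wpM2l// ltW// divr_gt0.
    by rewrite mulrA le_eqVlt; apply/orP; left; apply/eqP; congr (_ * _); field; rewrite gt_eqF.
  lra.
have B3 : \sum_(1 <= j < K.+1) csq (inner r (phi j)) <= eps ^+ 2 * nrm2 mu h.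
  apply: le_trans rb; apply: le_trans (bessel lphi ophi K.+1 lr).
  by rewrite [leRHS]big_ltn// lerDr csq_ge0.
have -> : (a * del + a * (eps * C) + (a * W ^+ 2 / lam 1) `^ s * eps ^+ 2) * nrm2 mu h =
    a * (del * nrm2 mu h) + a * (eps * C * nrm2 mu h) +
    (a * W ^+ 2 / lam 1) `^ s * (eps ^+ 2 * nrm2 mu h) by ring.
by rewrite !lerD// ler_wpM2l// ?powR_ge0// ltW.
Qed.

End spectral.

(** * The fractional Laplacian *)

Section fractional.
Context {R : realType} {M : ptopologicalType}.
Variable mu : {measure set (borel M) -> \bar R}.
Local Notation L2 := (L2 mu).
Local Notation inner := (inner mu setT).
Variables (lam : nat -> R) (phi : nat -> M -> R[i]).
Hypotheses (lam1 : 0 < lam 1%N) (lam_ndecr : forall k, lam k <= lam k.+1).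
Hypotheses (lphi : forall k, L2 (phi k))
  (ophi : forall j k, inner (phi j) (phi k) = (j == k)%:R)
  (cphi : forall u, L2 u ->
    L2_cvg mu (fun K p => \sum_(0 <= k < K) inner u (phi k) * phi k p) u).
Variables (s : R) (s0 : 0 < s).

(** The coefficients of u are those of h divided by lam j ^ s, which is bounded
    below; they are square summable. *)
Lemma frac_laplacian_exists h : L2 h -> inner h (phi 0) = 0 ->
  exists2 u, frac_laplacian mu lam phi s u h & inner u (phi 0) = 0.
Proof.
move=> lh h00.
pose c j := if j == 0%N then 0 else (lam j `^ (- s))%:C * inner h (phi j).
have cb K : \sum_(0 <= j < K) csq (c j) <= (lam 1%N `^ (- s)) ^+ 2 * nrm2 mu h.
  apply: (@le_trans _ _ (\sum_(0 <= j < K) (lam 1%N `^ (- s)) ^+ 2 * csq (inner h (phi j)))).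
    apply: ler_sum => -[|j] _; rewrite /c/=.
      by rewrite /csq/= expr0n/= addr0 mulr_ge0 ?sqr_ge0// addr_ge0 ?sqr_ge0.
    rewrite csqM ler_wpM2r ?csq_ge0// /csq/= expr0n/= addr0 lerXn2r ?nnegrE ?powR_ge0//.
    have lp := lam_gt0 lam1 lam_ndecr (ltn0Sn j).
    rewrite (powRN (lam j.+1)) (powRN (lam 1%N)) lef_pV2 ?posrE ?powR_gt0//.
    apply: ge0_ler_powR; rewrite ?nnegrE; [exact: ltW|exact: ltW|exact: ltW|].
    exact: (lam_ge1 lam_ndecr).
  by rewrite -mulr_sumr ler_wpM2l ?sqr_ge0// bessel.
have [u lu Su] := riesz_fischer lphi ophi cb.
have uc i : inner u (phi i) = c i by rewrite (coef_limit lphi ophi i lu Su).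
exists u; last by rewrite uc.
split; [exact: lu|exact: lh|].
set F := (X in L2_cvg mu X h).
have -> : F = (fun K p => \sum_(0 <= k < K) inner h (phi k) * phi k p); last exact: cphi.
apply/funext => K; apply/funext => p; rewrite /F; case: K => [|K]; first by rewrite !big_geq.
rewrite [RHS]big_ltn// h00 mul0r add0r; apply: eq_big_nat => -[//|j] _.
rewrite uc /c/= mulrA -rmorphM/= -powRD; last by rewrite (gt_eqF (lam_gt0 lam1 lam_ndecr (ltn0Sn j))) ?implybT.
by rewrite subrr powRr0 mul1r.
Qed.

Lemma frac_laplacian_coef u h : frac_laplacian mu lam phi s u h ->
  inner h (phi 0) = 0 /\
  forall j, (1 <= j)%N -> inner h (phi j) = (lam j `^ s)%:C * inner u (phi j).
Proof.
move=> [lu lh Sh].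
have H i := @coef_limit _ _ mu phi lphi ophi (fun k => (lam k `^ s)%:C * inner u (phi k)) 1 h i lh Sh.
by split; [rewrite H|move=> j j1; rewrite H j1].
Qed.

(** Parseval's identity for the product with 1 reduces to its first term; if the
    factor vanished, 1 would be zero almost everywhere. *)
Lemma mean_phi0 : L2 (cst 1) -> (forall j, (1 <= j)%N -> inner (cst 1) (phi j) = 0) ->
  (forall u, L2 u -> inner u (cst 1) = inner u (phi 0) * (inner (cst 1) (phi 0))^*) /\
  inner (cst 1) (phi 0) != 0.
Proof.
move=> l1 ort.
have H (a : nat -> R) b (l : R) : (forall K, a K.+1 = b) -> a @ \oo --> l -> l = b.
  move=> ab al; have sl : (fun K => a K.+1) @ \oo --> l by rewrite cvg_shiftS.
  apply: (@cvg_unique _ (@norm_hausdorff R R^o) _ _ _ _ sl).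
  by rewrite (_ : (fun K => a K.+1) = cst b); [exact: cvg_cst|apply/funext => K; exact: ab].
have E u : L2 u -> inner u (cst 1) = inner u (phi 0) * (inner (cst 1) (phi 0))^*.
  move=> lu; have /csq_cvg := parseval lphi cphi lu l1.
  have S K : \sum_(0 <= j < K.+1) inner u (phi j) * (inner (cst 1) (phi j))^* =
      inner u (phi 0) * (inner (cst 1) (phi 0))^*.
    rewrite big_ltn// big_nat big1 ?addr0// => j /andP[j1 _].
    have -> : inner (cst 1) (phi j) = 0 by exact: ort.
    by rewrite [X in _ * X](_ : _ = 0) ?mulr0//; exact: conjc0.
  move=> [c1 c2]; apply/eqP; rewrite eq_complex; apply/andP; split; apply/eqP.
    by apply: H c1 => K; rewrite S.
  by apply: H c2 => K; rewrite S.
split=> //; apply/negP => /eqP z.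
have n1 : inner (cst 1) (cst 1) = 0 by rewrite E// z mul0r.
have mu0 : mu setT = 0%E.
  have := nrm2E l1; move: n1; rewrite inner_self// => -[->].
  rewrite (eq_integral (cst 1%E)); last first.
    by move=> p _; rewrite /= expr0n/= expr1n addr0.
  by rewrite integral_cst// mul1e.
have := nrm2E (lphi 0); rewrite null_set_integral//.
  have := inner_self (lphi 0); rewrite ophi/= => -[<-] /eqP.
  by rewrite eqe eq_sym oner_eq0.
have [mr mi] := lphi 0.
apply/measurable_EFinP; apply: measurable_funD; apply: measurable_funX.
  exact: sqint_measurable mr.
exact: sqint_measurable mi.
Qed.

End fractional.

Local Close Scope complex_scope.

(** * Gradients in different charts *)

Section transition.
Context {R : realType} {n : nat} {M : ptopologicalType}.
Variables (A : set (chart R n M)) (hA : smooth_atlas A).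
Implicit Types e : chart R n M.

Lemma overlapE e e' x : overlap e e' x <-> chart_img e x /\ chart_dom e' (chart_inv e x).
Proof.
split=> [[p [Dp D'p] <-]|[[p Dp <-] D'p]]; first by rewrite chart_mapK//; split=> //; exists p.
by exists p => //; split=> //; rewrite chart_mapK in D'p.
Qed.

Lemma open_chart_preimage e (B : set M) : open B ->
  open [set x | chart_img e x /\ B (chart_inv e x)].
Proof.
exact: (open_continuous_preimage (open_img (e := e)) (@chart_inv_continuous _ _ _ e)).
Qed.

Lemma open_overlap e e' : open (overlap e e').
Proof.
rewrite (_ : overlap e e' = [set x | chart_img e x /\ chart_dom e' (chart_inv e x)]).
  by apply: open_chart_preimage; exact: chart_dom_open.
by apply/seteqP; split=> x /overlapE.
Qed.

Lemma transition_img e e' x : overlap e e' x -> chart_img e' (transition e e' x).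
Proof. by move=> /overlapE[_ D'x]; exact: chart_img_in. Qed.

Lemma transition_inv e e' x : overlap e e' x ->
  chart_inv e' (transition e e' x) = chart_inv e x.
Proof. by move=> /overlapE[_ D'x]; rewrite /transition chart_mapK. Qed.

Lemma Ck_transition k e e' (F : 'rV[R]_n -> R) : A e -> A e' -> Ck k (chart_img e') F ->
  Ck k (overlap e e') (F \o transition e e').
Proof.
move=> eA e'A cF.
have ct j : Ck k (overlap e e') (fun y => transition e e' y 0 j).
  exact: (atlas_compat hA eA e'A j k).
exact: Ck_comp (@open_overlap e e') (open_img (e := e')) (@transition_img e e') ct cF.
Qed.

Definition grad e (w : M -> R) (p : M) : 'rV[R]_n :=
  \row_i partial i (fun y => w (chart_inv e y)) (e p).

Lemma grad_transition e e' (w : M -> R) p : A e -> A e' -> chart_dom e p -> chart_dom e' p ->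
  Ck 1 (chart_img e') (fun y => w (chart_inv e' y)) ->
  grad e w p = grad e' w p *m (transition_jacobian e e' (e p))^T.
Proof.
move=> eA e'A Dp D'p cw; apply/rowP => i; rewrite !mxE.
have Op : overlap e e' (e p) by exists p.
have oO := @open_overlap e e'.
rewrite (@partial_eq _ _ _ _ ((fun y => w (chart_inv e' y)) \o transition e e') i oO); last 2 first.
- by move=> y; rewrite inE => Oy; rewrite /= transition_inv.
- by rewrite inE.
have dT j : is_derive (e p) (delta_mx 0 i) (fun y => transition e e' y 0 j)
    (transition_jacobian e e' (e p) i j).
  rewrite mxE; apply: DeriveDef => //.
  by apply: Ck_derivable (atlas_compat hA eA e'A j 1) Op.
have := is_derive_comp (open_img (e := e')) (transition_img Op) cw dT.
rewrite /transition chart_mapK// => D; rewrite /partial derive_val.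
by apply: eq_bigr => j _; rewrite !mxE mulrC.
Qed.

Lemma invmxM_congr (J G : 'M[R]_n) : J *m G *m J^T \in unitmx ->
  J^T *m invmx (J *m G *m J^T) *m J = invmx G.
Proof.
move=> uH; have [uJ uG uT] : [/\ J \in unitmx, G \in unitmx & J^T \in unitmx].
  by move: uH; rewrite !unitmx_mul => /andP[/andP[-> ->] ->].
have : (J *m G *m J^T) *m invmx (J *m G *m J^T) = 1%:M by rewrite mulmxV.
rewrite -!mulmxA => /(congr1 (mulmx (invmx J))); rewrite mulKmx// mulmx1.
move=> /(congr1 (mulmx^~ J)); rewrite mulVmx// -!mulmxA.
by move=> /(congr1 (mulmx (invmx G))); rewrite mulKmx// mulmx1 !mulmxA.
Qed.

Variable (g : chart R n M -> 'rV[R]_n -> 'M[R]_n).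
Hypothesis gM : riemannian_metric A 4 g.

Definition grad_dot e (u w : M -> R) (p : M) : R :=
  (grad e u p *m invmx (g e (e p)) *m (grad e w p)^T) 0 0.

(** The Jacobians in the transformation rules of gradients and of the metric
    cancel. *)
Lemma grad_dot_transition e e' (u w : M -> R) p : A e -> A e' ->
  chart_dom e p -> chart_dom e' p ->
  Ck 1 (chart_img e') (fun y => u (chart_inv e' y)) ->
  Ck 1 (chart_img e') (fun y => w (chart_inv e' y)) ->
  grad_dot e u w p = grad_dot e' u w p.
Proof.
move=> eA e'A Dp D'p cu cw; rewrite /grad_dot !(@grad_transition e e')//.
have Op : overlap e e' (e p) by exists p.
have uG := posdef_unit (metric_posdef gM eA (chart_img_in Dp)).
have gE := metric_compat gM eA e'A Op; rewrite gE in uG *.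
rewrite /transition chart_mapK// in uG *; rewrite trmx_mul trmxK -!mulmxA.
by rewrite -(invmxM_congr uG) !mulmxA.
Qed.

End transition.

Lemma partialB (R : realType) n (U : set 'rV[R]_n) (u v : 'rV[R]_n -> R) i :
  open U -> Ck 1 U u -> Ck 1 U v ->
  {in U, partial i (fun x => u x - v x) =1 fun x => partial i u x - partial i v x}.
Proof.
move=> oU cu cv x Ux; have cv' := CkZ (-1) oU cv.
transitivity (partial i (u \+ (fun y => -1 * v y)) x).
  by congr (partial i _ x); apply/funext => y /=; rewrite mulN1r.
by rewrite (partialD i cu cv' Ux)/= (partialZ _ i cv Ux) mulN1r.
Qed.

(** * Integration by parts in a chart *)

Section green.
Context {R : realType} {n : nat} {M : ptopologicalType}.
Variables (A : set (chart R n M)) (g : chart R n M -> 'rV[R]_n -> 'M[R]_n).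
Hypothesis gM : riemannian_metric A 4 g.
Variable (e : chart R n M).
Hypothesis eA : A e.
Local Notation I := (chart_img e).
Implicit Types u w : 'rV[R]_n -> R.

Definition fluxgrad w i x := \sum_j flux g e i j x * partial j w x.

Definition divgrad w x := \sum_i partial i (fluxgrad w i) x.

Lemma laplace_beltramiE w x : laplace_beltrami g e w x = (vol g e x)^-1 * divgrad w x.
Proof. by []. Qed.

Lemma Ck_fluxgrad k w i : (k <= 4)%N -> Ck k.+1 I w -> Ck k I (fluxgrad w i).
Proof.
move=> k4 cw; have oI := @open_img _ _ _ e; apply: Ck_sum => // j _.
apply: (CkM oI); first exact: Ck_le k4 (Ck_flux gM eA i j).
exact: Ck_partial.
Qed.

Lemma partial_mul_fluxgrad u w i x : I x -> Ck 1 I u -> Ck 2 I w ->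
  partial i (fun y => u y * fluxgrad w i y) x =
  partial i u x * fluxgrad w i x + u x * partial i (fluxgrad w i) x.
Proof.
move=> Ix cu cw; have cF : Ck 1 I (fluxgrad w i) by exact: Ck_fluxgrad.
by rewrite (partialM i cu cF) ?inE.
Qed.

(** The divergence theorem for the field u grad w. *)
Lemma weak_divgrad K u w : compact K -> K `<=` I ->
  (forall x, I x -> ~ K x -> u x = 0) -> Ck 1 I u -> Ck 2 I w ->
  (\int[@leb R n]_(x in I)
     (\sum_i partial i u x * fluxgrad w i x + u x * divgrad w x)%:E = 0)%E.
Proof.
move=> cK KI u0 cu cw; have oI := @open_img _ _ _ e.
rewrite -(@integral_divergence _ _ I K (fun i x => u x * fluxgrad w i x) oI cK KI).
- apply: eq_integral => x /[!inE] Ix; congr EFin.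
  rewrite mulr_sumr -big_split; apply: eq_bigr => i _.
  by rewrite partial_mul_fluxgrad.
- by move=> i; apply: (CkM oI cu); exact: Ck_fluxgrad.
- by move=> i x Ix nK; rewrite u0// mul0r.
Qed.

Lemma partial_zero_off (K : set 'rV[R]_n) u i x : closed K ->
  (forall x, I x -> ~ K x -> u x = 0) -> I x -> ~ K x -> partial i u x = 0.
Proof.
move=> cK u0 Ix nK; have oI := @open_img _ _ _ e.
have oV : open (I `&` ~` K) by apply: openI => //; exact: closed_openC.
rewrite (@partial_eq _ _ _ u (cst 0) i oV) ?partial_cst// ?inE// => y.
by rewrite inE => -[Iy nKy]; exact: u0.
Qed.

(** The divergence theorem for u grad w - w grad u: the terms with two first
    derivatives cancel because the metric is symmetric. *)
Lemma divgrad_symmetric K u w : compact K -> K `<=` I ->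
  (forall x, I x -> ~ K x -> u x = 0) -> Ck 2 I u -> Ck 2 I w ->
  (\int[@leb R n]_(x in I) (u x * divgrad w x - w x * divgrad u x)%:E = 0)%E.
Proof.
move=> cK KI u0 cu cw; have oI := @open_img _ _ _ e.
have clK : closed K by apply: compact_closed => //; exact: norm_hausdorff.
have cX (a b : 'rV[R]_n -> R) i : Ck 2 I a -> Ck 2 I b -> Ck 1 I (fun x => a x * fluxgrad b i x).
  by move=> ca cb; apply: (CkM oI); [exact: CkW|exact: Ck_fluxgrad].
rewrite -(@integral_divergence _ _ I K
  (fun i x => u x * fluxgrad w i x - w x * fluxgrad u i x) oI cK KI).
- apply: eq_integral => x /[!inE] Ix; congr EFin.
  have P i : partial i (fun x => u x * fluxgrad w i x - w x * fluxgrad u i x) x =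
      (partial i u x * fluxgrad w i x - partial i w x * fluxgrad u i x) +
      (u x * partial i (fluxgrad w i) x - w x * partial i (fluxgrad u i) x).
    rewrite (partialB i oI (cX u w i cu cw) (cX w u i cw cu)) ?inE//.
    by rewrite (partial_mul_fluxgrad i Ix (CkW cu) cw)
      (partial_mul_fluxgrad i Ix (CkW cw) cu) opprD addrACA.
  have E : \sum_i partial i u x * fluxgrad w i x = \sum_i partial i w x * fluxgrad u i x.
    under eq_bigr do rewrite mulr_sumr; rewrite exchange_big/=.
    apply: eq_bigr => i _; rewrite mulr_sumr; apply: eq_bigr => j _.
    by rewrite (flux_sym gM eA j i)// mulrCA [RHS]mulrCA; congr (_ * _); rewrite mulrC.
  have S (a b c d : 'I_n -> R) : \sum_i a i = \sum_i b i ->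
      \sum_i c i - \sum_i d i = \sum_i ((a i - b i) + (c i - d i)).
    by move=> ab; rewrite big_split/= !sumrB ab subrr add0r.
  rewrite [RHS](eq_bigr _ (fun i _ => P i)) -[RHS](S _ _ _ _ E).
  by rewrite /divgrad; congr (_ - _); rewrite mulr_sumr.
- move=> i; apply: (CkB oI); exact: cX.
- move=> i x Ix nK; rewrite u0// mul0r /fluxgrad big1 ?mulr0 ?subrr// => j _.
  by rewrite (partial_zero_off _ clK u0)// mulr0.
Qed.

End green.

(** * Functions supported in a chart *)

Section supported.
Context {R : realType} {n : nat} {M : ptopologicalType}.
Variables (A : set (chart R n M)) (g : chart R n M -> 'rV[R]_n -> 'M[R]_n).
Variable mu : {measure set (borel M) -> \bar R}.
Implicit Types (e : chart R n M) (K : set 'rV[R]_n) (F : M -> R).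

Definition supported e K F := forall p, ~ (chart_dom e p /\ K (e p)) -> F p = 0.

Lemma supported_off e K F : supported e K F ->
  forall x, chart_img e x -> ~ K x -> F (chart_inv e x) = 0.
Proof. by move=> sF x Ix nK; apply: sF => -[_]; rewrite chart_invK. Qed.

Lemma supported_dom e K F : supported e K F -> forall p, ~ chart_dom e p -> F p = 0.
Proof. by move=> sF p nD; apply: sF => -[]. Qed.

Lemma closed_support e K : hausdorff_space M -> compact K -> K `<=` chart_img e ->
  closed (chart_inv e @` K).
Proof.
move=> hM cK KI; apply: compact_closed => //; apply: continuous_compact => // => x.
apply: continuous_in_subspaceT => {}x /[!inE] Kx.
by apply: chart_inv_continuous; exact: KI.
Qed.

(** Smoothness across the boundary of a chart: near a point outside the support
    the function vanishes, because the support is compact, hence closed. *)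
Lemma Ck_supported k e e' K F : smooth_atlas A -> hausdorff_space M -> A e -> A e' ->
  compact K -> K `<=` chart_img e -> supported e K F ->
  Ck k (chart_img e) (fun x => F (chart_inv e x)) ->
  Ck k (chart_img e') (fun x => F (chart_inv e' x)).
Proof.
move=> hA hM eA e'A cK KI sF cF.
have clS := closed_support hM cK KI.
apply: Ck_local => x Ix.
have [Dx|nDx] := pselect (chart_dom e (chart_inv e' x)).
  exists (overlap e' e); first by apply/overlapE.
  apply: Ck_eq (Ck_transition hA e'A eA cF); first exact: open_overlap.
  by move=> y; rewrite inE => Oy /=; rewrite transition_inv.
exists [set y | chart_img e' y /\ (~` (chart_inv e @` K)) (chart_inv e' y)].
  by split=> // -[y Ky yx]; apply: nDx; rewrite -yx; apply: chart_inv_dom; exact: KI.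
apply: (@Ck_eq _ _ _ _ (cst 0)); [apply: open_chart_preimage; exact: closed_openC| |exact: Ck_cst].
move=> y; rewrite inE => -[Iy nK]; rewrite sF// => -[Dy Ky]; apply: nK.
by exists (e (chart_inv e' y)) => //; rewrite chart_mapK.
Qed.

Hypotheses (gM : riemannian_metric A 4 g) (muM : volume_measure A g mu).

Lemma measurable_supported e K F : A e -> supported e K F ->
  Ck 0 (chart_img e) (fun x => F (chart_inv e x)) ->
  measurable_fun setT (F : borel M -> R).
Proof.
move=> eA sF cF; have mD := @measurable_dom _ _ _ e.
have -> : F = (F \_ (chart_dom e)).
  apply/funext => p; rewrite patchE; case: ifPn => // /negP/[!inE] nD.
  exact: supported_dom sF _ nD.
apply/(measurable_restrictT (F : borel M -> R) mD).
apply: (@eq_measurable_fun _ _ (borel M) R _ (fun p => F (chart_inv e (e p)))).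
  by move=> p /[!inE] Dp; rewrite chart_mapK.
apply: (measurable_comp (F := chart_img e : set (borel 'rV[R]_n))
  (f := (fun x => F (chart_inv e x)) : borel 'rV[R]_n -> R)).
- exact: measurable_img.
- by [].
- by apply: Ck_measurable cF; exact: open_img.
- by apply: continuous_borel; [exact: chart_dom_open|exact: chart_map_continuous].
Qed.

Lemma Ck_vol_mul e F : A e -> Ck 0 (chart_img e) (fun x => F (chart_inv e x)) ->
  Ck 0 (chart_img e) (fun x => vol g e x * F (chart_inv e x)).
Proof.
move=> eA cF; have oI := @open_img _ _ _ e.
exact: (CkM oI (Ck_le (leq0n 4) (Ck_vol gM eA)) cF).
Qed.

Lemma supported_integrable e K F : A e -> compact K -> K `<=` chart_img e ->
  supported e K F -> Ck 0 (chart_img e) (fun x => F (chart_inv e x)) ->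
  mu.-integrable setT (EFin \o (F : borel M -> R)).
Proof.
move=> eA cK KI sF cF; have mF := measurable_supported eA sF cF.
have oI := @open_img _ _ _ e.
have clK : closed K by apply: compact_closed => //; exact: norm_hausdorff.
apply/integrableP; split; first exact/measurable_EFinP.
pose F' p := `|F p|.
have mF' : measurable_fun (chart_dom e : set (borel M)) (F' : borel M -> R).
  by apply: measurableT_comp => //; exact: measurable_funTS.
have F'0 p : ~ chart_dom e p -> F' p = 0.
  by move=> nD; rewrite /F' (supported_dom sF nD) normr0.
rewrite (chart_integral gM muM eA mF' F'0).
pose h := (fun x => vol g e x * F (chart_inv e x)) \_ (chart_img e).
have h0 x : ~ K x -> h x = 0.
  move=> nK; rewrite /h patchE; case: ifPn => // /[!inE] Ix.
  by rewrite (supported_off sF)// mulr0.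
have ch : Ck 0 setT h.
  apply: (@Ck_extend0 _ _ 0 _ K) => //; first exact: Ck_vol_mul.
  by move=> x Ix nK; rewrite (supported_off sF)// mulr0.
have {}ch : continuous h by move=> x; exact: (Ck_continuous ch).
have [r r0 Kr] := compact_sub_box cK.
have h0' x : ~ box 0 r x -> h x = 0 by move=> nx; apply: h0 => /Kr.
have [C hC] := continuous_box_bounded ch h0'.
have mh : measurable_fun setT (h : borel 'rV[R]_n -> R).
  by apply: continuous_borel_real; [exact: openT|move=> x _; exact: ch].
have /integrableP[_] := integrable_bounded_box mh r0 h0' hC.
apply: le_lt_trans; rewrite integral_mkcond le_eqVlt; apply/orP; left; apply/eqP.
apply: eq_integral => x _; rewrite patchE /h/= patchE; case: ifPn => Ix.
  by rewrite normrM ger0_norm// sqrtr_ge0.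
by rewrite normr0.
Qed.

End supported.

(** * Bumps and partitions of unity *)

Section bump.
Context {R : realType} {n : nat}.
Implicit Types (c x : 'rV[R]_n) (r : R).

Definition ball_bump c r x := flat 0 (1 - \sum_i (r^-1 * (x 0 i - c 0 i)) ^+ 2).

Lemma Ck_quad k (U : set 'rV[R]_n) c r : open U ->
  Ck k U (fun x => \sum_i (r^-1 * (x 0 i - c 0 i)) ^+ 2).
Proof.
move=> oU; apply: Ck_sum => // i _.
have cl : Ck k U (fun x => r^-1 * (x 0 i - c 0 i)).
  by apply: (CkZ _ oU); apply: (CkB oU); [exact: Ck_coord|exact: Ck_cst].
exact: (CkM oU cl cl).
Qed.

Lemma Ck_ball_bump k (U : set 'rV[R]_n) c r : open U -> Ck k U (ball_bump c r).
Proof.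
move=> oU; apply: (@Ck_flat _ _ _ _ (fun x => 1 - \sum_i (r^-1 * (x 0 i - c 0 i)) ^+ 2)) => //.
by apply: (CkB oU); [exact: Ck_cst|exact: Ck_quad].
Qed.

Lemma ball_bump_ge0 c r x : 0 <= ball_bump c r x.
Proof. exact: flat_ge0. Qed.

Lemma flat0_gt0 (t : R) : 0 < t -> 0 < flat 0 t.
Proof. by move=> t0; rewrite /flat t0 expr0 mul1r expR_gt0. Qed.

Lemma ball_bump_off_box c r x : 0 < r -> ~ box c r x -> ball_bump c r x = 0.
Proof.
move=> r0 nb; rewrite /ball_bump /flat ltNge; case: ifPn => // /negP; case.
have [i ri] : exists i, r < `|x 0 i - c 0 i|.
  apply/not_existsP => h; apply: nb => i; rewrite leNgt; apply/negP; exact: h.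
rewrite subr_le0 (bigD1 i)//= -[leLHS]addr0 lerD//; last first.
  by apply: sumr_ge0 => j _; exact: sqr_ge0.
rewrite -real_normK ?num_real// -[1](expr1n _ 2%N) lerXn2r ?nnegrE//.
by rewrite normrM ger0_norm ?invr_ge0 ?(ltW r0)// ler_pdivlMl// mulr1 ltW.
Qed.

Lemma open_quad c r : open [set x : 'rV[R]_n | \sum_i (r^-1 * (x 0 i - c 0 i)) ^+ 2 < 1].
Proof.
have ct : continuous (fun x : 'rV[R]_n => \sum_i (r^-1 * (x 0 i - c 0 i)) ^+ 2).
  by move=> x; apply: (Ck_continuous (Ck_quad 0 c r openT)).
exact: (open_comp (fun x _ => ct x) (@open_lt R 1)).
Qed.

Lemma quad_center c r : \sum_i (r^-1 * (c 0 i - c 0 i)) ^+ 2 = 0.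
Proof. by apply: big1 => i _; rewrite subrr mulr0 expr0n. Qed.

End bump.

Section partition.
Context {R : realType} {n : nat} {M : ptopologicalType}.
Variables (A : set (chart R n M)) (hA : smooth_atlas A).
Hypotheses (hM : hausdorff_space M) (cM : compact [set: M]).

Lemma open_sub_box (U : set 'rV[R]_n) c : open U -> U c -> exists2 r : R, 0 < r & box c r `<=` U.
Proof.
move=> oU Uc; have /nbhs_ballP[r /= r0 rU] := open_nbhs_nbhs (conj oU Uc).
exists (r / 2); first by rewrite divr_gt0.
move=> x bx; apply: rU; split=> // i j; rewrite ord1 /ball/= distrC.
by apply: le_lt_trans (bx j) _; lra.
Qed.

(** Bumps in charts that are positive near each point of M, finitely many by
    compactness, divided by their sum. *)
Lemma partition_of_unity : exists (s : seq M) (c : M -> chart R n M)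
    (K : M -> set 'rV[R]_n) (rho : M -> M -> R),
  [/\ forall p, [/\ A (c p), compact (K p) & K p `<=` chart_img (c p)],
      forall p, supported (c p) (K p) (rho p),
      forall p e, A e -> Ck 1 (chart_img e) (fun x => rho p (chart_inv e x)),
      forall p q, 0 <= rho p q & forall q, \sum_(p <- s) rho p q = 1].
Proof.
have /choice[z hz] : forall p : M, exists z : chart R n M * R,
    [/\ A z.1, chart_dom z.1 p, 0 < z.2 & box (z.1 p) z.2 `<=` chart_img z.1].
  move=> p; have [e eA Dp] := atlas_cover hA p.
  by have [r r0 br] := open_sub_box (open_img (e := e)) (chart_img_in Dp); exists (e, r).
pose c p := (z p).1; pose r p := (z p).2; pose K p := box (c p p) (r p).
pose b p x := ball_bump (c p p) (r p) x.
pose chi p q := if q \in chart_dom (c p) then b p (c p q) else 0.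
have cA p : A (c p) by have [] := hz p.
have r0 p : 0 < r p by have [] := hz p.
have KI p : K p `<=` chart_img (c p) by have [] := hz p.
have cK p : compact (K p) by exact: compact_box.
have chi_ge0 p q : 0 <= chi p q by rewrite /chi; case: ifP => // _; exact: ball_bump_ge0.
have schi p : supported (c p) (K p) (chi p).
  move=> q h; rewrite /chi; case: ifPn => // /[!inE] Dq; apply: ball_bump_off_box => // Kq.
  by apply: h.
have cchi p e k : A e -> Ck k (chart_img e) (fun x => chi p (chart_inv e x)).
  move=> eA; apply: Ck_supported hA hM (cA p) eA (cK p) (KI p) (schi p) _.
  apply: (Ck_eq (open_img (e := c p)) _ (Ck_ball_bump k _ _ (open_img (e := c p)))) => x.
  rewrite inE => Ix; rewrite /chi /b chart_invK// ifT//.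
  by rewrite inE; exact: chart_inv_dom.
pose V p := chart_dom (c p) `&` (c p) @^-1`
  [set x : 'rV[R]_n | \sum_i ((r p)^-1 * (x 0 i - c p p 0 i)) ^+ 2 < 1].
have oV p : open (V p).
  apply: open_continuous_preimage; [exact: chart_dom_open|exact: chart_map_continuous|].
  exact: open_quad.
have := cM; rewrite compact_cover => /(_ M setT V)[//|p _|D _ DV].
  exists p => //; split; first by have [] := hz p.
  by rewrite /= quad_center.
pose s : seq M := finmap.enum_fset D.
have sV q : exists2 p, p \in s & V p q by have [p pD Vp] := DV q I; exists p.
pose S q := \sum_(p <- s) chi p q.
have S_gt0 q : 0 < S q.
  have [p ps [Dq Vq]] := sV q.
  rewrite /S (big_rem p)//= ltr_pwDl//; last by apply: sumr_ge0.
  by rewrite /chi ifT ?inE//; apply: flat0_gt0; rewrite subr_gt0.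
exists s, c, K, (fun p q => chi p q * (S q)^-1); split.
- by move=> p; split.
- by move=> p q h; rewrite schi// mul0r.
- move=> p e eA; have oI := @open_img _ _ _ e.
  apply: (CkM oI (cchi p e 1%N eA)); apply: CkV => //.
    by move=> x _; rewrite gt_eqF.
  by apply: Ck_sum => // q _; exact: cchi.
- by move=> p q; rewrite mulr_ge0// invr_ge0 ltW.
- by move=> q; rewrite -mulr_suml -/(S q) mulfV// (gt_eqF (S_gt0 q)).
Qed.

End partition.

(** * The mean of an eigenfunction *)

Section mean.
Context {R : realType} {n : nat} {M : ptopologicalType}.
Variables (A : set (chart R n M)) (g : chart R n M -> 'rV[R]_n -> 'M[R]_n).
Variable mu : {measure set (borel M) -> \bar R}.
Hypotheses (mM : closed_connected_manifold A) (gM : riemannian_metric A 4 g)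
  (muM : volume_measure A g mu).
Let hA := manifold_atlas mM.
Let hM := manifold_hausdorff mM.

(** The constant 1 is a finite sum of compactly supported functions. *)
Lemma finite_volume : (mu setT < +oo)%E.
Proof.
have [s [c [K [rho [cK srho crho _ rho1]]]]] := partition_of_unity hA hM (manifold_compact mM).
have ir p : mu.-integrable setT (EFin \o (rho p : borel M -> R)).
  have [cA kK KI] := cK p.
  by apply: (supported_integrable gM muM cA kK KI (srho p)); apply: CkW; exact: crho.
have : mu.-integrable setT (fun q => \sum_(p <- s) (rho p q)%:E)%E.
  by apply: integrable_sum => // p _; exact: ir.
rewrite (_ : (fun q => _) = cst 1%E); last first.
  by apply/funext => q; rewrite sumEFin rho1.
move=> /integrableP[_]; rewrite (eq_integral (cst 1%E)); last first.
  by move=> q _; rewrite /= normr1.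
by rewrite integral_cst// mul1e.
Qed.

Lemma grad_dotE e (u w : M -> R) x : A e -> chart_img e x ->
  grad_dot g e u w (chart_inv e x) = (vol g e x)^-1 *
    \sum_i partial i (fun y => u (chart_inv e y)) x *
       fluxgrad g e (fun y => w (chart_inv e y)) i x.
Proof.
move=> eA Ix; rewrite /grad_dot /grad chart_invK// !mxE.
have v0 : vol g e x != 0 by rewrite gt_eqF// (vol_gt0 gM eA).
transitivity (\sum_j \sum_i (partial i (fun y => u (chart_inv e y)) x *
    invmx (g e x) i j) * partial j (fun y => w (chart_inv e y)) x).
  by apply: eq_bigr => j _; rewrite !mxE mulr_suml; apply: eq_bigr => i _; rewrite !mxE.
rewrite exchange_big mulr_sumr; apply: eq_bigr => i _.
rewrite /fluxgrad /flux mulrCA mulr_sumr mulr_sumr; apply: eq_bigr => j _.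
by rewrite -!mulrA mulKf.
Qed.

(** The product of lam with phi is minus the Laplacian of phi. Against one member
    of a partition of unity, its integral is that of the scalar product of two
    gradients; these scalar products do not depend on the chart, and the
    gradients of the members of the partition sum to 0. *)
Lemma eigen_mean_zero (phi : M -> R) (lam : R) : lam != 0 ->
  (forall e, A e -> Ck 2 (chart_img e) (fun x => phi (chart_inv e x))) ->
  (forall e x, A e -> chart_img e x ->
     - laplace_beltrami g e (fun y => phi (chart_inv e y)) x = lam * phi (chart_inv e x)) ->
  (\int[mu]_q (phi q)%:E = 0)%E.
Proof.
move=> l0 cphi ephi.
have [s [c [K [rho [cK srho crho _ rho1]]]]] := partition_of_unity hA hM (manifold_compact mM).
(* F p has integral 0, and the F p sum to - lam * phi since the E p sum to 0 *)
pose E p q := if q \in chart_dom (c p) then grad_dot g (c p) (rho p) phi q else 0.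
pose F p q := E p q - lam * (rho p q * phi q).
have rho0 p e x : A e -> chart_img e x -> ~ (chart_dom (c p) (chart_inv e x) /\
    K p (c p (chart_inv e x))) ->
  grad e (rho p) (chart_inv e x) = 0.
  move=> eA Ix nK; have [cA kK KI] := cK p; apply/rowP => i; rewrite !mxE chart_invK//.
  have oV := open_chart_preimage (e := e) (closed_openC (closed_support hM kK KI)).
  rewrite (@partial_eq _ _ _ _ (cst 0) i oV) ?partial_cst//.
    move=> y; rewrite inE => -[Iy nKy]; rewrite (srho p)// => -[Dy Ky]; apply: nKy.
    by exists (c p (chart_inv e y)) => //; rewrite chart_mapK.
  rewrite inE; split=> // -[y Ky yx]; apply: nK; rewrite -yx; have Iy := KI _ Ky.
  by split; [exact: chart_inv_dom|rewrite chart_invK].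
have sF p : supported (c p) (K p) (F p).
  move=> q h; rewrite /F (srho p)// mul0r mulr0 subr0 /E; case: ifPn => // /[!inE] Dq.
  have [cA _ _] := cK p; have := rho0 p (c p) (c p q) cA (chart_img_in Dq).
  by rewrite chart_mapK// /grad_dot => ->//; rewrite !mul0mx mxE.
have FE p x : chart_img (c p) x -> F p (chart_inv (c p) x) =
    (vol g (c p) x)^-1 * (\sum_i partial i (fun y => rho p (chart_inv (c p) y)) x *
      fluxgrad g (c p) (fun y => phi (chart_inv (c p) y)) i x +
      rho p (chart_inv (c p) x) * divgrad g (c p) (fun y => phi (chart_inv (c p) y)) x).
  move=> Ix; have [cA _ _] := cK p; rewrite /F /E ifT ?inE; last exact: chart_inv_dom.
  rewrite grad_dotE// mulrDr; congr (_ + _).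
  by rewrite mulrCA -(ephi _ _ cA Ix) laplace_beltramiE mulrN opprK mulrCA.
have oI p := @open_img _ _ _ (c p).
have crp p := crho p (c p) (let: And3 a _ _ := cK p in a).
have cpp p := cphi (c p) (let: And3 a _ _ := cK p in a).
have cF p : Ck 0 (chart_img (c p)) (fun x => F p (chart_inv (c p) x)).
  have [cA _ _] := cK p; have v0 x : chart_img (c p) x -> vol g (c p) x != 0.
    by move=> Ix; rewrite gt_eqF// (vol_gt0 gM cA).
  have ceq : {in chart_img (c p), (fun x => (vol g (c p) x)^-1 *
      (\sum_i partial i (fun y => rho p (chart_inv (c p) y)) x *
      fluxgrad g (c p) (fun y => phi (chart_inv (c p) y)) i x +
      rho p (chart_inv (c p) x) * divgrad g (c p) (fun y => phi (chart_inv (c p) y)) x))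
     =1 (fun x => F p (chart_inv (c p) x))}.
    by move=> x; rewrite inE => Ix; rewrite FE.
  apply: (Ck_eq (oI p) ceq); apply: (CkM (oI p)).
    by apply: (CkV (oI p) v0); exact: Ck_le (leq0n 4) (Ck_vol gM cA).
  apply: (CkD (oI p)).
    apply: Ck_sum => // i _; apply: (CkM (oI p)); first exact: Ck_partial.
    by apply: CkW; apply: (Ck_fluxgrad gM cA i (k := 1%N) isT); exact: cpp.
  apply: (CkM (oI p)); first exact: CkW.
  apply: Ck_sum => // i _; apply: Ck_partial.
  by apply: (Ck_fluxgrad gM cA i (k := 1%N) isT); exact: cpp.
have iF p : mu.-integrable setT (EFin \o (F p : borel M -> R)).
  have [cA kK KI] := cK p; exact: (supported_integrable gM muM cA kK KI (sF p) (cF p)).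
have F0 p : (\int[mu]_q (F p q)%:E = 0)%E.
  have [cA kK KI] := cK p.
  rewrite (chart_integral gM muM cA _ (supported_dom (sF p))); last first.
    by apply: measurable_funTS; exact: measurable_supported cA (sF p) (cF p).
  rewrite -[RHS](weak_divgrad gM cA kK KI (supported_off (srho p)) (crp p) (cpp p)).
  apply: eq_integral => x /[!inE] Ix; rewrite FE// mulVKf//.
  by rewrite gt_eqF// (vol_gt0 gM cA).
have E0 q : \sum_(p <- s) E p q = 0.
  have [e eA Dq] := atlas_cover hA q.
  have Eq p : E p q = grad_dot g e (rho p) phi q.
    have [cA kK KI] := cK p; rewrite /E; case: ifPn => [/[!inE] Dpq|/negP/[!inE] nD].
      by apply: (grad_dot_transition hA gM) => //; [exact: crho|apply: CkW; exact: cphi].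
    have := rho0 p e (e q) eA (chart_img_in Dq); rewrite chart_mapK// /grad_dot => ->.
      by rewrite !mul0mx mxE.
    by case.
  rewrite (eq_bigr _ (fun p _ => Eq p)) /grad_dot -summxE -!mulmx_suml.
  rewrite (_ : \sum_(p <- s) _ = 0) ?mul0mx ?mxE//.
  apply/rowP => i; rewrite summxE mxE.
  under eq_bigr do rewrite mxE.
  rewrite -(@partial_sum _ _ _ _ s _ i (open_img (e := e)) (fun p => crho p e eA)); last first.
    by rewrite inE; exact: chart_img_in.
  rewrite (_ : (fun x => _) = cst 1) ?partial_cst//.
  by apply/funext => x; rewrite rho1.
have SF q : \sum_(p <- s) F p q = - lam * phi q.
  rewrite sumrB E0 sub0r -mulr_sumr -mulr_suml rho1 mul1r mulNr//.
have iS : mu.-integrable setT (fun q => \sum_(p <- s) (F p q)%:E)%E.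
  by apply: integrable_sum => // p _; exact: iF.
have I0 : (\int[mu]_q (\sum_(p <- s) (F p q)%:E) = 0)%E.
  by rewrite integral_sum//; apply: big1 => p _; exact: F0.
transitivity (\int[mu]_q ((- lam)^-1%:E * (\sum_(p <- s) (F p q)%:E)))%E.
  apply: eq_integral => q _; rewrite sumEFin SF -EFinM mulKf// oppr_eq0//.
by rewrite integralZl// I0 mule0.
Qed.

End mean.

(** * Amplitudes *)

Lemma Ck_bounded (R : realType) n (K V : set 'rV[R]_n) (h : 'rV[R]_n -> R) :
  compact K -> K `<=` V -> Ck 0 V h -> exists2 C : R, 0 < C & forall x, K x -> `|h x| <= C.
Proof.
move=> cK KV ch; have : compact (h @` K).
  apply: continuous_compact cK; apply: continuous_in_subspaceT => x /[!inE] Kx.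
  by apply: (Ck_continuous ch); exact: KV.
move=> /compact_bounded[C [_ hC]]; exists (`|C| + 1); first by rewrite ltr_wpDl.
move=> x Kx; apply: (hC (`|C| + 1)); first by rewrite (le_lt_trans (ler_norm _))// ltrDl.
by exists x.
Qed.

Section amplitude.
Context {R : realType} {n : nat}.
Variables (U : set 'rV[R]_n) (oU : open U) (c : nat -> R) (c1 : forall k, 1 <= c k).
Implicit Types (w u v : nat -> 'rV[R]_n -> R).

(** Sequences of functions whose derivatives of order j <= m are O(c_k^j),
    uniformly on U. *)
Fixpoint amp (m : nat) w : Prop :=
  [/\ exists C, forall k x, U x -> `|w k x| <= C, forall k, Ck m U (w k) &
  (if m is m'.+1 then forall i, amp m' (fun k x => (c k)^-1 * partial i (w k) x) else True)].

Lemma amp_bound m w : amp m w -> exists C, forall k x, U x -> `|w k x| <= C.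
Proof. by case: m => [|m] []. Qed.

Lemma amp_Ck m w : amp m w -> forall k, Ck m U (w k).
Proof. by case: m => [|m] []. Qed.

Lemma amp_partial m w i : amp m.+1 w -> amp m (fun k x => (c k)^-1 * partial i (w k) x).
Proof. by move=> [_ _]; exact. Qed.

Lemma ampW m w : amp m.+1 w -> amp m w.
Proof.
elim: m w => [|m IH] w [b cw dw]; split=> //; try by move=> k; exact: CkW.
by move=> i; apply: IH.
Qed.

Lemma amp_eq m w w' : (forall k, {in U, w k =1 w' k}) -> amp m w -> amp m w'.
Proof.
elim: m w w' => [|m IH] w w' ww' [[C b] cw dw]; split=> //.
- by exists C => k x Ux; rewrite -ww' ?inE//; exact: b.
- by move=> k; exact: Ck_eq (ww' k) (cw k).
- by exists C => k x Ux; rewrite -ww' ?inE//; exact: b.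
- by move=> k; exact: Ck_eq (ww' k) (cw k).
- move=> i; apply: IH (dw i) => k x Ux.
  by rewrite (partial_eq i oU (ww' k) Ux).
Qed.

Lemma ampD m u v : amp m u -> amp m v -> amp m (fun k x => u k x + v k x).
Proof.
elim: m u v => [|m IH] u v [[C bu] cu du] [[D bv] cv dv].
  split=> //; last by move=> k; exact: CkD.
  by exists (C + D) => k x Ux; rewrite (le_trans (ler_normD _ _))// lerD ?bu ?bv.
split; [|by move=> k; exact: CkD|].
  by exists (C + D) => k x Ux; rewrite (le_trans (ler_normD _ _))// lerD ?bu ?bv.
move=> i; apply: amp_eq (IH _ _ (du i) (dv i)) => k x Ux.
have uk := Ck_le (ltn0Sn m) (cu k); have vk := Ck_le (ltn0Sn m) (cv k).
by rewrite -mulrDr (partialD i uk vk Ux).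
Qed.

Lemma amp_scale m (t : nat -> R) T w : (forall k, `|t k| <= T) -> amp m w ->
  amp m (fun k x => t k * w k x).
Proof.
move=> tT; elim: m w => [|m IH] w [[C b] cw dw].
  split=> //; last by move=> k; exact: CkZ.
  by exists (T * C) => k x Ux; rewrite normrM ler_pM ?b.
split; [|by move=> k; exact: CkZ|].
  by exists (T * C) => k x Ux; rewrite normrM ler_pM ?b.
move=> i; apply: amp_eq (IH _ (dw i)) => k x Ux.
by rewrite (partialZ _ i (Ck_le (ltn0Sn m) (cw k)) Ux) mulrCA.
Qed.

Lemma ampM m u v : amp m u -> amp m v -> amp m (fun k x => u k x * v k x).
Proof.
elim: m u v => [|m IH] u v au av; have [[C bu] cu du] := au; have [[D bv] cv dv] := av.
  split=> //; last by move=> k; exact: CkM.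
  by exists (C * D) => k x Ux; rewrite normrM ler_pM ?bu ?bv.
split; [|by move=> k; exact: CkM|].
  by exists (C * D) => k x Ux; rewrite normrM ler_pM ?bu ?bv.
move=> i; apply: amp_eq (ampD (IH _ _ (du i) (ampW av)) (IH _ _ (ampW au) (dv i))) => k x Ux.
have uk := Ck_le (ltn0Sn m) (cu k); have vk := Ck_le (ltn0Sn m) (cv k).
rewrite (partialM i uk vk Ux)/=.
move: (partial i (u k) x) (partial i (v k) x) (u k x) (v k x) => a b p q; ring.
Qed.

Lemma amp0 m : amp m (fun _ _ => 0).
Proof.
elim: m => [|m IH]; split=> //; try by move=> k; exact: Ck_cst.
- by exists 0 => k x _; rewrite normr0.
- by exists 0 => k x _; rewrite normr0.
by move=> i; apply: amp_eq IH => k x Ux; rewrite partial_cst mulr0.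
Qed.

Lemma amp_sum m (I : Type) (s : seq I) (w : I -> nat -> 'rV[R]_n -> R) :
  (forall i, amp m (w i)) -> amp m (fun k x => \sum_(i <- s) w i k x).
Proof.
move=> aw; elim: s => [|i s IH].
  by apply: amp_eq (amp0 m) => k x _; rewrite big_nil.
by apply: amp_eq (ampD (aw i) IH) => k x _; rewrite big_cons.
Qed.

Lemma invc_le1 k : `|(c k)^-1| <= 1.
Proof. by rewrite ger0_norm ?invr_ge0 ?(le_trans ler01)// invf_le1 ?(lt_le_trans ltr01). Qed.

Lemma amp_fixed m (K V : set 'rV[R]_n) h : compact K -> U `<=` K -> K `<=` V ->
  Ck m V h -> amp m (fun _ => h).
Proof.
move=> cK UK KV; elim: m h => [|m IH] h ch.
  split=> //; last by move=> _; apply: Ck_sub ch; exact: subset_trans KV.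
  have [C _ hC] := Ck_bounded cK KV ch.
  by exists C => k x Ux; apply: hC; exact: UK.
split; last 2 first.
- by move=> _; apply: Ck_sub ch; exact: subset_trans KV.
- move=> i; apply: (amp_scale (t := fun k => (c k)^-1) invc_le1); apply: IH; exact: Ck_partial.
exact: amp_bound (IH h (CkW ch)).
Qed.

(** Each derivative of the rescaled profile brings down one factor c_k, and the
    derivatives of E are bounded because its support is compact. *)
Lemma amp_profile m (x0 : 'rV[R]_n) (E : 'rV[R]_n -> R) : Ck m setT E ->
  (forall x, ~ box 0 1 x -> E x = 0) -> amp m (fun k x => E (c k *: (x - x0))).
Proof.
move=> cE E0; have Tj k j : (fun y : 'rV[R]_n => (c k *: (y - x0)) 0 j) =
    (fun y : 'rV[R]_n => c k * (y 0 j - x0 0 j)) by apply/funext => y; rewrite !mxE.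
have T_derive k x i j : is_derive x (delta_mx 0 i)
    (fun y : 'rV[R]_n => (c k *: (y - x0)) 0 j) (c k * (j == i)%:R).
  rewrite Tj.
  have := coord_is_derive j i x => d1; have d2 := is_derive_cst (x0 0 j) x (delta_mx 0 i).
  by apply: is_derive_eq; rewrite subr0.
have cT k d j : Ck d U (fun y : 'rV[R]_n => (c k *: (y - x0)) 0 j).
  rewrite Tj.
  by apply: (CkZ _ oU); apply: (CkB oU); [exact: Ck_coord|exact: Ck_cst].
have cE' k d F : Ck d setT F -> Ck d U (fun x => F (c k *: (x - x0))).
  by move=> cF; apply: (Ck_comp oU openT _ (cT k d) cF).
elim: m E cE E0 => [|m IH] E cE E0.
  split=> //; last by move=> k; exact: cE'.
  have [C EC] := continuous_box_bounded (fun x => Ck_continuous cE I) E0.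
  by exists C => k x _; exact: EC.
split; [|by move=> k; exact: cE'|].
  have [C EC] := continuous_box_bounded (fun x => Ck_continuous cE I) E0.
  by exists C => k x _; exact: EC.
move=> i; apply: amp_eq (IH (partial i E) (Ck_partial i cE) _); last first.
  by move=> x; exact: derive_zero_outside.
move=> k x _; have D := @is_derive_comp _ _ (fun y => c k *: (y - x0)) setT E x _ _ openT I
  (Ck_le (ltn0Sn m) cE) (T_derive k x i).
rewrite [in RHS]/partial derive_val (bigD1 i)//= eqxx mulr1 big1 => [|j ji].
  by rewrite addr0 mulKf// gt_eqF// (lt_le_trans ltr01).
by rewrite (negbTE ji) mulr0 mul0r.
Qed.

End amplitude.

(** * Oscillating functions *)

Section oscillation.
Context {R : realType} {n : nat} {M : ptopologicalType}.
Variables (A : set (chart R n M)) (g : chart R n M -> 'rV[R]_n -> 'M[R]_n).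
Hypothesis gM : riemannian_metric A 4 g.
Variable (e : chart R n M).
Hypothesis eA : A e.
Variables (U : set 'rV[R]_n) (oU : open U) (UI : U `<=` chart_img e).
Variables (alpha : 'rV[R]_n) (W c0 : R).
Implicit Types (a b : 'rV[R]_n -> R) (x : 'rV[R]_n).

Definition phase x := W * \sum_i alpha 0 i * x 0 i + c0.

(** Sums of this form are stable under differentiation, the phase being affine. *)
Definition osc a b x := cos (phase x) * a x + sin (phase x) * b x.

Lemma Ck_phase k V : open V -> Ck k V phase.
Proof.
move=> oV; apply: (CkD oV _ (@Ck_cst _ _ k V c0)); apply: (CkZ _ oV).
by apply: Ck_sum => // i _; apply: (CkZ _ oV); exact: Ck_coord.
Qed.

Lemma partial_phase i x : partial i phase x = W * alpha 0 i.
Proof.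
have oT : open [set: 'rV[R]_n] by exact: openT.
have c1 j : Ck 1 setT (fun x : 'rV[R]_n => alpha 0 j * x 0 j).
  by apply: (CkZ _ oT); exact: Ck_coord.
have c2 : Ck 1 setT (fun x : 'rV[R]_n => \sum_j alpha 0 j * x 0 j) by exact: Ck_sum.
have T : x \in [set: 'rV[R]_n] by rewrite inE.
rewrite (partialD i (CkZ W oT c2) (@Ck_cst _ _ 1 setT c0) T)/= partial_cst addr0.
rewrite (partialZ W i c2 T) (partial_sum _ i oT c1 T); congr (_ * _).
rewrite (bigD1 i)//= big1 ?addr0 => [|j ji].
  by rewrite (partialZ _ i (@Ck_coord _ _ 1 setT i) T) partial_coord eqxx mulr1.
by rewrite (partialZ _ i (@Ck_coord _ _ 1 setT j) T) partial_coord (negbTE ji) mulr0.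
Qed.

Lemma Ck_osc k V a b : open V -> Ck k V a -> Ck k V b -> Ck k V (osc a b).
Proof.
move=> oV ca cb; have [cc cs] := Ck_trig oV (Ck_phase k oV).
by apply: (CkD oV); apply: (CkM oV).
Qed.

Lemma partial_osc i a b x : Ck 1 U a -> Ck 1 U b -> U x ->
  partial i (osc a b) x = osc (fun y => partial i a y + W * alpha 0 i * b y)
    (fun y => partial i b y - W * alpha 0 i * a y) x.
Proof.
move=> ca cb Ux; have Ux' : x \in U by rewrite inE.
have [cc cs] := Ck_trig oU (Ck_phase 1 oU).
rewrite (partialD i (CkM oU cc ca) (CkM oU cs cb) Ux')/=.
rewrite (partialM i cc ca Ux') (partialM i cs cb Ux')/=.
rewrite (@partial_comp1 _ _ U phase cos (fun t => - sin t) i _ (Ck_phase 1 oU) x Ux').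
rewrite (@partial_comp1 _ _ U phase sin cos i _ (Ck_phase 1 oU) x Ux')/=.
rewrite partial_phase /osc.
by move: (partial i a x) (partial i b x) (cos _) (sin _) (a x) (b x) => a' b' C S p q; ring.
Qed.

Definition tau i x := \sum_j flux g e i j x * alpha 0 j.

(** The first order operator that collects the terms of order W in the Laplacian of
    an oscillating function: one derivative falls on the phase, the other one on
    the amplitude. *)
Definition transport b x :=
  \sum_i (partial i (fun y => tau i y * b y) x + alpha 0 i * fluxgrad g e b i x).

Lemma sum_osc (f a' al b' : 'I_n -> R) (C S a b : R) :
  \sum_j f j * (C * (a' j + W * al j * b) + S * (b' j - W * al j * a)) =
  C * (\sum_j f j * a' j + W * ((\sum_j f j * al j) * b)) +
  S * (\sum_j f j * b' j - W * ((\sum_j f j * al j) * a)).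
Proof.
transitivity (\sum_j (C * (f j * a' j) + C * W * b * (f j * al j) +
    (S * (f j * b' j) + - (S * W * a) * (f j * al j)))).
  by apply: eq_bigr => j _; ring.
by rewrite !big_split/= -!mulr_sumr; ring.
Qed.

Lemma fluxgrad_osc i a b x : Ck 1 U a -> Ck 1 U b -> U x ->
  fluxgrad g e (osc a b) i x = osc (fun y => fluxgrad g e a i y + W * (tau i y * b y))
    (fun y => fluxgrad g e b i y - W * (tau i y * a y)) x.
Proof.
move=> ca cb Ux; rewrite /osc /fluxgrad /tau -sum_osc; apply: eq_bigr => j _.
by rewrite partial_osc.
Qed.

Lemma Ck_tau i : Ck 4 U (tau i).
Proof.
apply: Ck_sum => // j _; apply: (CkM oU _ (@Ck_cst _ _ 4 U (alpha 0 j))).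
exact: Ck_sub UI (Ck_flux gM eA i j).
Qed.

Lemma Ck_fluxgrad_sub k w i : (k <= 4)%N -> Ck k.+1 U w -> Ck k U (fluxgrad g e w i).
Proof.
move=> k4 cw; apply: Ck_sum => // j _; apply: (CkM oU); last exact: Ck_partial.
exact: Ck_le k4 (Ck_sub UI (Ck_flux gM eA i j)).
Qed.

(** The expansion of the Laplacian in powers of W; the term of order W^2 comes from
    both derivatives falling on the phase. *)
Lemma divgrad_osc a b x : Ck 2 U a -> Ck 2 U b -> U x ->
  divgrad g e (osc a b) x =
  cos (phase x) * (divgrad g e a x + W * transport b x - W ^+ 2 * (\sum_i tau i x * alpha 0 i) * a x) +
  sin (phase x) * (divgrad g e b x - W * transport a x - W ^+ 2 * (\sum_i tau i x * alpha 0 i) * b x).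
Proof.
move=> ca cb Ux; have Ux' : x \in U by rewrite inE.
have cF w i : Ck 2 U w -> Ck 1 U (fluxgrad g e w i) by exact: Ck_fluxgrad_sub.
have ct w i : Ck 2 U w -> Ck 1 U (fun y => tau i y * w y).
  by move=> cw; apply: (CkM oU); [exact: Ck_le (Ck_tau i)|exact: CkW].
pose P i y := fluxgrad g e a i y + W * (tau i y * b y).
pose Q i y := fluxgrad g e b i y - W * (tau i y * a y).
have cP i : Ck 1 U (P i) by apply: (CkD oU (cF a i ca)); exact: (CkZ _ oU (ct b i cb)).
have cQ i : Ck 1 U (Q i) by apply: (CkB oU (cF b i cb)); exact: (CkZ _ oU (ct a i ca)).
have E i : partial i (fluxgrad g e (osc a b) i) x =
    osc (fun y => partial i (P i) y + W * alpha 0 i * Q i y)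
        (fun y => partial i (Q i) y - W * alpha 0 i * P i y) x.
  rewrite -partial_osc//; apply: (partial_eq i oU _ Ux') => y; rewrite inE => Uy.
  by rewrite fluxgrad_osc//; exact: CkW.
have PE i : partial i (P i) x = partial i (fluxgrad g e a i) x + W * partial i (fun y => tau i y * b y) x.
  rewrite (partialD i (cF a i ca) (CkZ W oU (ct b i cb)) Ux')/=.
  by rewrite (partialZ W i (ct b i cb) Ux').
have QE i : partial i (Q i) x = partial i (fluxgrad g e b i) x - W * partial i (fun y => tau i y * a y) x.
  rewrite (partialB i oU (cF b i cb) (CkZ W oU (ct a i ca)) Ux')/=.
  by rewrite (partialZ W i (ct a i ca) Ux').
rewrite {1}/divgrad (eq_bigr _ (fun i _ => E i)) /osc.
rewrite big_split/= -!mulr_sumr; congr (_ * _ + _ * _).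
  transitivity (\sum_i (partial i (fluxgrad g e a i) x + W * (partial i (fun y => tau i y * b y) x +
      alpha 0 i * fluxgrad g e b i x) + - (W ^+ 2) * (tau i x * alpha 0 i) * a x)).
    by apply: eq_bigr => i _; rewrite PE /Q; ring.
  by rewrite !big_split/= -!mulr_sumr -!mulr_suml -mulr_sumr !mulNr.
transitivity (\sum_i (partial i (fluxgrad g e b i) x + - W * (partial i (fun y => tau i y * a y) x +
    alpha 0 i * fluxgrad g e a i x) + - (W ^+ 2) * (tau i x * alpha 0 i) * b x)).
  by apply: eq_bigr => i _; rewrite QE /P; ring.
by rewrite !big_split/= -!mulr_sumr -!mulr_suml -mulr_sumr !mulNr.
Qed.

End oscillation.

(** * The remainder of an oscillating function *)

Section remainder.
Context {R : realType} {n : nat} {M : ptopologicalType}.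
Variables (A : set (chart R n M)) (g : chart R n M -> 'rV[R]_n -> 'M[R]_n).
Hypothesis gM : riemannian_metric A 4 g.
Variable (e : chart R n M).
Hypothesis eA : A e.
Local Notation I := (chart_img e).
Variables (U K : set 'rV[R]_n) (oU : open U) (cK : compact K) (UK : U `<=` K) (KI : K `<=` I).
Variables (alpha : 'rV[R]_n) (c W shift : nat -> R).
Hypotheses (c1 : forall k, 1 <= c k) (cW : forall k, c k <= W k).
Local Notation amp := (amp U c).
Let UI : U `<=` I := subset_trans UK KI.
Let c0 k : 0 < c k := lt_le_trans ltr01 (c1 k).
Let W0 k : 0 < W k := lt_le_trans (c0 k) (cW k).

Lemma amp_fluxgrad m b i : (m <= 4)%N -> amp m.+1 b ->
  amp m (fun k x => (c k)^-1 * fluxgrad g e (b k) i x).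
Proof.
move=> m4 ab.
apply: (amp_eq oU (w := fun k x => \sum_j flux g e i j x * ((c k)^-1 * partial j (b k) x))).
  by move=> k x _; rewrite /fluxgrad mulr_sumr; apply: eq_bigr => j _; rewrite mulrCA.
apply: (amp_sum oU) => j; refine (ampM oU _ (amp_partial j ab)).
by apply: (amp_fixed oU c1 cK UK KI); exact: Ck_le m4 (Ck_flux gM eA i j).
Qed.

Lemma divgrad_bound b : amp 2 b ->
  exists C, forall k x, U x -> `|divgrad g e (b k) x| <= C * c k ^+ 2.
Proof.
move=> ab; pose F i k x := (c k)^-1 * fluxgrad g e (b k) i x.
have aF i : amp 1 (F i) by exact: amp_fluxgrad.
have := @amp_sum _ _ U oU c 0 _ (index_enum 'I_n) _ (fun i => amp_partial i (aF i)).
move=> /amp_bound[C hC]; exists C => k x Ux; have Ux' : x \in U by rewrite inE.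
have -> : divgrad g e (b k) x = c k ^+ 2 * \sum_i (c k)^-1 * partial i (F i k) x.
  rewrite /divgrad mulr_sumr; apply: eq_bigr => i _.
  have cF : Ck 1 U (fluxgrad g e (b k) i).
    by apply: (Ck_fluxgrad_sub gM eA oU UI (k := 1%N) i isT); exact: amp_Ck ab k.
  by rewrite (partialZ (c k)^-1 i cF Ux') expr2 -mulrA !mulVKf// gt_eqF.
by rewrite normrM (ger0_norm (sqr_ge0 _)) mulrC ler_wpM2r ?sqr_ge0// hC.
Qed.

Lemma transport_bound b : amp 1 b ->
  exists C, forall k x, U x -> `|transport g e alpha (b k) x| <= C * c k.
Proof.
move=> ab.
have aT i : amp 0 (fun k x => (c k)^-1 * partial i (fun y => tau g e alpha i y * b k y) x).
  apply: amp_partial; refine (ampM oU _ ab); apply: (amp_fixed oU c1 cK UK KI).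
  apply: Ck_sum => [|j _]; first exact: open_img.
  apply: CkM; [exact: open_img| |exact: Ck_cst].
  by apply: Ck_le (Ck_flux gM eA i j).
have aF i : amp 0 (fun k x => alpha 0 i * ((c k)^-1 * fluxgrad g e (b k) i x)).
  by have := amp_scale oU (fun _ => lexx `|alpha 0 i|) (amp_fluxgrad (m := 0%N) i isT ab); apply.
have := @amp_sum _ _ U oU c 0 _ (index_enum 'I_n) _ (fun i => ampD oU (aT i) (aF i)).
move=> /amp_bound[C hC]; exists C => k x Ux.
have -> : transport g e alpha (b k) x = c k * \sum_i ((c k)^-1 *
    partial i (fun y => tau g e alpha i y * b k y) x +
    alpha 0 i * ((c k)^-1 * fluxgrad g e (b k) i x)).
  rewrite mulr_sumr; apply: eq_bigr => i _.
  by rewrite mulrDr mulVKf ?gt_eqF// (mulrCA (alpha 0 i)) mulVKf ?gt_eqF.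
by rewrite normrM (ger0_norm (ltW (c0 k))) mulrC ler_wpM2r ?(ltW (c0 k))// hC.
Qed.

Variables (x0 : 'rV[R]_n) (E q : 'rV[R]_n -> R).
Hypotheses (cE : Ck 3 setT E) (E0 : forall x, ~ box 0 1 x -> E x = 0).
Hypotheses (cq : Ck 2 I q)
  (qE : forall x, U x -> q x * (\sum_i tau g e alpha i x * alpha 0 i) = 1).

Definition profile k x := E (c k *: (x - x0)).

Definition profile' k x := (W k)^-1 * \sum_i alpha 0 i * partial i (profile k) x.

Definition wave k := osc alpha (W k) (shift k) (profile k) (profile' k).

(** The factor q makes the term of order W^2 of the Laplacian cancel the wave. What
    is left is of order W with one derivative of amplitudes, and of order 1 with
    two of them; both are O(c / W) after division by W^2, as c <= W. *)
Lemma wave_remainder : exists C, forall k x, U x ->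
  `|wave k x + (W k) ^- 2 * divgrad g e (fun y => q y * wave k y) x| <= C * (c k / W k).
Proof.
have ap3 : amp 3 profile by exact: amp_profile.
have ap : amp 2 profile by exact: ampW.
have ap' : amp 2 profile'.
  apply: (amp_eq oU (w := fun k x => (c k / W k) *
      \sum_i alpha 0 i * ((c k)^-1 * partial i (profile k) x))).
    move=> k x _; rewrite /profile' !mulr_sumr; apply: eq_bigr => i _.
    have := gt_eqF (c0 k); have := gt_eqF (W0 k).
    by move: (W k) (c k) (partial i _ x) (alpha 0 i) => w c' p a /negbT w0 /negbT c0'; field; rewrite w0.
  apply: (amp_scale oU (T := 1)).
    by move=> k; rewrite ger0_norm ?divr_ge0 ?(ltW (c0 k)) ?(ltW (W0 k))// ler_pdivrMr// mul1r.
  apply: (amp_sum oU) => i.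
  by have := amp_scale oU (fun _ => lexx `|alpha 0 i|) (amp_partial i ap3); apply.
have aq : amp 2 (fun _ => q) by exact: (amp_fixed oU c1 cK UK KI cq).
pose b1 k x := q x * profile k x; pose b2 k x := q x * profile' k x.
have ab1 : amp 2 b1 by exact: (ampM oU aq ap).
have ab2 : amp 2 b2 by exact: (ampM oU aq ap').
have [D1 hD1] := divgrad_bound ab1; have [D2 hD2] := divgrad_bound ab2.
have [T1 hT1] := transport_bound (ampW ab1); have [T2 hT2] := transport_bound (ampW ab2).
exists (D1 + T2 + (D2 + T1)) => k x Ux.
have -> : (fun y => q y * wave k y) = osc alpha (W k) (shift k) (b1 k) (b2 k).
  by apply/funext => y; rewrite /wave /osc mulrDr mulrCA (mulrCA (q y)).
rewrite (divgrad_osc gM eA oU UI)//; [|exact: (amp_Ck ab1 k)|exact: (amp_Ck ab2 k)].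
set kap := \sum_i _; set C := cos _; set S := sin _.
have kq := qE Ux; rewrite -/kap in kq.
have -> : wave k x = C * profile k x + S * profile' k x by [].
have w0 : W k != 0 by rewrite gt_eqF.
have -> : C * profile k x + S * profile' k x + W k ^- 2 *
    (C * (divgrad g e (b1 k) x + W k * transport g e alpha (b2 k) x - W k ^+ 2 * kap * b1 k x) +
     S * (divgrad g e (b2 k) x - W k * transport g e alpha (b1 k) x - W k ^+ 2 * kap * b2 k x)) =
  C * (W k ^- 2 * divgrad g e (b1 k) x + (W k)^-1 * transport g e alpha (b2 k) x) +
  S * (W k ^- 2 * divgrad g e (b2 k) x - (W k)^-1 * transport g e alpha (b1 k) x).
  rewrite /b1 /b2.
  move: (divgrad g e _ x) (divgrad g e _ x) (transport g e alpha _ x) (transport g e alpha _ x) => d1 d2 t1 t2.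
  have -> (p : R) : W k ^+ 2 * kap * (q x * p) = W k ^+ 2 * p.
    by rewrite -[in RHS](mul1r p) -kq; ring.
  have -> (p : R) : W k ^+ 2 * kap * (q x * p) = W k ^+ 2 * p.
    by rewrite -[in RHS](mul1r p) -kq; ring.
  by move: (W k) w0 C S (profile _ _) (profile' _ _) => w w0 *; field.
have bb (d t D T : R) : `|d| <= D * c k ^+ 2 -> `|t| <= T * c k ->
    W k ^- 2 * `|d| + (W k)^-1 * `|t| <= (D + T) * (c k / W k).
  move=> dD tT; have D0 : 0 <= D.
    by have := le_trans (normr_ge0 _) dD; rewrite pmulr_lge0// exprn_gt0.
  rewrite mulrDl; apply: lerD.
    apply: (@le_trans _ _ (W k ^- 2 * (D * c k ^+ 2))).
      by rewrite ler_wpM2l// invr_ge0 sqr_ge0.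
    rewrite (_ : W k ^- 2 * (D * c k ^+ 2) = D * (c k / W k) * (c k / W k)); last first.
      by move: (W k) w0 => w w0; field.
    have cw0 : 0 <= c k / W k by rewrite divr_ge0 ?(ltW (c0 k)) ?(ltW (W0 k)).
    by apply: ler_piMr; [exact: mulr_ge0|rewrite ler_pdivrMr// mul1r].
  apply: (@le_trans _ _ ((W k)^-1 * (T * c k))); first by rewrite ler_wpM2l// invr_ge0 ltW.
  by rewrite mulrC -mulrA.
have cS (z d t D T : R) : `|z| <= 1 -> `|d| <= D * c k ^+ 2 -> `|t| <= T * c k ->
    `|z * (W k ^- 2 * d + (W k)^-1 * t)| <= (D + T) * (c k / W k).
  move=> z1 dD tT; apply: le_trans (bb _ _ _ _ dD tT).
  rewrite normrM; apply: (@le_trans _ _ (1 * `|W k ^- 2 * d + (W k)^-1 * t|)).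
    by rewrite ler_wpM2r.
  rewrite mul1r; apply: le_trans (ler_normD _ _) _; rewrite !normrM.
  have i1 : 0 <= (W k)^-1 by rewrite invr_ge0 ltW.
  have i2 : 0 <= W k ^- 2 by rewrite invr_ge0 sqr_ge0.
  by rewrite (ger0_norm i1) (ger0_norm i2).
have C1 : `|C| <= 1 by rewrite ler_norml cos_geN1 cos_le1.
have S1 : `|S| <= 1 by rewrite ler_norml sin_geN1 sin_le1.
apply: le_trans (ler_normD _ _) _; rewrite [leRHS]mulrDl; apply: lerD.
  by apply: cS => //; [exact: hD1|exact: hT2].
by rewrite -mulrN; apply: cS => //; [exact: hD2|rewrite normrN; exact: hT1].
Qed.

End remainder.

Local Open Scope complex_scope.

(** * Norms of functions supported in a chart *)

Section real_functions.
Context {R : realType} {M : ptopologicalType}.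
Variable mu : {measure set (borel M) -> \bar R}.
Implicit Types F H : M -> R.
Local Notation sqint F := ((F : borel M -> R) \in Lfun mu 2%:E).

Definition rc F : M -> R[i] := fun p => (F p)%:C.

Lemma im_rc F : im (rc F) = cst 0. Proof. by []. Qed.

Lemma sqint0 : sqint (cst 0).
Proof.
apply: sqintI; first exact: measurable_cst.
by rewrite (eq_integral (cst 0%E)) ?integral0// => p _; rewrite expr0n.
Qed.

Lemma L2_rc F : sqint F -> L2 mu (rc F).
Proof. by move=> sF; apply/L2P; split => //; exact: sqint0. Qed.

Lemma ip0 F : ip mu (cst 0) F = 0.
Proof.
by rewrite /ip /Rintegral (eq_integral (cst 0%E)) ?integral0// => p _; rewrite mul0r.
Qed.

Lemma inner_rc F (u : M -> R[i]) : sqint F -> L2 mu u ->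
  inner mu setT (rc F) u = ip mu F (re u) +i* (- ip mu F (im u)).
Proof.
by move=> sF lu; rewrite innerE//; [rewrite im_rc !ip0 addr0 sub0r|exact: L2_rc].
Qed.

Lemma nrm2_rc F : nrm2 mu (rc F) = ip mu F F.
Proof. by rewrite /nrm2 im_rc ip0 addr0. Qed.

Lemma nrm2_rcE F : sqint F -> (\int[mu]_p (F p ^+ 2)%:E = (nrm2 mu (rc F))%:E)%E.
Proof. by move=> sF; rewrite nrm2_rc -ipE//. Qed.

Lemma nrm2_rc_le F H (c : R) : sqint F -> sqint H ->
  (forall p, `|F p| <= c * `|H p|) -> nrm2 mu (rc F) <= c ^+ 2 * nrm2 mu (rc H).
Proof.
move=> sF sH FH; rewrite -lee_fin EFinM -!nrm2_rcE//.
rewrite -ge0_integralZl//=; last 3 first.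
- by apply/measurable_EFinP; apply: measurable_funX; exact: sqint_measurable sH.
- by move=> p _; rewrite lee_fin sqr_ge0.
- by rewrite lee_fin sqr_ge0.
apply: ge0_le_integral => //.
- by move=> p _; rewrite lee_fin sqr_ge0.
- by apply/measurable_EFinP; apply: measurable_funX; exact: sqint_measurable sF.
- under eq_fun do rewrite -EFinM; apply/measurable_EFinP; apply: measurable_funM => //.
  by apply: measurable_funX; exact: sqint_measurable sH.
move=> p _; rewrite -EFinM lee_fin -(real_normK (num_real (F p))) -(real_normK (num_real (H p))).
rewrite -exprMn lerXn2r ?nnegrE//; exact: le_trans (normr_ge0 _) (FH p).
Qed.

End real_functions.

Section pull.
Context {R : realType} {n : nat} {M : ptopologicalType}.
Variables (A : set (chart R n M)) (g : chart R n M -> 'rV[R]_n -> 'M[R]_n).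
Variable mu : {measure set (borel M) -> \bar R}.
Variable (e : chart R n M).
Implicit Types (F : 'rV[R]_n -> R).
Local Notation I := (chart_img e).
Local Notation leb := (@leb R n).

Definition pull F (p : M) : R := if p \in chart_dom e then F (e p) else 0.

Lemma pull_inv F x : I x -> pull F (chart_inv e x) = F x.
Proof. by move=> Ix; rewrite /pull ifT ?inE ?chart_invK//; exact: chart_inv_dom. Qed.

Lemma supported_pull K F : (forall x, I x -> ~ K x -> F x = 0) -> supported e K (pull F).
Proof.
move=> F0 p h; rewrite /pull; case: ifPn => // /[!inE] Dp; apply: F0.
  exact: chart_img_in.
by move=> Kp; apply: h.
Qed.

Lemma Ck_pull k F : Ck k I F -> Ck k I (fun x => pull F (chart_inv e x)).
Proof.
move=> cF; apply: (Ck_eq (open_img (e := e)) _ cF) => x.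
by rewrite inE => Ix; rewrite pull_inv.
Qed.

Hypotheses (gM : riemannian_metric A 4 g) (muM : volume_measure A g mu).
Hypothesis eA : A e.
Variable K : set 'rV[R]_n.
Hypotheses (cK : compact K) (KI : K `<=` I).
Local Notation sqint F := ((F : borel M -> R) \in Lfun mu 2%:E).

Lemma supported_sqint (F : M -> R) : supported e K F ->
  Ck 0 I (fun x => F (chart_inv e x)) -> sqint F.
Proof.
move=> sF cF; apply: sqintI; first exact: (measurable_supported eA sF cF).
have sF2 : supported e K (fun p => F p ^+ 2) by move=> p h; rewrite sF// expr0n.
have cF2 : Ck 0 I (fun x => F (chart_inv e x) ^+ 2) by exact: (CkM (open_img (e := e)) cF cF).
have := supported_integrable gM muM eA cK KI sF2 cF2; move/integrable_lty; apply.
exact: measurableT.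
Qed.

Lemma nrm2_chart (F : M -> R) : supported e K F -> Ck 0 I (fun x => F (chart_inv e x)) ->
  ((nrm2 mu (rc F))%:E = \int[leb]_(x in I) (vol g e x * F (chart_inv e x) ^+ 2)%:E)%E.
Proof.
move=> sF cF; rewrite -nrm2_rcE; last exact: supported_sqint.
apply: (chart_integral gM muM eA (F := fun p => F p ^+ 2)).
  apply: measurable_funX; apply: measurable_funTS; exact: measurable_supported eA sF cF.
by move=> p nD; rewrite (supported_dom sF nD) expr0n.
Qed.

Lemma nrm2_box_le (F : M -> R) (x0 : 'rV[R]_n) (rho eps V : R) :
  supported e K F -> Ck 0 I (fun x => F (chart_inv e x)) -> 0 <= rho -> 0 <= V ->
  (forall x, I x -> ~ box x0 rho x -> F (chart_inv e x) = 0) ->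
  (forall x, I x -> box x0 rho x -> vol g e x <= V /\ `|F (chart_inv e x)| <= eps) ->
  nrm2 mu (rc F) <= V * eps ^+ 2 * (2 * rho) ^+ n.
Proof.
move=> sF cF r0 V0 F0 Fb; have oI := @open_img _ _ _ e; have mI := @measurable_img _ _ _ e.
rewrite -lee_fin nrm2_chart//.
have mB := @measurable_box R n x0 rho.
have mF : measurable_fun (I : set (borel 'rV[R]_n))
    ((fun x => (vol g e x * F (chart_inv e x) ^+ 2)) : borel 'rV[R]_n -> R).
  apply: (Ck_measurable oI); exact: (Ck_vol_mul (F := fun p => F p ^+ 2) gM eA (CkM oI cF cF)).
apply: (@le_trans _ _ (\int[leb]_(x in I) ((V * eps ^+ 2) * \1_(box x0 rho) x)%:E)%E).
  apply: ge0_le_integral => //.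
  - move=> x Ix; rewrite lee_fin mulr_ge0 ?sqr_ge0// ltW//; exact: (vol_gt0 gM eA).
  - exact/measurable_EFinP.
  - apply/measurable_EFinP; apply: measurable_funM => //; exact: measurable_indic.
  move=> x Ix; rewrite lee_fin indicE; have v0 := ltW (vol_gt0 gM eA Ix).
  have [bx|nb] := boolP (x \in box x0 rho).
    rewrite inE in bx; have [vV Fe] := Fb x Ix bx; rewrite mulr1 ler_pM ?sqr_ge0//.
    rewrite -real_normK ?num_real// lerXn2r ?nnegrE//.
    exact: le_trans (normr_ge0 _) Fe.
  by rewrite F0 ?expr0n ?mulr0// => bx; move/negP: nb; rewrite inE.
apply: (@le_trans _ _ (\int[leb]_x ((V * eps ^+ 2) * \1_(box x0 rho) x)%:E)%E).
  apply: ge0_subset_integral => //.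
    apply/measurable_EFinP; apply: measurable_funM => //; exact: measurable_indic.
  by move=> x _; rewrite lee_fin; apply: mulr_ge0; [rewrite mulr_ge0 ?sqr_ge0|rewrite indicE].
under eq_integral do rewrite EFinM.
rewrite ge0_integralZl//; last 2 first.
- by apply/measurable_EFinP; exact: measurable_indic.
- by rewrite lee_fin mulr_ge0 ?sqr_ge0.
by rewrite integral_indic//= setIT [X in (_ * X)%E](leb_box x0 r0) -EFinM.
Qed.

(** The density vol of the volume measure and the two factors 1 / vol of the square
    leave the weight 1 / vol on f^2. *)
Lemma nrm2_density (f : 'rV[R]_n -> R) (L w1 w2 : R) : Ck 0 setT f ->
  (forall x, ~ K x -> f x = 0) -> (\int[leb]_x (f x ^+ 2)%:E = L%:E)%E ->
  0 <= w1 -> 0 <= w2 -> (forall x, K x -> w1 <= (vol g e x)^-1 <= w2) ->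
  w1 * L <= nrm2 mu (rc (pull (fun x => f x / vol g e x))) <= w2 * L.
Proof.
move=> cf f0 fL w10 w20 wb; have oI := @open_img _ _ _ e; have mI := @measurable_img _ _ _ e.
have cfI : Ck 0 I f by apply: Ck_sub cf.
have cfv : Ck 0 I (fun x => f x / vol g e x).
  apply: (CkM oI cfI); apply: (CkV oI) => [x Ix|]; first by rewrite gt_eqF// (vol_gt0 gM eA).
  exact: Ck_le (leq0n 4) (Ck_vol gM eA).
have s0 : supported e K (pull (fun x => f x / vol g e x)).
  by apply: supported_pull => x _ /f0 ->; rewrite mul0r.
have E : ((nrm2 mu (rc (pull (fun x => f x / vol g e x))))%:E =
    \int[leb]_(x in I) (f x ^+ 2 * (vol g e x)^-1)%:E)%E.
  rewrite nrm2_chart//; last exact: Ck_pull.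
  apply: eq_integral => x /[!inE] Ix; rewrite pull_inv//; congr EFin.
  have := vol_gt0 gM eA Ix; move: (vol g e x) (f x) => v y v0.
  by field; rewrite gt_eqF.
have fLI : (\int[leb]_(x in I) (f x ^+ 2)%:E = L%:E)%E.
  rewrite -fL [LHS]integral_mkcond; apply: eq_integral => x _; rewrite patchE.
  by case: ifPn => // /negP/[!inE] nI; rewrite f0 ?expr0n// => /KI.
have mf : measurable_fun (I : set (borel 'rV[R]_n))
    ((fun x => f x ^+ 2) : borel 'rV[R]_n -> R).
  by apply: (Ck_measurable oI); exact: (CkM oI cfI cfI).
have mfv : measurable_fun (I : set (borel 'rV[R]_n))
    ((fun x => f x ^+ 2 * (vol g e x)^-1) : borel 'rV[R]_n -> R).
  apply: (Ck_measurable oI); apply: (CkM oI (CkM oI cfI cfI)).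
  apply: (CkV oI) => [x Ix|]; first by rewrite gt_eqF// (vol_gt0 gM eA).
  exact: Ck_le (leq0n 4) (Ck_vol gM eA).
have Z (w : R) : 0 <= w -> (\int[leb]_(x in I) (w * f x ^+ 2)%:E = (w * L)%:E)%E.
  move=> w0; under eq_integral do rewrite EFinM.
  rewrite ge0_integralZl// ?fLI ?EFinM//; first exact/measurable_EFinP.
  by move=> x _; rewrite lee_fin sqr_ge0.
have wf (w : R) : measurable_fun (I : set (borel 'rV[R]_n))
    ((fun x => (w * f x ^+ 2)%:E) : borel 'rV[R]_n -> \bar R).
  by apply/measurable_EFinP; apply: measurable_funM.
rewrite -!lee_fin E -!Z//; apply/andP; split; apply: ge0_le_integral => //.
- by move=> x _; rewrite lee_fin mulr_ge0 ?sqr_ge0.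
- exact/measurable_EFinP.
- move=> x Ix; rewrite lee_fin mulrC; have [Kx|nK] := pselect (K x).
    by have /andP[] := wb x Kx => l1 l2; rewrite ler_wpM2l ?sqr_ge0.
  by rewrite f0// expr0n !mul0r.
- by move=> x Ix; rewrite lee_fin mulr_ge0 ?sqr_ge0// invr_ge0 ltW// (vol_gt0 gM eA).
- exact/measurable_EFinP.
- move=> x Ix; rewrite lee_fin [leRHS]mulrC; have [Kx|nK] := pselect (K x).
    by have /andP[] := wb x Kx => l1 l2; rewrite ler_wpM2l ?sqr_ge0.
  by rewrite f0// expr0n !mul0r.
Qed.

End pull.

Local Close Scope complex_scope.

(** * The test functions *)

Section source.
Context {R : realType} {n : nat}.
Variables (alpha : 'rV[R]_n) (halpha : \sum_i alpha 0 i ^+ 2 = 1).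
Variables (c W : nat -> R) (c1 : forall k, 1 <= c k) (cW : forall k, c k <= W k).
Variable x0 : 'rV[R]_n.
Local Notation leb := (@leb R n).
Let cp k : 0 < c k := lt_le_trans ltr01 (c1 k).
Let Wp k : 0 < W k := lt_le_trans (cp k) (cW k).

Definition envelope (k : nat) : 'rV[R]_n -> R := profile c x0 (ball_bump 0 1) k.

Definition osc_source (t : R) (k : nat) : 'rV[R]_n -> R :=
  wave alpha c W (fun _ => t) x0 (ball_bump 0 1) k.

Definition supp_ball k : set 'rV[R]_n := [set x | \sum_i (c k * (x 0 i - x0 0 i)) ^+ 2 <= 1].

Lemma envelopeE k x : envelope k x = flat 0 (1 - \sum_i (c k * (x 0 i - x0 0 i)) ^+ 2).
Proof.
rewrite /envelope /profile /ball_bump; congr (flat 0 (1 - _)); apply: eq_bigr => i _.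
by rewrite !mxE subr0 invr1 mul1r.
Qed.

Lemma envelope_bump k : envelope k = ball_bump x0 (c k)^-1.
Proof. by apply/funext => x; rewrite envelopeE /ball_bump invrK. Qed.

Lemma Ck_envelope m k (V : set 'rV[R]_n) : open V -> Ck m V (envelope k).
Proof. by move=> oV; rewrite envelope_bump; exact: Ck_ball_bump. Qed.

Lemma envelope_ge0 k x : 0 <= envelope k x.
Proof. by rewrite envelopeE flat_ge0. Qed.

Lemma osc_sourceE t k x : osc_source t k x = cos (phase alpha (W k) t x) * envelope k x +
  sin (phase alpha (W k) t x) * ((W k)^-1 * \sum_i alpha 0 i * partial i (envelope k) x).
Proof. by []. Qed.

Lemma Ck_osc_source m t k (V : set 'rV[R]_n) : open V -> Ck m V (osc_source t k).
Proof.
move=> oV; apply: (Ck_osc _ _ _ oV (Ck_envelope m k oV)).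
apply: (CkZ _ oV); apply: Ck_sum => // i _; apply: (CkZ _ oV).
by apply: Ck_partial; exact: Ck_envelope.
Qed.

Lemma closed_supp_ball k : closed (supp_ball k).
Proof.
have ct : continuous (fun x : 'rV[R]_n => \sum_i (c k * (x 0 i - x0 0 i)) ^+ 2).
  move=> x; rewrite (_ : (fun x : 'rV[R]_n => _) =
    (fun x : 'rV[R]_n => \sum_i ((c k)^-1^-1 * (x 0 i - x0 0 i)) ^+ 2)); last by rewrite invrK.
  exact: (Ck_continuous (Ck_quad 0 x0 (c k)^-1 openT)).
apply: (@closed_comp _ _ (fun x : 'rV[R]_n => \sum_i (c k * (x 0 i - x0 0 i)) ^+ 2) [set y | y <= 1]).
  by move=> x _; exact: ct.
exact: closed_le.
Qed.

Lemma supp_ball_box k : supp_ball k `<=` box x0 (c k)^-1.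
Proof.
move=> x Qx i; rewrite -[leRHS]mulr1 ler_pdivlMl//.
rewrite -(ger0_norm (ltW (cp k))) -normrM -(ler_pXn2r (n := 2))// ?nnegrE// real_normK ?num_real// expr1n.
apply: le_trans Qx; rewrite /= (bigD1 i)//= lerDl.
by apply: sumr_ge0 => j _; exact: sqr_ge0.
Qed.

Lemma compact_supp_ball k : compact (supp_ball k).
Proof.
exact: (subclosed_compact (closed_supp_ball (k := k)) (@compact_box _ _ x0 (c k)^-1)
  (@supp_ball_box k)).
Qed.

Lemma envelope_off k x : ~ supp_ball k x -> envelope k x = 0.
Proof.
move=> /negP; rewrite /supp_ball/= -ltNge => Qx; rewrite envelopeE /flat ltNge.
by rewrite subr_le0 (ltW Qx).
Qed.

Lemma partial_envelope_off k i x : ~ supp_ball k x -> partial i (envelope k) x = 0.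
Proof.
move=> nQ; have oV := closed_openC (closed_supp_ball (k := k)).
rewrite (@partial_eq _ _ _ (envelope k) (cst 0) i oV) ?partial_cst// ?inE// => y.
by rewrite inE => nQy; exact: envelope_off.
Qed.

Lemma osc_source_off t k x : ~ supp_ball k x -> osc_source t k x = 0.
Proof.
move=> nQ; rewrite osc_sourceE envelope_off// mulr0 add0r big1 ?mulr0// => i _.
by rewrite partial_envelope_off// mulr0.
Qed.

(** The correction of order 1 / W in the source is there for this identity, which
    makes the mean of the source vanish. *)
Lemma osc_source_divergence t k x :
  osc_source t k x = \sum_i partial i (fun y => alpha 0 i *
    osc alpha (W k) t (cst 0) (fun y => (W k)^-1 * envelope k y) y) x.
Proof.
have oT : open [set: 'rV[R]_n] by exact: openT.
have Tx : x \in [set: 'rV[R]_n] by rewrite inE.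
have cb : Ck 1 setT (fun y => (W k)^-1 * envelope k y) by apply: (CkZ _ oT); exact: Ck_envelope.
have c0 := @Ck_cst R n 1 setT 0.
have w0 : W k != 0 by rewrite gt_eqF.
rewrite osc_sourceE.
transitivity (\sum_i (cos (phase alpha (W k) t x) * envelope k x * alpha 0 i ^+ 2 +
    sin (phase alpha (W k) t x) * (W k)^-1 * (alpha 0 i * partial i (envelope k) x))).
  by rewrite big_split/= -!mulr_sumr halpha mulr1 mulrA.
apply: eq_bigr => i _.
rewrite (partialZ _ i (Ck_osc alpha (W k) t oT c0 cb) Tx) (partial_osc oT alpha (W k) t i c0 cb) ?inE//.
rewrite /osc partial_cst (partialZ _ i (Ck_envelope 1 k oT) Tx)/=.
move: (W k) w0 (partial i _ x) (cos _) (sin _) (envelope k x) (alpha 0 i) => w w0 *.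
by field.
Qed.

Lemma osc_source_mean t k (V : set 'rV[R]_n) : open V -> box x0 (c k)^-1 `<=` V ->
  (\int[leb]_(x in V) (osc_source t k x)%:E = 0)%E.
Proof.
move=> oV bV.
rewrite -(@integral_divergence _ _ V (supp_ball k) (fun i y => alpha 0 i *
    osc alpha (W k) t (cst 0) (fun y => (W k)^-1 * envelope k y) y))//.
- by apply: eq_integral => x _; rewrite osc_source_divergence.
- exact: compact_supp_ball.
- by apply: subset_trans bV; exact: supp_ball_box.
- move=> i; apply: (CkZ _ oV); apply: (Ck_osc _ _ _ oV); first exact: Ck_cst.
  by apply: (CkZ _ oV); exact: Ck_envelope.
- by move=> i x _ nQ; rewrite /osc envelope_off// !mulr0 addr0 mulr0.
Qed.

Lemma square_integrable k (F : 'rV[R]_n -> R) : Ck 0 setT F ->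
  (forall x, ~ supp_ball k x -> F x = 0) ->
  (\int[leb]_x (F x ^+ 2)%:E = (\int[leb]_x (F x ^+ 2))%:E)%E.
Proof.
move=> cF F0; pose F2 x := F x ^+ 2.
have cF2 : Ck 0 setT F2 by exact: (CkM openT cF cF).
have ct : continuous F2 by move=> x; exact: (Ck_continuous cF2).
have F20 x : ~ box x0 (c k)^-1 x -> F2 x = 0.
  by move=> nb; rewrite /F2 F0 ?expr0n// => /supp_ball_box.
have [C FC] := continuous_box_bounded ct F20.
have mF2 : measurable_fun setT (F2 : borel 'rV[R]_n -> R).
  by apply: continuous_borel_real; [exact: openT|move=> x _; exact: ct].
have ck0 : 0 <= (c k)^-1 by rewrite invr_ge0 ltW.
have iF := integrable_bounded_box mF2 ck0 F20 FC.
by rewrite /Rintegral fineK//; apply: integrable_fin_num.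
Qed.

Definition norm_source t k : R := \int[leb]_x (osc_source t k x ^+ 2).

Lemma norm_sourceE t k : (\int[leb]_x (osc_source t k x ^+ 2)%:E = (norm_source t k)%:E)%E.
Proof.
apply: (@square_integrable k); first exact: Ck_osc_source openT.
by move=> x; exact: osc_source_off.
Qed.

(** Cosine and sine are exchanged between the two phases, so the sum of the two
    squares no longer oscillates. *)
Lemma norm_source_quarter k :
  \int[leb]_x (envelope k x ^+ 2) <= norm_source 0 k + norm_source (- (pi / 2)) k.
Proof.
have ms F : Ck 0 setT F -> measurable_fun setT ((fun x => (F x ^+ 2)%:E) : borel 'rV[R]_n -> \bar R).
  move=> cF; apply/measurable_EFinP; apply: (Ck_measurable openT).
  exact: (CkM openT cF cF).
rewrite -lee_fin EFinD -!norm_sourceE -(@square_integrable k); last 2 first.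
- exact: Ck_envelope openT.
- by move=> x; exact: envelope_off.
rewrite -ge0_integralD//; last 4 first.
- by move=> x _; rewrite lee_fin sqr_ge0.
- by apply: ms; exact: Ck_osc_source openT.
- by move=> x _; rewrite lee_fin sqr_ge0.
- by apply: ms; exact: Ck_osc_source openT.
apply: ge0_le_integral => //.
- by move=> x _; rewrite lee_fin sqr_ge0.
- by apply: ms; exact: Ck_envelope openT.
- by apply: emeasurable_funD; apply: ms; exact: Ck_osc_source openT.
move=> x _; rewrite -EFinD lee_fin !osc_sourceE.
have P : phase alpha (W k) (- (pi / 2)) x = phase alpha (W k) 0 x - pi / 2.
  by rewrite /phase addr0.
rewrite P cosB sinB cos_pihalf sin_pihalf.
move: (W k)^-1 (\sum_i _) (envelope k x) => w S y.
have := cos2Dsin2 (phase alpha (W k) 0 x).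
move: (cos _) (sin _) => C D CD.
rewrite [leRHS](_ : _ = (C ^+ 2 + D ^+ 2) * (y ^+ 2 + (w * S) ^+ 2)); last by ring.
by rewrite CD mul1r lerDl sqr_ge0.
Qed.

(** By scaling: the bump is bounded below on a fixed proportion of its support. *)
Lemma norm_envelope_lower : exists2 kap : R, 0 < kap &
  forall k, kap * (c k) ^- n <= \int[leb]_x (envelope k x ^+ 2).
Proof.
pose E : 'rV[R]_n -> R := ball_bump 0 1.
have cE : continuous E.
  by move=> x; apply: (Ck_continuous (Ck_ball_bump 0 0 1 (@openT _ )) (I : setT x)).
have E0 : 0 < E 0 by apply: flat0_gt0; rewrite quad_center subr0.
have oV : open [set x | E 0 / 2 < E x].
  exact: (open_comp (fun x _ => cE x) (@open_gt R (E 0 / 2))).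
have [|d d0 hd] := open_sub_box (c := (0 : 'rV[R]_n)) oV; first by rewrite /= gtr_pMr// invf_lt1// ltr1n.
exists ((E 0 / 2) ^+ 2 * (2 * d) ^+ n).
  by rewrite mulr_gt0// exprn_gt0 ?mulr_gt0// divr_gt0.
move=> k; have dk : 0 <= d / c k by rewrite divr_ge0 ?ltW.
have -> : (E 0 / 2) ^+ 2 * (2 * d) ^+ n * c k ^- n = (E 0 / 2) ^+ 2 * (2 * (d / c k)) ^+ n.
  by rewrite -mulrA -exprVn -exprMn mulrA.
rewrite -lee_fin EFinM -(leb_box x0 dk) -(@square_integrable k); last 2 first.
- exact: Ck_envelope openT.
- by move=> x; exact: envelope_off.
have mB := @measurable_box R n x0 (d / c k).
apply: (@le_trans _ _ (\int[leb]_x ((E 0 / 2) ^+ 2 * \1_(box x0 (d / c k)) x)%:E)%E).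
  under eq_integral do rewrite EFinM.
  rewrite ge0_integralZl//; last 2 first.
  - by apply/measurable_EFinP; exact: measurable_indic.
  - by rewrite lee_fin sqr_ge0.
  by rewrite integral_indic//= setIT.
apply: ge0_le_integral => //.
- by move=> x _; rewrite lee_fin mulr_ge0 ?sqr_ge0// indicE.
- by apply/measurable_EFinP; apply: measurable_funM => //; exact: measurable_indic.
- apply/measurable_EFinP; apply: (Ck_measurable openT).
  exact: (CkM openT (Ck_envelope 0 k openT) (Ck_envelope 0 k openT)).
move=> x _; rewrite lee_fin indicE; have [bx|_] := boolP (x \in box x0 (d / c k)); last by rewrite mulr0 sqr_ge0.
rewrite mulr1 lerXn2r ?nnegrE ?envelope_ge0 ?divr_ge0 ?(ltW E0)//.
apply: ltW; apply: (hd (c k *: (x - x0))) => i; rewrite !mxE subr0.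
rewrite inE in bx; have := bx i; rewrite ler_pdivlMr// mulrC => xi.
by rewrite normrM (ger0_norm (ltW (cp k))).
Qed.

End source.

Local Open Scope complex_scope.

(** * Frequency components of a function supported in a chart *)

Section spectral_relation.
Context {R : realType} {n : nat} {M : ptopologicalType}.
Variables (A : set (chart R n M)) (g : chart R n M -> 'rV[R]_n -> 'M[R]_n).
Variable mu : {measure set (borel M) -> \bar R}.
Hypotheses (mM : closed_connected_manifold A) (gM : riemannian_metric A 4 g)
  (muM : volume_measure A g mu).
Local Notation sqint F := ((F : borel M -> R) \in Lfun mu 2%:E).

Lemma sqint1 : sqint (cst 1).
Proof.
apply: sqintI; first exact: measurable_cst.
rewrite (eq_integral (cst 1%E)) => [|p _]; last by rewrite /= expr1n.
by rewrite integral_cst// mul1e; exact: finite_volume mM gM muM.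
Qed.

Variables (lambda : nat -> R) (phi : nat -> M -> R[i]).
Hypothesis eB : eigenbasis A g mu lambda phi.

Lemma L2_one : L2 mu (cst 1).
Proof. exact: L2_rc sqint1. Qed.

Lemma lambda_gt0 j : (1 <= j)%N -> 0 < lambda j.
Proof. by move=> j1; apply: lam_gt0 j1; [exact: eigenvalue1 eB|exact: eigenvalue_ndecr eB]. Qed.

Lemma inner_one_phi j : (1 <= j)%N -> inner mu setT (cst 1) (phi j) = 0.
Proof.
move=> j1; have l0 : lambda j != 0 by rewrite gt_eqF// lambda_gt0.
have [cre cim] : (forall e, A e -> Ck 2 (chart_img e) (fun x => re (phi j) (chart_inv e x))) /\
    (forall e, A e -> Ck 2 (chart_img e) (fun x => im (phi j) (chart_inv e x))).
  split=> e eA; [exact: (eigenfun_C2 eB j eA).1|exact: (eigenfun_C2 eB j eA).2].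
have zr := eigen_mean_zero mM gM muM l0 cre (fun e x eA Ix => (eigenfun_eq eB j eA Ix).1).
have zi := eigen_mean_zero mM gM muM l0 cim (fun e x eA Ix => (eigenfun_eq eB j eA Ix).2).
rewrite (inner_rc (F := cst 1) sqint1 (eigenfun_L2 eB j)) /ip /Rintegral.
under eq_integral do rewrite mul1r; rewrite zr.
by under eq_integral do rewrite mul1r; rewrite zi oppr0.
Qed.

Variable (e : chart R n M).
Hypothesis eA : A e.
Local Notation I := (chart_img e).
Variable K : set 'rV[R]_n.
Hypotheses (cK : compact K) (KI : K `<=` I).

Definition chart_laplace (v : 'rV[R]_n -> R) : M -> R := pull e (laplace_beltrami g e v).

Variable v : 'rV[R]_n -> R.
Hypotheses (cv : Ck 2 I v) (v0 : forall x, I x -> ~ K x -> v x = 0).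

Lemma supported_chart_laplace : supported e K (chart_laplace v).
Proof.
apply: supported_pull => x Ix nK; have oI := @open_img _ _ _ e.
have clK : closed K by apply: compact_closed => //; exact: norm_hausdorff.
rewrite laplace_beltramiE /divgrad big1 ?mulr0// => i _.
apply: (partial_zero_off i clK) Ix nK => y Iy nKy.
rewrite /fluxgrad big1// => j _.
by rewrite (partial_zero_off j clK v0 Iy nKy) mulr0.
Qed.

Lemma Ck_laplace : Ck 0 I (laplace_beltrami g e v).
Proof.
have oI := @open_img _ _ _ e; apply: (CkM oI).
  apply: (CkV oI) => [x Ix|]; last exact: Ck_le (leq0n 4) (Ck_vol gM eA).
  by rewrite gt_eqF// (vol_gt0 gM eA).
apply: Ck_sum => // i _; apply: Ck_partial.
exact: (Ck_fluxgrad gM eA i (k := 1%N) isT cv).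
Qed.

Lemma sqint_pull F : Ck 0 I F -> (forall x, I x -> ~ K x -> F x = 0) -> sqint (pull e F).
Proof.
move=> cF F0; apply: (supported_sqint gM muM eA cK KI); first exact: supported_pull.
exact: Ck_pull.
Qed.

Lemma sqint_chart_laplace : sqint (chart_laplace v).
Proof.
apply: (supported_sqint gM muM eA cK KI supported_chart_laplace).
by apply: Ck_pull; exact: Ck_laplace.
Qed.

(** The symmetry of the Laplacian, where one factor is supported in the chart and
    the other one satisfies the equation of an eigenfunction. *)
Lemma ip_chart_laplace (lam : R) (psi : M -> R) : sqint psi ->
  Ck 2 I (fun x => psi (chart_inv e x)) ->
  (forall x, I x -> - laplace_beltrami g e (fun y => psi (chart_inv e y)) x =
     lam * psi (chart_inv e x)) ->
  ip mu (chart_laplace v) psi = - lam * ip mu (pull e v) psi.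
Proof.
move=> spsi cpsi epsi; have oI := @open_img _ _ _ e.
have sv := sqint_pull (CkW (CkW cv)) v0; have sL := sqint_chart_laplace.
have sD := sqint_add sL (sqint_scale lam sv).
suff : -1 * ip mu (fun p => chart_laplace v p + lam * pull e v p) psi = 0.
  rewrite ipDl//; last exact: sqint_scale.
  by rewrite ipZl// mulN1r => /eqP; rewrite oppr_eq0 addr_eq0 mulNr => /eqP.
rewrite -ipZl//.
pose F p := -1 * (chart_laplace v p + lam * pull e v p) * psi p.
have sF : supported e K F.
  move=> p h; rewrite /F supported_chart_laplace//.
  by rewrite (supported_pull v0)// mulr0 addr0 mulr0 mul0r.
have cF : Ck 0 I (fun x => F (chart_inv e x)).
  apply: (CkM oI); last exact: CkW (CkW cpsi).
  apply: (CkZ _ oI); apply: (CkD oI); first by apply: Ck_pull; exact: Ck_laplace.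
  by apply: (CkZ _ oI); apply: Ck_pull; exact: CkW (CkW cv).
rewrite /ip /Rintegral -/F.
rewrite (chart_integral gM muM eA _ (supported_dom sF)); last first.
  by apply: measurable_funTS; exact: measurable_supported eA sF cF.
rewrite (_ : (\int[_]_(x in _) _)%E = 0%E)//.
rewrite -[RHS](divgrad_symmetric gM eA cK KI v0 cv cpsi).
apply: eq_integral => x /[!inE] Ix; congr EFin.
have vp := vol_gt0 gM eA Ix.
have E : lam * psi (chart_inv e x) = - ((vol g e x)^-1 * divgrad g e (fun y => psi (chart_inv e y)) x).
  by rewrite -epsi// laplace_beltramiE.
rewrite /F /chart_laplace !pull_inv// laplace_beltramiE -mulrA mulrDl [lam * _]mulrC -(mulrA (v x)) E.
move: (vol g e x) vp (divgrad _ _ _ _) (divgrad _ _ _ _) (psi _) (v x) => w w0 *.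
by field; rewrite gt_eqF.
Qed.

(** The definition of the remainder r = h + w Delta v, seen on the eigenfunctions. *)
Lemma inner_remainder (h : 'rV[R]_n -> R) (w : R) j : Ck 0 I h ->
  (forall x, I x -> ~ K x -> h x = 0) ->
  inner mu setT (rc (pull e h)) (phi j) =
  (lambda j * w)%:C * inner mu setT (rc (pull e v)) (phi j) +
  inner mu setT (rc (fun p => pull e h p + w * chart_laplace v p)) (phi j).
Proof.
move=> ch h0; have sh := sqint_pull ch h0; have sv := sqint_pull (CkW (CkW cv)) v0.
have sL := sqint_chart_laplace; have sw := sqint_scale w sL.
have lp := eigenfun_L2 eB j; have [lr li] := lp.
have [cre cim] := eigenfun_C2 eB j eA.
have Er := ip_chart_laplace lr cre (fun x Ix => (eigenfun_eq eB j eA Ix).1).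
have Ei := ip_chart_laplace li cim (fun x Ix => (eigenfun_eq eB j eA Ix).2).
rewrite !inner_rc//; last exact: sqint_add.
rewrite !(ipDl sh sw)// !(ipZl w sL)// Er Ei mulcE addcE.
by apply/eqP; rewrite eq_complex/=; apply/andP; split; apply/eqP; ring.
Qed.

End spectral_relation.

(** * The asymptotics for a given metric *)

Lemma posdef_inv (R : realType) n (G : 'M[R]_n) (v : 'rV[R]_n) : posdef G -> G^T = G ->
  v != 0 -> 0 < (v *m invmx G *m v^T) 0 0.
Proof.
move=> pG sG v0; have uG := posdef_unit pG.
have w0 : v *m invmx G != 0.
  by apply: contraNneq v0 => w0; rewrite -(mulmxKV uG v) w0 mul0mx.
by have := pG _ w0; rewrite mulmxKV// trmx_mul trmx_inv sG mulmxA.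
Qed.

Lemma continuous_at_box (R : realType) n (h : 'rV[R]_n -> R) (x0 : 'rV[R]_n) (eps : R) :
  {for x0, continuous h} -> 0 < eps ->
  exists2 r : R, 0 < r & forall x, box x0 r x -> `|h x - h x0| <= eps.
Proof.
move=> ch e0; have /nbhs_ballP[r /= r0 hr] : \forall x \near x0, `|h x0 - h x| < eps.
  by move/cvgrPdist_lt : ch; exact.
exists (r / 2); first by rewrite divr_gt0.
move=> x bx; rewrite distrC ltW//; apply: hr; split=> // i j; rewrite ord1 /ball/= distrC.
by apply: le_lt_trans (bx j) _; lra.
Qed.

Lemma dist_le_of_between (R : realType) (N t w l : R) :
  (w - t) * l <= N -> N <= (w + t) * l -> `|N - w * l| <= t * l.
Proof.
by rewrite mulrBl mulrDl => h1 h2; rewrite ler_norml; apply/andP; split; lra.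
Qed.

(** The exponent is at least 2. *)
Lemma le_powR_frequency (R : realType) (s x : R) : 0 < s -> s < 1 -> 1 <= x ->
  x <= x `^ (2 / (1 - s)) /\ x ^+ 2 <= x `^ (2 / (1 - s)).
Proof.
move=> s0 s1 x1; have x0 : 0 <= x by exact: le_trans x1.
have e2 : 2 <= 2 / (1 - s) by rewrite ler_pdivlMr ?subr_gt0// ler_piMr// gerBl ltW.
split; last by rewrite -powR_mulrn//; exact: ler_powR.
rewrite -{1}(powRr1 x0); apply: ler_powR => //.
by apply: le_trans e2; rewrite ler1n.
Qed.

Section asymptotics.
Context {R : realType} {n : nat} {M : ptopologicalType}.
Variables (A : set (chart R n M)) (g : chart R n M -> 'rV[R]_n -> 'M[R]_n).
Variable mu : {measure set (borel M) -> \bar R}.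
Hypotheses (gM : riemannian_metric A 4 g)
  (muM : volume_measure A g mu).
Variables (lambda : nat -> R) (phi : nat -> M -> R[i]).
Hypothesis eB : eigenbasis A g mu lambda phi.
Variables (e : chart R n M) (eA : A e).
Local Notation I := (chart_img e).
Variables (s : R) (s0 : 0 < s) (s1 : s < 1).
Variables (alpha : 'rV[R]_n) (halpha : \sum_i alpha 0 i ^+ 2 = 1).

(** The principal symbol of the Laplacian at the covector alpha. *)
Definition symbol x := \sum_i \sum_j invmx (g e x) i j * alpha 0 i * alpha 0 j.

Lemma symbol_gt0 x : I x -> 0 < symbol x.
Proof.
move=> Ix; have a0 : alpha != 0.
  apply/negP => /eqP a0; move/eqP: halpha; rewrite a0 big1 ?(eq_sym 0) ?oner_eq0// => i _.
  by rewrite mxE expr0n.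
have := posdef_inv (metric_posdef gM eA Ix) (Defs.metric_sym gM eA Ix) a0.
rewrite /symbol !mxE; congr (_ < _); rewrite exchange_big; apply: eq_bigr => j _.
by rewrite !mxE mulr_suml; apply: eq_bigr => i _; rewrite (mulrC (alpha _ _)).
Qed.

Lemma tau_symbol x : I x -> \sum_i tau g e alpha i x * alpha 0 i = vol g e x * symbol x.
Proof.
move=> Ix; rewrite mulr_sumr; apply: eq_bigr => i _; rewrite /tau mulr_suml mulr_sumr.
by apply: eq_bigr => j _; rewrite /flux; ring.
Qed.

Lemma Ck_symbol : Ck 4 I symbol.
Proof.
have oI := @open_img _ _ _ e; apply: Ck_sum => // i _; apply: Ck_sum => // j _.
apply: (CkM oI _ (@Ck_cst _ _ 4 I (alpha 0 j))); apply: (CkM oI _ (@Ck_cst _ _ 4 I (alpha 0 i))).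
exact: (Ck_invmx gM eA).
Qed.

Lemma divgradZ (a : R) w x : Ck 2 I w -> I x ->
  divgrad g e (fun y => a * w y) x = a * divgrad g e w x.
Proof.
move=> cw Ix; have oI := @open_img _ _ _ e; have Ix' : x \in I by rewrite inE.
rewrite /divgrad mulr_sumr; apply: eq_bigr => i _.
have cf : Ck 1 I (fluxgrad g e w i) by exact: (Ck_fluxgrad gM eA i (k := 1%N) isT cw).
rewrite -(partialZ a i cf Ix'); apply: (partial_eq i oI _ Ix') => y Iy.
rewrite /fluxgrad mulr_sumr; apply: eq_bigr => j _.
by rewrite (partialZ a j (CkW cw) Iy) mulrCA.
Qed.

Variables (x0 : 'rV[R]_n) (r0 : R) (r0_gt0 : 0 < r0) (bI : box x0 r0 `<=` I).
Variables (c t : nat -> R) (c1 : forall k, 1 <= c k) (cr : forall k, (c k)^-1 < r0).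
Hypothesis coo : c k @[k --> \oo] --> +oo.
Let W k := c k `^ (2 / (1 - s)).
Local Notation f k := (osc_source alpha c W x0 (t k) k).
Local Notation L k := (norm_source alpha c W x0 (t k) k).
Variables (kap : R) (kap0 : 0 < kap) (Lkap : forall k, kap * c k ^- n <= L k).

Let c0 k : 0 < c k := lt_le_trans ltr01 (c1 k).
Let W0 k : 0 < W k. Proof. by rewrite powR_gt0. Qed.
Let cW k : c k <= W k. Proof. exact: (le_powR_frequency s0 s1 (c1 k)).1. Qed.
Let c2W k : c k ^+ 2 <= W k. Proof. exact: (le_powR_frequency s0 s1 (c1 k)).2. Qed.
Let WsW k : W k `^ s / W k * c k = (c k)^-1.
Proof.
have w0 := W0 k; rewrite -(powR_inv1 (ltW w0)) -powRD ?(gt_eqF w0) ?implybT//.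
rewrite /W -powRrM -{2}(powRr1 (ltW (c0 k))) -powRD ?(gt_eqF (c0 k)) ?implybT//.
rewrite -(powR_inv1 (ltW (c0 k))); congr (_ `^ _).
by have : 1 - s != 0 by [rewrite gt_eqF ?subr_gt0]; move=> ?; field.
Qed.

Definition source_density k (a : R) x := a * f k x / vol g e x.

Let supp_sub k : supp_ball c x0 k `<=` box x0 r0.
Proof. by move=> x /(supp_ball_box c1) bx i; apply: le_trans (bx i) (ltW (cr k)). Qed.
Let supp_I k : supp_ball c x0 k `<=` I := subset_trans (@supp_sub k) bI.

Let q x := (\sum_i tau g e alpha i x * alpha 0 i)^-1.

(** This is spectral_estimate, with the errors that wave_remainder and the
    continuity of the symbol provide. The bound holds for all amplitudes a at
    once, because a will depend on k. *)
Lemma pairing_estimate (eps : R) : 0 < eps -> \forall k \near \oo, forall (a : R) (u : M -> R[i]),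
  frac_laplacian mu lambda phi s u (rc (pull e (source_density k a))) ->
  complex.Im (inner mu setT (rc (pull e (source_density k a))) u) = 0 /\
  `|W k `^ (2 * s) * complex.Re (inner mu setT (rc (pull e (source_density k a))) u) -
    symbol x0 `^ (- s) * (vol g e x0)^-1 * (a ^+ 2 * L k)| <= eps * (a ^+ 2 * L k).
Proof.
move=> eps0; have oI := @open_img _ _ _ e; have cbox := @compact_box _ _ x0 r0.
have Ix0 : I x0 by apply: bI => i; rewrite subrr normr0 ltW.
have cvol := Ck_le (leq0n 4) (Ck_vol gM eA).
have vol0 x : I x -> vol g e x != 0 by move=> Ix; rewrite gt_eqF// (vol_gt0 gM eA).
have sym0 x : I x -> symbol x != 0 by move=> Ix; rewrite gt_eqF// symbol_gt0.
have cvoli : Ck 0 I (fun x => (vol g e x)^-1) by exact: (CkV oI vol0).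
have csymi : Ck 0 I (fun x => (symbol x)^-1) by apply: (CkV oI sym0); exact: Ck_le Ck_symbol.
have [Vb Vb0 hVb] := Ck_bounded cbox bI cvol.
have [Vi Vi0 hVi] := Ck_bounded cbox bI cvoli.
have [P P0 hP] := Ck_bounded cbox bI csymi.
pose U := ball x0 r0.
have oU : open U by exact: ball_open.
have UK : U `<=` box x0 r0 by move=> x [_ hx] i; rewrite distrC ltW//; exact: hx.
have suppU k : supp_ball c x0 k `<=` U.
  move=> x /(supp_ball_box c1) bx; split=> // i j; rewrite ord1 /ball/= distrC.
  exact: le_lt_trans (bx j) (cr k).
have cq : Ck 4 I q.
  apply: (CkV oI) => [x Ix|].
    by rewrite tau_symbol// mulf_neq0 ?vol0 ?sym0.
  apply: Ck_sum => // i _; apply: (CkM oI _ (@Ck_cst _ _ 4 I (alpha 0 i))).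
  apply: Ck_sum => // j _; apply: (CkM oI _ (@Ck_cst _ _ 4 I (alpha 0 j))).
  exact: (Ck_flux gM eA).
have qE x : U x -> q x * (\sum_i tau g e alpha i x * alpha 0 i) = 1.
  move=> /UK/bI Ix; rewrite /q mulVf// tau_symbol// mulf_neq0 ?vol0 ?sym0//.
have [C1 hC1] := wave_remainder gM eA oU cbox UK bI t c1 cW x0
  (Ck_ball_bump 3 0 1 openT) (fun x => ball_bump_off_box ltr01) (Ck_le (isT : (2 <= 4)%N) cq) qE.
pose sy := symbol x0; have sy0 : 0 < sy by exact: symbol_gt0.
pose ss := sy `^ (- s); have ss0 : 0 < ss by rewrite powR_gt0.
pose w0 := (vol g e x0)^-1; have w00 : 0 < w0 by rewrite invr_gt0 (vol_gt0 gM eA).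
pose l1 := lambda 1%N; have l10 : 0 < l1 by exact: eigenvalue1 eB.
(* D bounds the ratio of the norms of r and h, up to c / W: the former is bounded
   uniformly on a box of side 2 / c, the latter is bounded below by Lkap. *)
pose B := Vb ^+ 2 * Vi ^+ 2 * C1 ^+ 2 * 2 ^+ n / kap.
have B0 : 0 <= B.
  apply: divr_ge0 (ltW kap0); apply: mulr_ge0; last exact: exprn_ge0.
  by apply: mulr_ge0 (sqr_ge0 _); apply: mulr_ge0; exact: sqr_ge0.
pose D := Num.sqrt (B + 1); have D0 : 0 < D by rewrite sqrtr_gt0 ltr_wpDl.
have D2 : D ^+ 2 = B + 1 by rewrite sqr_sqrtr// addr_ge0.
pose G1 := ss * (sy + sy * (D * P) + (sy / l1) `^ s * D ^+ 2).
have G10 : 0 <= G1.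
  rewrite mulr_ge0 ?(ltW ss0)// !addr_ge0 ?(ltW sy0)//.
    by rewrite !mulr_ge0 ?(ltW sy0) ?(ltW D0) ?(ltW P0).
  by rewrite mulr_ge0 ?sqr_ge0 ?powR_ge0.
have G20 : 0 < G1 * (w0 + 1) + ss by rewrite ltr_wpDl// mulr_ge0// addr_ge0 ?(ltW w00).
(* th is the accuracy required of the symbol, of the density and of 1 / c; up to
   the factor G1 it is also the error of spectral_estimate. *)
have [th [th0 th1 thw the]] : exists th,
    [/\ 0 < th, th <= 1, th <= w0 & th * (G1 * (w0 + 1) + ss) <= eps].
  exists (Num.min 1 (Num.min w0 (eps / (G1 * (w0 + 1) + ss)))); split.
  - by rewrite !lt_min ltr01 w00 divr_gt0.
  - by rewrite ge_min lexx.
  - by rewrite !ge_min lexx orbT.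
  - by rewrite -ler_pdivlMr// !ge_min lexx !orbT.
have [r1 r10 hr1] := continuous_at_box (Ck_continuous csymi Ix0) th0.
have [r2 r20 hr2] := continuous_at_box (Ck_continuous cvoli Ix0) th0.
have cinv : \forall k \near \oo, (c k)^-1 <= Num.min th (Num.min r1 r2).
  have m0 : 0 < Num.min th (Num.min r1 r2) by rewrite !lt_min th0 r10 r20.
  have : \forall k \near \oo, (Num.min th (Num.min r1 r2))^-1 <= c k.
    by move/cvgryPge : coo; exact.
  by apply: filterS => k; rewrite invf_ple// posrE.
apply: filterS cinv => k; rewrite !le_min => /and3P[cth cr1 cr2] a u fl.
have cK := compact_supp_ball c1 (x0 := x0) (k := k).
have fI m : Ck m I (f k) by exact: Ck_osc_source.
have f0 x : ~ supp_ball c x0 k x -> f k x = 0 by exact: osc_source_off.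
pose h := source_density k a; pose v x := a * (q x * f k x).
have ch : Ck 0 I h by apply: (CkM oI _ cvoli); exact: (CkZ a oI (fI 0%N)).
have h0 x : I x -> ~ supp_ball c x0 k x -> h x = 0.
  by move=> _ nQ; rewrite /h /source_density f0// mulr0 mul0r.
have cqf : Ck 2 I (fun x => q x * f k x) by exact: (CkM oI (CkW (CkW cq)) (fI 2%N)).
have cv : Ck 2 I v by exact: (CkZ a oI cqf).
have v0 x : I x -> ~ supp_ball c x0 k x -> v x = 0.
  by move=> _ nQ; rewrite /v f0// !mulr0.
have sh := sqint_pull gM muM eA cK (@supp_I k) ch h0.
have sv := sqint_pull gM muM eA cK (@supp_I k) (CkW (CkW cv)) v0.
have sL := sqint_chart_laplace gM muM eA cK (@supp_I k) cv v0.
have vh x : I x -> v x = (symbol x)^-1 * h x.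
  move=> Ix; rewrite /v /h /source_density /q tau_symbol//.
  by move: (vol g e x) (vol0 _ Ix) (symbol x) (sym0 _ Ix) => w w1 y y1; field; rewrite ?w1 ?y1.
pose r p := pull e h p + W k ^- 2 * chart_laplace g e v p.
have lu : L2 mu u by have [] := fl.
set Nh := nrm2 mu (rc (pull e h)).
have N1 : nrm2 mu (rc (pull e v)) <= P ^+ 2 * Nh.
  apply: nrm2_rc_le => // p; rewrite /pull; case: ifPn => [/[!inE] Dp|_]; last by rewrite normr0 mulr0.
  have Ip := chart_img_in Dp; rewrite vh// normrM.
  have [Qp|nQ] := pselect (supp_ball c x0 k (e p)).
    by rewrite ler_wpM2r//; apply: hP; exact: supp_sub Qp.
  by rewrite h0// normr0 !mulr0.
have N3 : nrm2 mu (fun p => rc (pull e v) p - sy^-1%:C * rc (pull e h) p) <= th ^+ 2 * Nh.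
  rewrite (_ : (fun p => _) = rc (fun p => pull e v p - sy^-1 * pull e h p)); last first.
    by apply/funext => p; rewrite /rc rmorphB rmorphM.
  apply: nrm2_rc_le => //; first by apply: sqint_sub => //; exact: sqint_scale.
  move=> p; rewrite /pull; case: ifPn => [/[!inE] Dp|_]; last by rewrite !mulr0 subr0 normr0 mulr0.
  have Ip := chart_img_in Dp; rewrite vh// -mulrBl normrM.
  have [Qp|nQ] := pselect (supp_ball c x0 k (e p)).
    rewrite ler_wpM2r//; apply: hr1 => i.
    by apply: le_trans cr1; exact: (supp_ball_box c1 Qp i).
  by rewrite h0// normr0 !mulr0.
have AL0 : 0 <= a ^+ 2 * L k.
  rewrite mulr_ge0 ?sqr_ge0// (le_trans _ (Lkap k))// mulr_ge0 ?(ltW kap0)// invr_ge0.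
  by rewrite exprn_ge0 ?(ltW (c0 k)).
have dens (w1 w2 : R) : 0 <= w1 -> 0 <= w2 ->
    (forall x, supp_ball c x0 k x -> w1 <= (vol g e x)^-1 <= w2) ->
    w1 * (a ^+ 2 * L k) <= Nh <= w2 * (a ^+ 2 * L k).
  move=> w1_0 w2_0 hw; apply: (nrm2_density gM muM eA cK (@supp_I k) (f := fun x => a * f k x)) => //.
  - by apply: (CkZ a openT); exact: Ck_osc_source openT.
  - by move=> x nQ; rewrite f0// mulr0.
  under eq_integral do rewrite exprMn EFinM.
  rewrite ge0_integralZl//; last 3 first.
  - apply/measurable_EFinP; apply: (Ck_measurable (k := 0%N) openT).
    by apply: (CkM openT); exact: Ck_osc_source openT.
  - by move=> x _; rewrite lee_fin sqr_ge0.
  - by rewrite lee_fin sqr_ge0.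
  by rewrite norm_sourceE.
have NhV : Vb^-1 * (a ^+ 2 * L k) <= Nh.
  suff /andP[] : Vb^-1 * (a ^+ 2 * L k) <= Nh <= Vi * (a ^+ 2 * L k) by [].
  apply: dens; [by rewrite invr_ge0 ltW|exact: ltW|].
  move=> x /supp_sub bx; have Ix := bI bx; apply/andP; split.
    rewrite lef_pV2 ?posrE ?(vol_gt0 gM eA)//.
    by apply: le_trans (hVb x bx); exact: ler_norm.
  by apply: le_trans (hVi x bx); exact: ler_norm.
have rsupp : supported e (supp_ball c x0 k) r.
  move=> p hp; rewrite /r (supported_pull h0)// (supported_chart_laplace g cK v0)//.
  by rewrite mulr0 addr0.
have cr0 : Ck 0 I (fun x => r (chart_inv e x)).
  apply: (CkD oI); first exact: Ck_pull.
  by apply: (CkZ _ oI); apply: Ck_pull; exact: (Ck_laplace gM eA cv).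
have rE x : I x -> r (chart_inv e x) = a * (vol g e x)^-1 *
    (f k x + W k ^- 2 * divgrad g e (fun y => q y * f k y) x).
  move=> Ix; rewrite /r /chart_laplace !(pull_inv _ Ix) laplace_beltramiE /v (divgradZ a cqf Ix).
  rewrite /h /source_density.
  by move: (W k ^- 2) (divgrad _ _ _ _) (vol g e x)^-1 (f k x) => *; ring.
have N2 : nrm2 mu (rc r) <= (D * (c k / W k)) ^+ 2 * Nh.
  have ck0 : 0 <= (c k)^-1 by rewrite invr_ge0 ltW.
  apply: (le_trans (@nrm2_box_le _ _ _ _ _ mu e gM muM eA _ cK (@supp_I k) r x0 (c k)^-1
    (`|a| * Vi * (C1 * (c k / W k))) Vb rsupp cr0 ck0 (ltW Vb0) _ _)).
  - move=> x Ix nb; rewrite (supported_off rsupp)// => /(supp_ball_box c1) //.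
  - move=> x Ix bx; have bx0 : box x0 r0 x.
      by move=> i; apply: le_trans (bx i) (ltW (cr k)).
    split; first by apply: le_trans (hVb x bx0); exact: ler_norm.
    rewrite rE// !normrM; apply: ler_pM => //; first by rewrite ler_wpM2l// hVi.
    apply: hC1; split=> // i j; rewrite ord1 /ball/= distrC.
    exact: le_lt_trans (bx j) (cr k).
  have cw2 : 0 <= (c k / W k) ^+ 2 by exact: sqr_ge0.
  rewrite [(D * _) ^+ 2]exprMn D2 -[leRHS]mulrA; apply: (@le_trans _ _ (B * ((c k / W k) ^+ 2 * Nh))); last first.
    rewrite ler_wpM2r ?lerDl// mulr_ge0// nrm2_ge0//.
  apply: (@le_trans _ _ (B * ((c k / W k) ^+ 2 * (Vb^-1 * (a ^+ 2 * (kap * c k ^- n)))))).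
    have alg (V1 V2 C z m p kk aa : R) : V1 != 0 -> kk != 0 ->
      V1 * (aa * V2 * (C * z)) ^+ 2 * (p * m) =
      V1 ^+ 2 * V2 ^+ 2 * C ^+ 2 * p / kk * (z ^+ 2 * (V1^-1 * (aa ^+ 2 * (kk * m)))).
      by move=> V10 kk0; field; rewrite ?V10 ?kk0.
    rewrite [(2 * _) ^+ n]exprMn exprVn (alg Vb Vi C1 (c k / W k) (c k ^- n) (2 ^+ n) kap) ?gt_eqF//.
    by rewrite real_normK ?num_real.
  rewrite ler_wpM2l// ler_wpM2l//; apply: le_trans NhV.
  by rewrite ler_wpM2l ?invr_ge0 ?(ltW Vb0)// ler_wpM2l ?sqr_ge0.
have eps_gt0 : 0 < D * (c k / W k) by rewrite mulr_gt0 ?divr_gt0.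
have hvr j := inner_remainder gM muM eB eA cK (@supp_I k) cv v0 (W k ^- 2) j ch h0.
have [h00 hu] := frac_laplacian_coef (eigenfun_L2 eB) (eigenfun_orthonormal eB) fl.
have lr : L2 mu (rc r) by apply: L2_rc; exact: sqint_add sh (sqint_scale _ sL).
have [imu reu] := spectral_estimate (eigenvalue1 eB) (eigenvalue_ndecr eB) (eigenfun_L2 eB)
  (eigenfun_orthonormal eB) (@eigenfun_complete _ _ _ _ _ _ _ _ eB) s0 s1 sy0 (W0 k)
  (L2_rc sh) (L2_rc sv) lr lu hvr h00 hu eps_gt0 th0 P0 N3 N2 N1.
split=> //.
have /andP[Nh1 Nh2] : (w0 - th) * (a ^+ 2 * L k) <= Nh <= (w0 + th) * (a ^+ 2 * L k).
  apply: dens; [by rewrite subr_ge0|by rewrite addr_ge0 ?(ltW w00) ?(ltW th0)|].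
  move=> x Qx; rewrite -ler_distl; apply: hr2 => i.
  by apply: le_trans cr2; exact: (supp_ball_box c1 Qx i).
have Nh0 : 0 <= Nh by exact: nrm2_ge0.
have cW1 : c k / W k <= (c k)^-1.
  by rewrite ler_pdivrMr// mulrC ler_pdivlMr// -expr2.
have E1 : ss * (sy * th + sy * (D * (c k / W k) * P) +
    (sy * W k ^+ 2 / l1) `^ s * (D * (c k / W k)) ^+ 2) <= G1 * th.
  rewrite /G1 -[leRHS]mulrA; apply: ler_wpM2l; first exact: ltW.
  rewrite [leRHS]mulrDl [X in _ <= X + _]mulrDl; apply: lerD; first apply: lerD => //.
    rewrite -[leRHS]mulrA; apply: ler_wpM2l; first exact: ltW.
    rewrite mulrAC; apply: ler_wpM2l; last exact: le_trans cW1 cth.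
    by rewrite mulr_ge0 ?(ltW D0) ?(ltW P0).
  have -> : (sy * W k ^+ 2 / l1) `^ s = (sy / l1) `^ s * (W k `^ s) ^+ 2.
    rewrite mulrAC powRM ?divr_ge0 ?(ltW sy0) ?(ltW l10) ?sqr_ge0//; congr (_ * _).
    by rewrite expr2 powRM ?(ltW (W0 k))// expr2.
  rewrite -(mulrA (_ `^ s)) -(mulrA (_ `^ s)) ler_wpM2l ?powR_ge0//.
  have -> : (W k `^ s) ^+ 2 * (D * (c k / W k)) ^+ 2 = D ^+ 2 * (W k `^ s / W k * c k) ^+ 2.
    by ring.
  rewrite WsW ler_wpM2l ?sqr_ge0//; apply: le_trans cth.
  by rewrite expr2 ler_piMl ?invr_ge0 ?(ltW (c0 k))// invf_le1.
set Z := W k `^ (2 * s) * _; set AL := a ^+ 2 * L k.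
have -> : Z - ss * w0 * AL = (Z - ss * Nh) + ss * (Nh - w0 * AL) by ring.
apply: le_trans (ler_normD _ _) _.
have Q1 : `|Z - ss * Nh| <= G1 * th * ((w0 + 1) * AL).
  apply: le_trans reu _; apply: ler_pM => //.
  apply: mulr_ge0 (ltW ss0) _; apply: addr_ge0; last first.
    by apply: mulr_ge0; [exact: powR_ge0|exact: sqr_ge0].
  apply: addr_ge0; first by rewrite mulr_ge0 ?(ltW sy0) ?(ltW th0).
  by apply: mulr_ge0 (ltW sy0) _; rewrite mulr_ge0 ?(ltW P0) ?(ltW eps_gt0).
  by apply: le_trans Nh2 _; rewrite ler_wpM2r// lerD2l.
have Q2 : `|ss * (Nh - w0 * AL)| <= ss * (th * AL).
  rewrite normrM (ger0_norm (ltW ss0)) ler_wpM2l ?(ltW ss0)//.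
  exact: dist_le_of_between.
apply: le_trans (lerD Q1 Q2) _.
have -> : G1 * th * ((w0 + 1) * AL) + ss * (th * AL) = th * (G1 * (w0 + 1) + ss) * AL by ring.
by rewrite ler_wpM2r.
Qed.

End asymptotics.

(** * Conclusion *)

Section constants.
Context {R : realType}.

(** The factor cs enters through its absolute value, cs_hat through its square, and
    the integrands of c1 and c2 are nonnegative. *)
Lemma c_tilde_ge0 (s : R) : 0 <= c_tilde s.
Proof.
have i0 (h : R -> R) : 0 <= \int[lebesgue_measure]_(t in `]0, +oo[) (t * h t ^+ 2).
  apply: Rintegral_ge0 => t /=; rewrite in_itv/= andbT => t0.
  by rewrite mulr_ge0 ?sqr_ge0 ?ltW.
apply: mulr_ge0; last by apply: addr_ge0; exact: i0.
by apply: mulr_ge0; rewrite invr_ge0 ?normr_ge0 ?sqr_ge0.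
Qed.

Lemma C_tilde_powR n (s : R) (alpha : 'rV[R]_n) (G : 'M[R]_n) : 0 < s -> 0 < \det G ->
  let a := \sum_i \sum_j invmx G i j * alpha 0 i * alpha 0 j in
  0 < a -> C_tilde s alpha G `^ (- (2 * s)) = a `^ (- s) * (Num.sqrt (\det G))^-1.
Proof.
move=> s0 d0 a a0; set d := \det G in d0 *.
have -> : C_tilde s alpha G = Num.sqrt (d `^ (1 / (2 * s)) * a).
  rewrite /C_tilde; congr Num.sqrt; rewrite /a mulr_sumr; apply: eq_bigr => i _.
  by rewrite mulr_sumr; apply: eq_bigr => j _; rewrite !mulrA.
have dp : 0 < d `^ (1 / (2 * s)) by rewrite powR_gt0.
have s2 : 2 * s != 0 by rewrite mulf_neq0 ?pnatr_eq0// gt_eqF.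
rewrite -powR12_sqrt ?mulr_ge0 ?(ltW dp) ?(ltW a0)// -powRrM.
rewrite (_ : 2^-1 * - (2 * s) = - s); last by field.
rewrite powRM ?(ltW dp) ?(ltW a0)// mulrC -powRrM; congr (_ * _).
rewrite -powR12_sqrt ?(ltW d0)// -powRN; congr (_ `^ _).
by field; rewrite gt_eqF.
Qed.

Lemma cvg_real_complex (x : nat -> R) (l : R) : x k @[k --> \oo] --> l ->
  ((x k)%:C : R[i]^o) @[k --> \oo] --> (l%:C : R[i]^o).
Proof.
move=> /cvgrPdist_lt xl; apply/cvgrPdist_lt => eps; rewrite ltcE/= => /andP[/eqP i0 e0].
have := xl _ e0; apply: filterS => k lx.
rewrite -rmorphB normc_def/= expr0n/= addr0 sqrtr_sqr ltcE/= lx andbT; exact/eqP.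
Qed.

End constants.

Section pairing.
Context {R : realType} {n : nat} {M : ptopologicalType}.
Variables (g : chart R n M -> 'rV[R]_n -> 'M[R]_n) (e : chart R n M).
Variable mu : {measure set (borel M) -> \bar R}.

Lemma sqrt_detE p : sqrt_det g e p = (vol g e (e p))%:C.
Proof. by []. Qed.

Lemma div_sqrt_det (F : 'rV[R]_n -> R) :
  (fun p => rc (pull e F) p / sqrt_det g e p) = rc (pull e (fun x => F x / vol g e x)).
Proof.
apply/funext => p; rewrite sqrt_detE /rc /pull; case: ifPn => _; last by rewrite mul0r.
by rewrite fmorph_div.
Qed.

(** The factor 1 / sqrt(det g) is real, so it may be moved from the second argument
    to the first one, where it turns f into h. *)
Lemma duality_pairing_solution (O : set M) (F : 'rV[R]_n -> R) (u : M -> R[i]) :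
  (forall p, chart_dom e p -> ~ O p -> F (e p) = 0) ->
  duality_pairing mu O (rc (pull e F)) (fun p => (sqrt_det g e p)^-1 * patch (cst 0) O u p) =
  inner mu setT (rc (pull e (fun x => F x / vol g e x))) u.
Proof.
move=> F0; rewrite -div_sqrt_det /duality_pairing /inner.
have E p : (if p \in O then rc (pull e F) p * ((sqrt_det g e p)^-1 * patch (cst 0) O u p)^*%C
    else 0) = rc (pull e F) p / sqrt_det g e p * (u p)^*%C.
  have [Op|nO] := boolP (p \in O).
    rewrite /patch Op rmorphM sqrt_detE -mulrA; congr (_ * (_ * _)).
    by rewrite -fmorphV /= oppr0.
  rewrite (_ : rc (pull e F) p = 0) ?mul0r// /rc /pull; case: ifPn => // /[!inE] Dp.
  by rewrite F0// => Op; move/negP: nO; rewrite inE.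
congr (_ +i* _); rewrite [LHS]Rintegral_mkcond; congr Rintegral; apply/funext => p.
  by rewrite patchE -E; case: ifP.
by rewrite patchE -E; case: ifP.
Qed.

End pairing.

Section test_functions.
Context {R : realType} {n : nat} {M : ptopologicalType}.
Variables (A : set (chart R n M)) (mM : closed_connected_manifold A).
Variables (e : chart R n M) (eA : A e) (O : set M).
Variables (s : R) (s0 : 0 < s) (s1 : s < 1).
Variables (alpha : 'rV[R]_n) (halpha : \sum_i alpha 0 i ^+ 2 = 1).
Variables (x0 : 'rV[R]_n) (r0 : R) (r0_gt0 : 0 < r0).
Hypotheses (bI : box x0 r0 `<=` chart_img e) (bO : forall x, box x0 r0 x -> O (chart_inv e x)).
Variable c : nat -> R.
Hypotheses (c1 : forall k, 1 <= c k) (cr : forall k, (c k)^-1 < r0)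
  (coo : c k @[k --> \oo] --> +oo).
Let hA := manifold_atlas mM.
Let hM := manifold_hausdorff mM.

Definition frequency k := c k `^ (2 / (1 - s)).
Local Notation W := frequency.
Local Notation supp k := (supp_ball c x0 k).

(** One of the two phases keeps at least half of the norm of the envelope. The
    choice does not involve the metric. *)
Definition phase_shift k : R :=
  if 2^-1 * (\int[@leb R n]_x (envelope c x0 k x ^+ 2)) <= norm_source alpha c W x0 0 k
  then 0 else - (pi / 2).

(** The support has radius 1 / c, half of 1 / scale; the margin makes its closure fit
    in the open ball. *)
Definition scale k : R := c k / 2.

(** Chosen so that the squared Lebesgue norm of the source, multiplied by
    scale ^ (2 s + n / 2) and divided by W ^ (2 s), is c_tilde. *)
Definition amplitude k : R := Num.sqrt (c_tilde s * W k `^ (2 * s) *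
  (scale k `^ (2 * s + n%:R / 2))^-1 / norm_source alpha c W x0 (phase_shift k) k).

Definition profile_source k x : R := amplitude k * osc_source alpha c W x0 (phase_shift k) k x.

Definition test_function k : M -> R[i] := rc (pull e (profile_source k)).

Let c0 k : 0 < c k := lt_le_trans ltr01 (c1 k).
Let cW k : c k <= W k. Proof. exact: (le_powR_frequency s0 s1 (c1 k)).1. Qed.

Let scale0 k : 0 < scale k. Proof. by rewrite divr_gt0. Qed.

Let supp_sub k : supp k `<=` box x0 r0.
Proof. by move=> x /(supp_ball_box c1) bx i; apply: le_trans (bx i) (ltW (cr k)). Qed.
Let supp_I k : supp k `<=` chart_img e := subset_trans (@supp_sub k) bI.

Lemma profile_source_off k x : ~ supp k x -> profile_source k x = 0.
Proof. by move=> nQ; rewrite /profile_source osc_source_off// mulr0. Qed.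

Lemma norm_shift_lower : exists2 kap : R, 0 < kap &
  forall k, kap * c k ^- n <= norm_source alpha c W x0 (phase_shift k) k.
Proof.
have [kap kap0 hk] := norm_envelope_lower c1 x0.
exists (2^-1 * kap); first by rewrite mulr_gt0.
move=> k; have q := norm_source_quarter alpha W c1 x0 k.
apply: (@le_trans _ _ (2^-1 * (\int[@leb R n]_x (envelope c x0 k x ^+ 2)))).
  by rewrite -mulrA ler_wpM2l.
move: q; rewrite /phase_shift; set Y := \int[_]_x _; set N0 := norm_source _ _ _ _ 0 _.
case: ifPn => // /negP/negP; rewrite -ltNge; set N1 := norm_source _ _ _ _ _ _.
by move: Y N0 N1 => Y N0 N1; lra.
Qed.

Lemma norm_shift_gt0 k : 0 < norm_source alpha c W x0 (phase_shift k) k.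
Proof.
have [kap kap0 hk] := norm_shift_lower; apply: lt_le_trans (hk k).
by rewrite divr_gt0// exprn_gt0.
Qed.

Lemma scale_cvg : scale k @[k --> \oo] --> +oo.
Proof.
apply/cvgryPge => B; have : \forall k \near \oo, 2 * B <= c k by move/cvgryPge : coo; exact.
by apply: filterS => k h; rewrite /scale ler_pdivlMr// mulrC.
Qed.

Lemma supported_test k : supported e (supp k) (pull e (profile_source k)).
Proof. by apply: supported_pull => x _; exact: profile_source_off. Qed.

Lemma test_function_smooth k : smooth_manifold_fun A (test_function k).
Proof.
move=> m e' e'A; split; last exact: Ck_cst.
apply: (Ck_supported (F := pull e (profile_source k)) hA hM eA e'A
  (compact_supp_ball c1 (x0 := x0) (k := k)) (@supp_I k) (@supported_test k)).
by apply: Ck_pull; apply: (CkZ _ (open_img (e := e))); exact: Ck_osc_source (open_img (e := e)).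
Qed.

Lemma test_function_support k : closure [set p | test_function k p != 0] `<=`
  chart_dom e `&` O `&` e @^-1` euclidean_ball x0 (1 / scale k).
Proof.
have cl := closed_support hM (compact_supp_ball c1 (x0 := x0) (k := k)) (@supp_I k).
apply: (@subset_trans _ (chart_inv e @` supp k)).
  rewrite [X in _ `<=` X]((closure_id _).1 cl); apply: closure_subset => p /eqP np.
  have [Dp Sp] : chart_dom e p /\ supp k (e p).
    by apply: contrapT => h; apply: np; rewrite /test_function /rc supported_test.
  by exists (e p) => //; rewrite chart_mapK.
move=> _ [x Sx <-]; have Ix := supp_I Sx; split; first split.
- exact: chart_inv_dom.
- by apply: bO; exact: supp_sub Sx.
rewrite /= /euclidean_ball/= chart_invK//.
have ck := gt_eqF (c0 k).
have E : \sum_i (x 0 i - x0 0 i) ^+ 2 = (c k) ^- 2 * \sum_i (c k * (x 0 i - x0 0 i)) ^+ 2.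
  rewrite mulr_sumr; apply: eq_bigr => i _; rewrite exprMn mulKf// expf_eq0/= ck//.
apply: (@le_lt_trans _ _ (c k)^-1).
  rewrite -(ger0_norm (_ : 0 <= (c k)^-1)) ?invr_ge0 ?(ltW (c0 k))// -sqrtr_sqr ler_sqrt ?sqr_ge0//.
  by rewrite E exprVn ler_piMr// invr_ge0 sqr_ge0.
by rewrite /scale div1r invf_div ltr_pMl ?invr_gt0// ltr1n.
Qed.

Section metric.
Variables (g : chart R n M -> 'rV[R]_n -> 'M[R]_n).
Variable mu : {measure set (borel M) -> \bar R}.
Hypotheses (gM : riemannian_metric A 4 g) (muM : volume_measure A g mu).
Variables (lambda : nat -> R) (phi : nat -> M -> R[i]).
Hypothesis eB : eigenbasis A g mu lambda phi.
Local Notation I := (chart_img e).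

Local Notation h k := (rc (pull e (fun x => profile_source k x / vol g e x))).

Lemma test_function_mean k : inner mu setT (h k) (cst 1) = 0.
Proof.
have oI := @open_img _ _ _ e; have cK := compact_supp_ball c1 (x0 := x0) (k := k).
have cvi : Ck 0 I (fun x => (vol g e x)^-1).
  apply: (CkV oI) => [x Ix|]; first by rewrite gt_eqF// (vol_gt0 gM eA).
  exact: Ck_le (leq0n 4) (Ck_vol gM eA).
pose F x := osc_source alpha c W x0 (phase_shift k) k x / vol g e x.
have cF : Ck 0 I F by apply: (CkM oI _ cvi); exact: Ck_osc_source oI.
have F0 x : ~ supp k x -> F x = 0 by move=> nQ; rewrite /F osc_source_off// mul0r.
have sF : supported e (supp k) (pull e F) by apply: supported_pull => x _; exact: F0.
have sqF := sqint_pull gM muM eA cK (@supp_I k) cF (fun x _ => @F0 x).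
have sq1 := sqint1 mM gM muM.
have hE : pull e (fun x => profile_source k x / vol g e x) = fun p => amplitude k * pull e F p.
  apply/funext => p; rewrite /pull; case: ifPn => _; last by rewrite mulr0.
  by rewrite /profile_source /F mulrA.
rewrite hE inner_rc; [|exact: sqint_scale|exact: L2_rc].
have -> : im (cst 1 : M -> R[i]) = cst 0 by [].
rewrite [ip mu _ (cst 0)]ipC ip0 oppr0 ipZl// [X in _ * X](_ : _ = 0) ?mulr0//.
rewrite /ip /Rintegral; under eq_integral do rewrite mulr1.
rewrite (chart_integral gM muM eA _ (supported_dom sF)); last first.
  by apply: measurable_funTS; apply: (measurable_supported eA sF); exact: Ck_pull.
rewrite (_ : (\int[_]_(x in _) _)%E = 0%E)//.
rewrite -[RHS](osc_source_mean halpha c1 cW (x0 := x0) (phase_shift k) (k := k) oI); last first.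
  by apply: subset_trans bI => x bx i; apply: le_trans (bx i) (ltW (cr k)).
apply: eq_integral => x /[!inE] Ix; rewrite pull_inv// /F mulrC divfK// gt_eqF//.
exact: (vol_gt0 gM eA).
Qed.

Lemma test_function_limit :
  ((scale k `^ (2 * s + n%:R / 2))%:C *
     duality_pairing mu O (test_function k) (fun p => (sqrt_det g e p)^-1 *
       source_to_solution g mu lambda phi s e O (test_function k) p) : R[i]^o)
    @[k --> \oo] -->
  ((c_tilde s * C_tilde s alpha (g e x0) `^ (- (2 * s)))%:C : R[i]^o).
Proof.
have l1 := L2_one mM gM muM.
have one_phi j (j1 : (1 <= j)%N) := inner_one_phi mM gM muM eB j1.
have ecomp := @eigenfun_complete _ _ _ _ _ _ _ _ eB.
have [mean phi0] := mean_phi0 (eigenfun_L2 eB) (eigenfun_orthonormal eB) ecomp l1 one_phi.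
pose u k := xget (cst 0) (solution g mu lambda phi s e (test_function k)).
have lh k : L2 mu (h k).
  apply: L2_rc; apply: (sqint_pull gM muM eA (compact_supp_ball c1 (x0 := x0) (k := k)) (@supp_I k)).
    apply: (CkM (open_img (e := e))).
      by apply: (CkZ _ (open_img (e := e))); exact: Ck_osc_source (open_img (e := e)).
    apply: (CkV (open_img (e := e))) => [x Ix|]; first by rewrite gt_eqF// (vol_gt0 gM eA).
    exact: Ck_le (leq0n 4) (Ck_vol gM eA).
  by move=> x _ nQ; rewrite profile_source_off// mul0r.
have su k : frac_laplacian mu lambda phi s (u k) (h k) /\ inner mu setT (u k) (cst 1) = 0.
  have h0 : inner mu setT (h k) (phi 0) = 0.
    have := test_function_mean k; rewrite mean// => /eqP; rewrite mulf_eq0 => /orP[/eqP//|].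
    by rewrite conjc_eq0 (negbTE phi0).
  have [w fw w0] := frac_laplacian_exists (eigenvalue1 eB) (eigenvalue_ndecr eB)
    (eigenfun_L2 eB) (eigenfun_orthonormal eB) ecomp s0 (lh k) h0.
  have : solution g mu lambda phi s e (test_function k) w.
    split; first by rewrite /test_function div_sqrt_det.
    by rewrite mean ?w0 ?mul0r//; have [] := fw.
  by move=> /xgetI/= - /(_ (cst 0)) []; rewrite /test_function div_sqrt_det.
pose z k := inner mu setT (h k) (u k).
have pz k : duality_pairing mu O (test_function k) (fun p => (sqrt_det g e p)^-1 *
    source_to_solution g mu lambda phi s e O (test_function k) p) = z k.
  apply: duality_pairing_solution => p Dp nO; apply: profile_source_off => Sp.
  by apply: nO; rewrite -(chart_mapK Dp); apply: bO; exact: supp_sub Sp.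
have [kap kap0 hkap] := norm_shift_lower.
have est eps (eps0 : 0 < eps) := pairing_estimate gM muM eB eA s0 s1 halpha r0_gt0 bI
  c1 cr coo kap0 hkap eps0.
pose L k := norm_source alpha c W x0 (phase_shift k) k.
pose B k := scale k `^ (2 * s + n%:R / 2).
have aL k : amplitude k ^+ 2 * L k * (B k * (W k `^ (2 * s))^-1) = c_tilde s.
  have L0 : 0 < L k by exact: norm_shift_gt0.
  have B0 : 0 < B k by rewrite powR_gt0.
  have W0 : 0 < W k `^ (2 * s) by rewrite powR_gt0// powR_gt0.
  rewrite sqr_sqrtr; last first.
    apply: divr_ge0 (ltW L0); apply: divr_ge0 (ltW B0).
    exact: mulr_ge0 (c_tilde_ge0 s) (ltW W0).
  rewrite -/(B k) -/(L k); move: (L k) (B k) (W k `^ _) L0 B0 W0 => x y w x0' y0 w0'.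
  by field; rewrite !gt_eqF.
have Ix0 : I x0 by apply: bI => i; rewrite subrr normr0 ltW.
pose T0 := symbol g e alpha x0 `^ (- s) * (vol g e x0)^-1.
have -> : c_tilde s * C_tilde s alpha (g e x0) `^ (- (2 * s)) = T0 * c_tilde s.
  rewrite C_tilde_powR// ?(metric_det_gt0 gM eA)//; last exact: (symbol_gt0 gM eA halpha).
  by rewrite mulrC.
have [k0 _ imz] : \forall k \near \oo, complex.Im (z k) = 0.
  have := est 1 ltr01; apply: filterS => k /(_ (amplitude k) (u k)) H.
  by have [fu u1] := su k; have [] := H fu.
suff : (B k * complex.Re (z k)) @[k --> \oo] --> T0 * c_tilde s.
  move=> /cvg_real_complex; apply: cvg_trans; apply: near_eq_cvg.
  exists k0 => // k /= kk0; rewrite pz rmorphM/=; congr (_ * _).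
  have real_of w : complex.Im w = 0 -> w = (complex.Re w)%:C :> R[i] by case: w => x y /= ->.
  by symmetry; exact: real_of (imz k kk0).
apply/cvgrPdist_lt => eps eps0.
have ct0 := c_tilde_ge0 s.
have d0 : 0 < eps / (c_tilde s + 1) by rewrite divr_gt0// ltr_wpDl.
have := est _ d0; apply: filterS => k /(_ (amplitude k) (u k)) H.
have [fu u1] := su k; have [_] := H fu.
rewrite -/(z k) -/(W k) -/(L k) -/T0.
have bw : 0 < B k * (W k `^ (2 * s))^-1.
  by rewrite mulr_gt0 ?invr_gt0 ?powR_gt0// powR_gt0.
move=> /(ler_wpM2l (ltW bw)); rewrite -{1}(ger0_norm (ltW bw)) -normrM.
have -> : B k * (W k `^ (2 * s))^-1 * (W k `^ (2 * s) * complex.Re (z k) -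
    T0 * (amplitude k ^+ 2 * L k)) = B k * complex.Re (z k) - T0 * c_tilde s.
  rewrite -(aL k) mulrBr; congr (_ - _); last by ring.
  by rewrite mulrA divfK// gt_eqF// powR_gt0// powR_gt0.
rewrite [X in _ <= X]mulrCA [X in _ <= _ * X]mulrC aL distrC => /le_lt_trans; apply.
rewrite mulrAC ltr_pdivrMr ?ltr_wpDl// ltr_pM2l// ltrDl//.
Qed.

End metric.

End test_functions.

Theorem theorem2 (R : realType) (s : R) (hs0 : 0 < s) (hs1 : s < 1)
    (n : nat) (hn : (2 <= n)%N) (M : ptopologicalType)
    (A : set (chart R n M)) (hM : closed_connected_manifold A)
    (O : set M) (hO : open O) (hO0 : O !=set0)
    (alpha : 'rV[R]_n) (halpha : \sum_i alpha 0 i ^+ 2 = 1)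
    (x0 : M) (hx0 : O x0)
    (e : chart R n M) (he : A e) (hex0 : chart_dom e x0) :
  exists (N : nat -> R) (f : nat -> M -> R[i]),
    [/\ N k @[k --> \oo] --> +oo,
        forall k, smooth_manifold_fun A (f k),
        forall k, closure [set p | f k p != 0] `<=`
          chart_dom e `&` O `&` e @^-1` euclidean_ball (e x0) (1 / N k) &
        forall (g : chart R n M -> 'rV[R]_n -> 'M[R]_n)
          (mu : {measure set (borel M) -> \bar R})
          (lambda : nat -> R) (phi : nat -> M -> R[i]),
          riemannian_metric A 4 g ->
          volume_measure A g mu ->
          eigenbasis A g mu lambda phi ->
          (forall k,
             inner mu setT (fun p => f k p / sqrt_det g e p) (cst 1) = 0) /\
          ((N k `^ (2 * s + n%:R / 2))%:C *
           duality_pairing mu O (f k) (fun p =>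
             (sqrt_det g e p)^-1 *
             source_to_solution g mu lambda phi s e O (f k) p) : R[i]^o)
            @[k --> \oo] -->
          ((c_tilde s * C_tilde s alpha (g e (e x0)) `^ (- (2 * s)))%:C : R[i]^o)].
Proof.
have [|r r0 rV] := open_sub_box (c := e x0) (open_chart_preimage (e := e) hO).
  by split; [exact: chart_img_in|rewrite chart_mapK].
have bI : box (e x0) r `<=` chart_img e by move=> x /rV[].
have bO x : box (e x0) r x -> O (chart_inv e x) by move=> /rV[].
(* r^-1 keeps the supports inside the box of radius r *)
pose c k : R := k%:R + (1 + r^-1).
have r1 : 0 < r^-1 by rewrite invr_gt0.
have c1 k : 1 <= c k.
  by rewrite /c addrCA lerDl addr_ge0// ltW.
have cr k : (c k)^-1 < r.
  have rc : r^-1 < c k by rewrite /c addrA ltrDr ltr_wpDl.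
  by rewrite invf_plt ?posrE// (lt_le_trans ltr01 (c1 k)).
have coo : c k @[k --> \oo] --> +oo.
  apply/cvgryPge => B; have : \forall k \near \oo, B <= k%:R :> R.
    by move/cvgryPge : (@cvgr_idn R); exact.
  by apply: filterS => k h; rewrite /c (le_trans h)// lerDl addr_ge0// ltW.
exists (scale c), (test_function e s alpha (e x0) c); split.
- exact: scale_cvg.
- exact: (test_function_smooth hM he s alpha bI c1 cr).
- by move=> k; exact: (test_function_support hM bI bO c1 cr).
move=> g mu lambda phi gM muM eB; split=> [k|].
  rewrite /test_function div_sqrt_det.
  exact: (test_function_mean hM he hs0 hs1 halpha bI c1 cr gM muM).
exact: (test_function_limit hM he hs0 hs1 halpha r0 bI bO c1 cr coo gM muM eB).
Qed.
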